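(* Let $I$ be a homogeneous ideal of the polynomial ring $\mathbb{C}[z_1,\dots,z_d]$, let $\mathcal{P}_I$ be its closure in the Drury–Arveson space $H_d^2$, let $\mathcal{Q}_I=\mathcal{P}_I^\perp\cong H_d^2/\mathcal{P}_I$, and let $Q$ be the orthogonal projection of $H_d^2$ onto $\mathcal{Q}_I$. Let $S_i=QM_{z_i}|_{\mathcal{Q}_I}$ for $i=1,\dots,d$, where $M_{z_i}f=z_if$ on $H_d^2$, and let $\mathbf{S}=(S_1,\dots,S_d)$, $e=Q1$. Let $\{\mu_k\}$ be the sequence of singular values of the positive compact operator $L_{\mathbf{S},e}$ on the Fock space $F^2$ (its nonzero eigenvalues, repeated according to multiplicity and listed in non-increasing order). Then $$\lim_{k\to\infty}\frac{\ln k}{\ln\ln(1/\mu_k)}=\dim_{\mathbb{C}}Z(I),$$ where $Z(I)=\{z\in\mathbb{C}^d: p(z)=0\ \text{for all } p\in I\}$.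
   Context: The Drury–Arveson space $H_d^2$ is the Hilbert space of analytic functions $f(z)=\sum_{\alpha\in\mathbb{N}_0^d}a_\alpha z^\alpha$ on the open unit ball $\mathbb{B}_d\subset\mathbb{C}^d$ with $\|f\|^2=\sum_\alpha|a_\alpha|^2\frac{\alpha!}{|\alpha|!}<\infty$. The space $\mathcal{P}_I$ is invariant under each coordinate multiplication $M_{z_i}$, and $\mathcal{Q}_I$ is invariant under each $M_{z_i}^*$. A cyclic commuting $d$-tuple $(\mathbf{T},h)$ on a Hilbert space $\mathcal{H}$ is a tuple $\mathbf{T}=(T_1,\dots,T_d)$ of pairwise commuting bounded linear operators on $\mathcal{H}$ together with a vector $h\in\mathcal{H}$ such that $\{p(\mathbf{T})h: p\in\mathbb{C}[z_1,\dots,z_d]\}$ is dense in $\mathcal{H}$. The pair $(\mathbf{S},e)$ is a cyclic commuting $d$-tuple on $\mathcal{Q}_I$. The Fock space $F^2$ is the Hilbert space of entire functions $f$ on $\mathbb{C}^d$ with $\|f\|_{F^2}^2=\int_{\mathbb{C}^d}|f(z)|^2\,\pi^{-d}e^{-|z|^2}\,dm(z)<\infty$, where $m$ is Lebesgue measure. For a cyclic commuting tuple $(\mathbf{T},h)$ on $\mathcal{H}$, define $\iota:F^2\to\mathcal{H}$ by $\iota f=f(\mathbf{T})h$, where $f(\mathbf{T})=\sum_\alpha a_\alpha\mathbf{T}^\alpha$ for $f=\sum_\alpha a_\alpha z^\alpha$. The operator $\iota$ is compact, and $L_{\mathbf{T},h}=\iota^*\iota$ is a positive compact operator on $F^2$.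 *)

(* Defs.v *)
From HB Require Import structures.
From mathcomp Require Import all_boot all_order all_algebra.
From mathcomp Require Import ring_quotient complex.
From mathcomp Require Import (canonicals, coercions) mpoly.
From mathcomp Require Import all_classical all_reals all_analysis.

Set Implicit Arguments.
Unset Strict Implicit.
Unset Printing Implicit Defensive.

Import Order.TTheory GRing.Theory Num.Theory.
Import numFieldNormedType.Exports.

Local Notation normc := ComplexField.Normc.normc.

Local Open Scope classical_set_scope.
Local Open Scope complex_scope.
Local Open Scope ring_scope.

(* [mpoly] is not imported: its notations clash with those of the analysis
   library. *)
Notation multiindex := mpoly.multinom.
Notation polynomials R d := (mpoly.mpoly d R[i]).

(** * Homogeneous ideals, zero loci, dimension *)

Section Algebraic_sets.
Variables (R : realType) (d : nat).
Implicit Types (I J : {pred polynomials R d}).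

(* Ideals are proper: [idealr_closed] includes [1 \notin I]. The unit ideal has
   an empty zero locus and a zero quotient space. *)
Definition homogeneous_ideal I : Prop :=
  idealr_closed I /\
  forall p, p \in I -> forall n, mpoly.pihomog mpoly.mdeg n p \in I.

Definition zero_locus J : set ('I_d -> R[i]) :=
  [set z | forall p, p \in J -> mpoly.meval z p = 0].

Definition zariski_closed (Z : set ('I_d -> R[i])) : Prop :=
  exists J : {pred polynomials R d}, Z = zero_locus J.

Definition zariski_irreducible (Z : set ('I_d -> R[i])) : Prop :=
  Z !=set0 /\
  forall Z1 Z2, zariski_closed Z1 -> zariski_closed Z2 ->
    Z `<=` Z1 `|` Z2 -> Z `<=` Z1 \/ Z `<=` Z2.

(* Complex dimension: the supremum of the lengths [n] of the chains
   W 0 < W 1 < ... < W n of irreducible Zariski closed subsets of Z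
   (-oo if Z is empty). *)
Definition complex_dim (Z : set ('I_d -> R[i])) : \bar R :=
  ereal_sup [set n%:R%:E | n in [set n : nat |
    exists W : nat -> set ('I_d -> R[i]),
      (forall i, (i <= n)%N ->
        [/\ zariski_closed (W i), zariski_irreducible (W i) & W i `<=` Z]) /\
      (forall i, (i < n)%N -> W i `<` W i.+1)]].

End Algebraic_sets.

(** * Hilbert spaces and operators *)

(* A Hilbert space is given by its underlying set of vectors inside an ambient
   complex vector space, and its inner product, linear in the first argument. The
   record carries no axioms: it is only used for the concrete spaces below.
   Only the values of the inner product (and of operators) on [hdom] matter. *)
Record hilbert_space (R : realType) (V : lmodType R[i]) :=
  HilbertSpace { hdom : set V; hinner : V -> V -> R[i] }.

Section Hilbert.
Variables (R : realType) (V : lmodType R[i]) (H : hilbert_space V).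
Implicit Types (A : set V) (x y : V).

Definition hnorm x : R := Num.sqrt (complex.Re (hinner H x x)).

Definition hcvg (u : nat -> V) x : Prop :=
  hdom H x /\ (fun n => hnorm (u n - x)) @ \oo --> (0 : R).

Definition hlim (u : nat -> V) : V := xget 0 [set x | hcvg u x].

Definition hclosure A : set V :=
  [set x | hdom H x /\
    forall eps : R, 0 < eps -> exists2 y, A y & hnorm (x - y) < eps].

Definition hortho A : set V :=
  [set x | hdom H x /\ forall y, A y -> hinner H x y = 0].

(* The orthogonal projection onto a closed subspace A of H *)
Definition hproj A x : V :=
  xget 0 [set y | A y /\ forall z, A z -> hinner H (x - y) z = 0].

Definition hsubspace A : hilbert_space V := HilbertSpace A (hinner H).

Definition eigenspace_of (L : V -> V) (lambda : R[i]) : set V :=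
  [set x | hdom H x /\ L x = lambda *: x].

End Hilbert.

Definition adjoint (R : realType) (V W : lmodType R[i])
    (H : hilbert_space V) (K : hilbert_space W) (A : V -> W) (y : W) : V :=
  xget 0 [set x | hdom H x /\
    forall v, hdom H v -> hinner K (A v) y = hinner H v x].

Section Singular_values.
Variables (R : realType) (V : lmodType R[i]) (H : hilbert_space V).

Definition has_dim (E : set V) (n : nat) : Prop :=
  exists b : 'I_n -> V,
    [/\ forall i, E (b i),
        forall c : 'I_n -> R[i],
          \sum_i c i *: b i = 0 -> forall i, c i = 0
      & forall x, E x -> exists c : 'I_n -> R[i], x = \sum_i c i *: b i].

(* [mu] lists the nonzero eigenvalues of L in non-increasing order, each one
   as often as its multiplicity; if there are finitely many of them, the list
   is continued by zeros. *)
Definition eigenvalue_listing (L : V -> V) (mu : nat -> R) : Prop :=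
  [/\ forall k, 0 <= mu k,
      forall k, mu k.+1 <= mu k
    & forall lambda : R[i], lambda != 0 ->
        exists2 n : nat, has_dim (eigenspace_of H L lambda) n
          & ([set k | (mu k)%:C = lambda] #= `I_n)%card].

(* The sequence of singular values of a positive compact operator; such an
   operator has exactly one eigenvalue listing. *)
Definition singular_values (L : V -> V) : nat -> R :=
  xget (fun=> 0) [set mu | eigenvalue_listing L mu].

End Singular_values.

(** * Power series in d variables *)

Section Power_series.
Variables (R : realType) (d : nat).

(* Analytic functions are identified with their families of Taylor
   coefficients at 0. *)
Definition power_series : Type := multiindex d -> R[i].
HB.instance Definition _ := GRing.Lmodule.on power_series.

Definition series_of_poly (p : polynomials R d) : power_series :=
  fun m => mpoly.mcoeff m p.

(* Sums over all multi-indices, as limits of the sums over |m| < n. They are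
   only used for absolutely convergent families. *)
Definition multisum (F : multiindex d -> R[i]) : R[i] :=
  let s n := \sum_(m : mpoly.bmultinom d n) F (mpoly.bmnm m) in
  lim ((fun n => complex.Re (s n)) @ \oo) +i*
  lim ((fun n => complex.Im (s n)) @ \oo).

Definition monomial (z : 'I_d -> R[i]) (m : multiindex d) : R[i] :=
  \prod_(i < d) z i ^+ m i.

Definition abs_cvg_at (a : power_series) (z : 'I_d -> R[i]) : Prop :=
  (\esum_(m in [set: multiindex d]) (normc (a m * monomial z m))%:E < +oo)%E.

Definition eval_series (a : power_series) (z : 'I_d -> R[i]) : R[i] :=
  multisum (fun m => a m * monomial z m).

Definition sqnorm (z : 'I_d -> R[i]) : R := \sum_(i < d) normc (z i) ^+ 2.

Definition analytic_on_ball (a : power_series) : Prop :=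
  forall z, sqnorm z < 1 -> abs_cvg_at a z.

Definition entire (a : power_series) : Prop := forall z, abs_cvg_at a z.

(* Multiplication by the i-th coordinate *)
Definition mult_coord (i : 'I_d) (a : power_series) : power_series :=
  fun m => if (0 < m i)%N then a (mpoly.mnm_sub m (mpoly.mnm1 i)) else 0.

(** ** The Drury-Arveson space *)

(* m! / |m|! *)
Definition da_weight (m : multiindex d) : R :=
  (\prod_(i < d) (m i)`!)%:R / ((mpoly.mdeg m)`!)%:R.

Definition drury_arveson : hilbert_space power_series :=
  HilbertSpace
    [set a : power_series | analytic_on_ball a /\
      (\esum_(m in [set: multiindex d])
         (normc (a m) ^+ 2 * da_weight m)%:E < +oo)%E]
    (fun a b => multisum (fun m => a m * conjc (b m) * (da_weight m)%:C)).

End Power_series.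

(** * Lebesgue measure on C^d *)

(* A point of C^d is given by the d pairs of real and imaginary parts of its
   coordinates. *)
Notation cplane R := (measurableTypeR R * measurableTypeR R)%type.
Notation cspace R d := (d.-tuple (cplane R)).

Lemma product_sigma_finite d1 d2 (T1 : measurableType d1)
    (T2 : measurableType d2) (R : realType) (m1 : {measure set T1 -> \bar R})
    (m2 : {sigma_finite_measure set T2 -> \bar R}) :
  sigma_finite setT m1 -> sigma_finite setT (m1 \x m2)%E.
Proof.
move=> /sigma_finiteP[F [TF ndF Foo]].
have /sigma_finiteP[G [TG ndG Goo]] := sigma_finiteT m2.
exists (fun n => F n `*` G n).
  rewrite -setXTT TF TG predeqE => -[x y]; split.
    move=> [/= [n _ Fnx] [k _ Gky]]; exists (maxn n k) => //; split.
    - by move: x Fnx; exact/subsetPset/ndF/leq_maxl.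
    - by move: y Gky; exact/subsetPset/ndG/leq_maxr.
  by move=> [n _ []/= ? ?]; split; exists n.
move=> k; have [? ?] := Foo k; have [? ?] := Goo k.
split; first exact: measurableX.
by rewrite product_measure1E// lte_mul_pinfty// ge0_fin_numE.
Qed.

Section Lebesgue_measure_step.
Variables (R : realType) (d : nat).
Variable m : {sigma_finite_measure set (cspace R d) -> \bar R}.

Definition cspace_cons
    (w : cplane R * cspace R d) : cspace R d.+1 :=
  [tuple of w.1 :: w.2].

Lemma measurable_cspace_cons : measurable_fun setT cspace_cons.
Proof. exact: measurable_cons. Qed.

(* The product of Lebesgue measure on C and m *)
Definition lebesgue_step : set (cspace R d.+1) -> \bar R :=
  pushforward
    ((lebesgue_measure \x lebesgue_measure) \x m)%E cspace_cons.

Let step0 : lebesgue_step set0 = 0%E.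
Proof. by rewrite /lebesgue_step /pushforward preimage_set0 measure0. Qed.

Let step_ge0 A : (0 <= lebesgue_step A)%E.
Proof. by rewrite /lebesgue_step /pushforward; exact: measure_ge0. Qed.

Let step_sigma_additive : semi_sigma_additive lebesgue_step.
Proof.
move=> F mF tF mUF; rewrite /lebesgue_step /pushforward preimage_bigcup.
apply: measure_semi_sigma_additive.
- by move=> n; rewrite -[X in measurable X]setTI; exact: measurable_cspace_cons.
- apply/trivIsetP => /= i j _ _ ij; rewrite -preimage_setI.
  by move/trivIsetP : tF => /(_ _ _ _ _ ij) ->//; rewrite preimage_set0.
- rewrite -preimage_bigcup -[X in measurable X]setTI.
  exact: measurable_cspace_cons.
Qed.

HB.instance Definition _ := isMeasure.Build _ _ _ lebesgue_step
  step0 step_ge0 step_sigma_additive.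

Let step_sigma_finite : sigma_finite setT lebesgue_step.
Proof.
have [F TF mF] : sigma_finite setT
    ((lebesgue_measure \x lebesgue_measure) \x m)%E.
  by do 2?apply: product_sigma_finite; exact: sigma_finiteT.
pose uncons (t : cspace R d.+1) := (thead t, [tuple of behead t]).
have consK : cancel cspace_cons uncons.
  by case=> w t; rewrite /uncons theadE; congr (_, _); exact/val_inj.
have unconsK : cancel uncons cspace_cons.
  by move=> t; rewrite /cspace_cons /= -tuple_eta.
exists (fun n => uncons @^-1` F n).
  by rewrite -preimage_bigcup -TF preimage_setT.
move=> n; have [mFn Fn] := mF n; split.
  rewrite -[X in measurable X]setTI.
  have muncons : measurable_fun setT uncons.
    apply: measurable_fun_pair; first exact: measurable_tnth.
    exact: measurable_behead.
  exact: muncons.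
rewrite /= /lebesgue_step /pushforward.
suff -> : cspace_cons @^-1` (uncons @^-1` F n) = F n by [].
by apply/seteqP; split => x /=; rewrite consK.
Qed.

HB.instance Definition _ := Measure_isSigmaFinite.Build _ _ _ lebesgue_step
  step_sigma_finite.

End Lebesgue_measure_step.

Fixpoint lebesgue_cspace (R : realType) (d : nat) :
    {sigma_finite_measure set (cspace R d) -> \bar R} :=
  if d is n.+1 then lebesgue_step (lebesgue_cspace R n)
  else dirac [tuple].

(** * The Fock space *)

Section Fock.
Variables (R : realType) (d : nat).

Definition cpoint (w : cspace R d) : 'I_d -> R[i] :=
  fun i => (tnth w i).1 +i* (tnth w i).2.

Definition gauss_density (w : cspace R d) : R :=
  pi ^- d * expR (- sqnorm (cpoint w)).

Definition fock_inner (a b : power_series R d) : R[i] :=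
  let f w := eval_series a (cpoint w) * conjc (eval_series b (cpoint w)) in
  (\int[lebesgue_cspace R d]_w (complex.Re (f w) * gauss_density w))%R +i*
  (\int[lebesgue_cspace R d]_w (complex.Im (f w) * gauss_density w))%R.

Definition fock_space : hilbert_space (power_series R d) :=
  HilbertSpace
    [set a : power_series R d | entire a /\
      (\int[lebesgue_cspace R d]_w
         (normc (eval_series a (cpoint w)) ^+ 2 * gauss_density w)%:E
       < +oo)%E]
    fock_inner.

(** * The operators attached to a cyclic commuting tuple (T, h) on H *)

Variables (V : lmodType R[i]) (H : hilbert_space V).
Variables (T : 'I_d -> V -> V) (h : V).

(* T_1^(m_1) ... T_d^(m_d) x *)
Definition tuple_power (m : multiindex d) (x : V) : V :=
  foldr (fun i y => iter (m i) (T i) y) x (enum 'I_d).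

(* iota f = f(T) h, the sum of the series of the a_m T^m h in H *)
Definition iota_op (a : power_series R d) : V :=
  hlim H (fun n => \sum_(m : mpoly.bmultinom d n)
    a (mpoly.bmnm m) *: tuple_power (mpoly.bmnm m) h).

Definition L_op : power_series R d -> power_series R d :=
  adjoint fock_space H iota_op \o iota_op.

End Fock.

(** * The quotient module of a homogeneous ideal *)

Section Quotient_module.
Variables (R : realType) (d : nat) (I : {pred polynomials R d}).

Definition P_ideal : set (power_series R d) :=
  hclosure (drury_arveson R d)
    [set a | exists2 p, p \in I & a = series_of_poly p].

Definition Q_ideal : set (power_series R d) :=
  hortho (drury_arveson R d) P_ideal.

Definition Q_space : hilbert_space (power_series R d) :=
  hsubspace (drury_arveson R d) Q_ideal.

Definition Q_proj : power_series R d -> power_series R d :=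
  hproj (drury_arveson R d) Q_ideal.

Definition S_tuple (i : 'I_d) : power_series R d -> power_series R d :=
  Q_proj \o @mult_coord R d i.

Definition e_vector : power_series R d := Q_proj (series_of_poly 1).

End Quotient_module.

(* Main.v *)
(* The operator iota is the degreewise orthogonal projection onto the complement
   of I in the Drury-Arveson space, whose squared norm on homogeneous polynomials
   of degree n is 1 / n! times that of the Fock space.  So L acts on them as 1 / n!
   times a projection of rank H(n) - H(n-1), H(n) being the number of monomials
   of degree at most n that are not leading monomials of I, and
   mu_k >= 1 / n! exactly for k < H(n), if n > 0.  Since lnln n! ~ ln n, the limit is the
   exponent D of the polynomial growth of H.

   D is the largest length of a chain of irreducible closed subsets of Z(I).  A chain
   of length k forces H(n) >= c n^k, because dividing a prime ideal by one more
   element costs a summation of H.  Conversely, if t variables are independent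
   modulo I, then they are so modulo a homogeneous prime ideal P containing I, and
   adding one variable to P leaves t - 1 independent variables; the
   Nullstellensatz, over an uncountable field, turns the resulting chain of primes
   into a chain of irreducible sets.

   The monomials are orthogonal in the Fock space because Lebesgue measure is
   invariant under the rotation by (3 + 4i) / 5, a product of three shears, which
   is not a root of unity; their norms are Gaussian moments. *)

Require Import Defs.
From HB Require Import structures.
From mathcomp Require Import all_boot all_order all_algebra.
From mathcomp Require Import complex zify ring lra.
From mathcomp Require boolp classical_sets functions cardinality finmap reals.
From mathcomp Require mpoly ssrcomplements.

Set Implicit Arguments.
Unset Strict Implicit.
Unset Printing Implicit Defensive.

Import Order.TTheory GRing.Theory Num.Theory.

(* [mpoly] is imported in this module only, as its notations clash with those of
   the analysis library. *)
Module Hilbert_function.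

Import boolp classical_sets functions cardinality finmap reals mpoly ssrcomplements.

Local Open Scope classical_set_scope.
Local Open Scope complex_scope.
Local Open Scope ring_scope.

(** * Ideals of polynomials and truncation by degree *)

Section Ideals.
Variables (d : nat) (K : fieldType).
Local Notation P := {mpoly K[d]}.
Implicit Types (J M : set P) (p q f : P) (m : 'X_{1..d}) (T : {set 'I_d}).

(** D is defined as the largest number of variables in which no leading monomial of I can be
    written. The growth of H and the lengths of chains are both compared with this number, by
    two-sided bounds of order n^D; their constants disappear in the quotient of logarithms.

    On the analytic side, limits, projections, adjoints and the list of singular values are choices
    made by [xget] with a default value, so each of them must be identified by existence and
    uniqueness. Both are reduced to Taylor coefficients: as I is homogeneous, the projection
    commutes with truncation by degree, so iota is computed on polynomials and extended degree by
    degree, and the adjoint is determined by testing against monomials. Adjoint vectors are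
    constructed for eigenvectors only; conversely, L x = lambda x with a nonzero right-hand side
    rules out the default value.

    Degrees 0 and 1 share the eigenvalue 0! = 1! = 1, whence the special treatment of the first
    block of eigenvalues. *)

Definition is_ideal J :=
  [/\ J 0, forall p q, J p -> J q -> J (p + q) & forall p q, J q -> J (p * q)].

Section Ideal_theory.
Variables (J : set P) (idJ : is_ideal J).

Lemma ideal0 : J 0. Proof. by case: idJ. Qed.

Lemma idealD p q : J p -> J q -> J (p + q).
Proof. by case: idJ => _ + _; exact. Qed.

Lemma idealM p q : J q -> J (p * q).
Proof. by case: idJ => _ _; exact. Qed.

Lemma idealZ c p : J p -> J (c *: p).
Proof. by rewrite -mul_mpolyC; exact: idealM. Qed.

Lemma idealN p : J p -> J (- p).
Proof. by rewrite -scaleN1r; exact: idealZ. Qed.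

Lemma idealB p q : J p -> J q -> J (p - q).
Proof. by move=> Jp Jq; apply: idealD => //; exact: idealN. Qed.

Lemma ideal_sum (I : Type) (r : seq I) (Q : pred I) (F : I -> P) :
  (forall i, Q i -> J (F i)) -> J (\sum_(i <- r | Q i) F i).
Proof. by move=> H; elim/big_ind: _; [exact: ideal0|exact: idealD|]. Qed.

Lemma ideal_addr p q : J q -> J (p + q) -> J p.
Proof. by move=> Jq Jpq; rewrite -(addrK q p); exact: idealB. Qed.

End Ideal_theory.

Definition trunc n p : P :=
  \sum_(m <- msupp p | (mdeg m < n)%N) p@_m *: 'X_[m].

Lemma mcoeff_trunc n p m : (trunc n p)@_m = if (mdeg m < n)%N then p@_m else 0.
Proof.
rewrite /trunc -big_filter raddf_sum /=.
under eq_bigr do rewrite mcoeffZ mcoeffX.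
have [mp|mp] := boolP (m \in [seq i <- msupp p | (mdeg i < n)%N]).
  rewrite (bigD1_seq m) ?filter_uniq ?msupp_uniq//= eqxx mulr1 big1 ?addr0.
    by move: mp; rewrite mem_filter => /andP[->].
  by move=> i /negPf ->; rewrite mulr0.
rewrite big_seq big1 => [|i ip]; last first.
  by case: eqP => [im|_]; rewrite ?mulr0//; move: mp; rewrite -im ip.
by move: mp; rewrite mem_filter; case: ltnP => //= _ /memN_msupp_eq0.
Qed.

Fact trunc_is_linear n : linear (trunc n).
Proof.
move=> c p q; apply/mpolyP => m.
by rewrite !(mcoeffD, mcoeffZ, mcoeff_trunc); case: ifP; rewrite ?mulr0 ?addr0.
Qed.

HB.instance Definition _ n :=
  GRing.isLinear.Build K P P _ (trunc n) (trunc_is_linear n).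

Lemma msize_leP n p : reflect (forall m, m \in msupp p -> (mdeg m < n)%N) (msize p <= n)%N.
Proof.
apply: (iffP idP) => [pn m /msize_mdeg_lt /leq_trans-> //|H].
by rewrite msizeE; apply/bigmax_leqP_seq => m mp _; exact: H.
Qed.

Lemma msize_trunc n p : (msize (trunc n p) <= n)%N.
Proof.
apply/msize_leP => m; rewrite mcoeff_msupp mcoeff_trunc.
by case: ifP; rewrite ?eqxx.
Qed.

Lemma trunc_id n p : (msize p <= n)%N -> trunc n p = p.
Proof.
move=> /msize_leP pn; apply/mpolyP => m; rewrite mcoeff_trunc.
case: ltnP => // nm; apply/esym/memN_msupp_eq0.
by apply/negP => /pn; rewrite ltnNge nm.
Qed.

Lemma trunc0n p : trunc 0 p = 0.
Proof. by apply/mpolyP => m; rewrite mcoeff_trunc mcoeff0. Qed.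

Lemma trunc_pihomog n p : trunc n.+1 p - trunc n p = pihomog mdeg n p.
Proof.
rewrite pihomogE; apply/mpolyP => m; rewrite mcoeffB !mcoeff_trunc.
have -> : (\sum_(m0 <- msupp p | mdeg m0 == n) p@_m0 *: 'X_[m0])@_m
   = if mdeg m == n then p@_m else 0.
  rewrite -big_filter raddf_sum /=.
  under eq_bigr do rewrite mcoeffZ mcoeffX.
  have [mp|mp] := boolP (m \in [seq i <- msupp p | mdeg i == n]).
    rewrite (bigD1_seq m) ?filter_uniq ?msupp_uniq//= eqxx mulr1 big1 ?addr0.
      by move: mp; rewrite mem_filter => /andP[->].
    by move=> i /negPf ->; rewrite mulr0.
  rewrite big_seq big1 => [|i ip]; last first.
    by case: eqP => [im|_]; rewrite ?mulr0//; move: mp; rewrite -im ip.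
  by move: mp; rewrite mem_filter; case: eqP => //= _ /memN_msupp_eq0.
by rewrite ltnS leq_eqVlt; case: ltngtP => //= _; rewrite ?subrr ?subr0.
Qed.

Lemma trunc_mulX n s p : trunc n.+1 ('X_s * p) = 'X_s * trunc n p.
Proof.
apply/mpolyP => m; rewrite mcoeff_trunc (mulrC 'X_s p) (mulrC 'X_s).
have [ms|ms] := boolP (U_(s) <= m)%MM; last first.
  suff H q : (q * 'X_s)@_m = 0 by rewrite !H if_same.
  apply/memN_msupp_eq0/negP => /msuppM_le /allpairsP[[a b] /= [_]].
  by rewrite msuppX inE => /eqP -> E; move/negP: ms; apply; rewrite E lem_addl.
rewrite -(submK ms) addmC !mcoeffMX mdegD mdeg1 add1n ltnS.
by rewrite mcoeff_trunc.
Qed.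

(** Homogeneity is expressed by truncations instead of homogeneous components, which are their
    differences: a truncation is linear, compatible with multiplication by a variable, and
    self-adjoint for the inner product [ip]. *)
Definition graded J := forall n p, J p -> J (trunc n p).

(** * Leading monomials and the Hilbert function *)

Definition leading J m := exists p, [/\ J p, p != 0 & mlead p = m].

Definition standard J : pred 'X_{1..d} := fun m => ~~ `[< leading J m >].

Lemma leadingS J M m : J `<=` M -> leading J m -> leading M m.
Proof. by move=> JM [p [/JM ? ? ?]]; exists p. Qed.

Lemma mpolyX_neq0 m : 'X_[m] != 0 :> P.
Proof. by rewrite -msize_poly_eq0 msizeX. Qed.

Lemma leading_le J m m' : is_ideal J -> (m <= m')%MM ->
  leading J m -> leading J m'.
Proof.
move=> idJ mm' [p [Jp p0 pm]]; exists ('X_[m' - m] * p).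
split; [exact: idealM|by rewrite mulf_neq0 ?mpolyX_neq0|].
by rewrite mleadM ?mpolyX_neq0// mleadXm pm submK.
Qed.

Lemma standard_indep J p : J p -> {in msupp p, forall m, standard J m} -> p = 0.
Proof.
move=> Jp std; apply/eqP/negP => /negP p0.
have /negP := std _ (mlead_supp p0); apply.
by apply/asboolP; exists p.
Qed.

(** Division by J, by well-founded induction on the leading monomial. The monomial order refines the
    degree, so neither the part in J nor the remainder exceeds p in degree; hence the standard
    monomials of degree less than n span the polynomials of degree less than n modulo J. *)
Lemma standard_decomp J p : is_ideal J -> exists i s : P,
  [/\ p = i + s, J i, {in msupp s, forall m, standard J m},
      (msize i <= msize p)%N & (msize s <= msize p)%N].
Proof.
move=> idJ; have [->|] := eqVneq p 0.
  exists 0, 0; split; rewrite ?addr0//; first exact: ideal0.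
  by move=> m; rewrite msupp0.
have [m] : exists m, m = mlead p by exists (mlead p).
elim/(well_founded_ind (@ltom_wf d)) : m p => m IH p pm p0.
have rec q : q = p - p@_m *: 'X_[m] -> exists i s : P,
    [/\ q = i + s, J i, {in msupp s, forall m, standard J m},
        (msize i <= msize p)%N & (msize s <= msize p)%N].
  move=> qE; have [->|q0] := eqVneq q 0.
    exists 0, 0; split; rewrite ?addr0 ?mmeasure0//; first exact: ideal0.
    by move=> k; rewrite msupp0.
  have qp : (mlead q < mlead p)%O by rewrite qE pm ltm_mleadD -?pm -?qE.
  have [|i [s [qis Ji std si ss]]] := IH _ _ q erefl q0; first by rewrite pm.
  have qlep : (msize q <= msize p)%N.
    by rewrite -!mlead_deg// ltnS lemc_mdeg// ltW.
  exists i, s; split => //; exact: leq_trans qlep.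
have pmsz : (mdeg m < msize p)%N by rewrite pm mlead_deg.
have [lm|/negPf nlm] := boolP `[< leading J m >]; last first.
  have [i [s [qis Ji std si ss]]] := rec _ erefl.
  exists i, (s + p@_m *: 'X_[m]); split => //.
  - by rewrite addrA -qis subrK.
  - move=> k /msuppD_le; rewrite mem_cat => /orP[/std//|/msuppZ_le].
    by rewrite msuppX inE => /eqP ->; rewrite /standard nlm.
  - rewrite (leq_trans (msizeD_le _ _))// geq_max ss/=.
    by rewrite (leq_trans (msizeZ_le _ _))// msizeX.
have [g [Jg g0 gm]] := asboolW lm.
pose q := p - (p@_m / g@_m) *: g.
have gm0 : g@_m != 0 by rewrite -gm mleadc_eq0.
have gsz : (msize g <= msize p)%N by rewrite -!mlead_deg// gm pm.
have [q0|q0] := eqVneq q 0.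
  exists p, 0; split; rewrite ?addr0 ?mmeasure0//.
    by rewrite (subr0_eq q0); exact: idealZ.
  by move=> k; rewrite msupp0.
have qp : (mlead q < m)%O.
  rewrite lt_neqAle; apply/andP; split.
    apply: contra_neq q0 => qm; apply/eqP; rewrite -mleadc_eq0 qm.
    by rewrite mcoeffB mcoeffZ divfK// subrr.
  rewrite (le_trans (mleadB_le _ _))// leUx -pm lexx/=.
  by rewrite (le_trans (mleadZ_le _ _))// gm pm.
have qlep : (msize q <= msize p)%N.
  by rewrite -!mlead_deg// -pm ltnS lemc_mdeg// ltW.
have [i [s [qis Ji std si ss]]] := IH _ qp q erefl q0.
exists (i + (p@_m / g@_m) *: g), s; split => //.
- by rewrite addrAC -qis subrK.
- by apply: idealD => //; exact: idealZ.
- rewrite (leq_trans (msizeD_le _ _))// geq_max (leq_trans si)//=.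
  by rewrite (leq_trans (msizeZ_le _ _)).
- exact: leq_trans qlep.
Qed.

Lemma standard_comb p n : (msize p <= n)%N -> forall S : pred 'X_{1..d},
  {in msupp p, forall m, S m} ->
  p = \sum_(m : {m : 'X_{1..d < n} | S (bmnm m)}) p@_(val m) *: 'X_[val m].
Proof.
move=> pn S pS; rewrite {1}(mpolywE pn).
rewrite (bigID (fun m : 'X_{1..d < n} => S m)) /= addrC big1 ?add0r; last first.
  move=> m /negP Sm; rewrite memN_msupp_eq0 ?scale0r//.
  by apply/negP => /pS.
rewrite (reindex_omap (val : {m : 'X_{1..d < n} | S (bmnm m)} -> _) insub).
  by apply: eq_bigl => -[m Sm] /=; rewrite insubT Sm /= eqxx.
by move=> m Sm; rewrite insubT.
Qed.

Local Notation stdT J n := {m : 'X_{1..d < n} | standard J (bmnm m)}.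

(** The bound on the degree is strict: [hilb J n.+1] is the affine Hilbert function of J at n, and
    [hilb J 0] is 0. *)
Definition hilb J n : nat := #|{: stdT J n}|.

(** Steinitz inequality in the quotient by J. The comparisons [hilb_prime], [hilb_addX] and
    [hilb_lower] are instances of it. *)
Lemma card_indep_le_span J (I1 I2 : finType) (u : I1 -> P) (v : I2 -> P) :
  is_ideal J ->
  (forall i, exists c : I2 -> K, J (u i - \sum_j c j *: v j)) ->
  (forall c : I1 -> K, J (\sum_i c i *: u i) -> forall i, c i = 0) ->
  (#|I1| <= #|I2|)%N.
Proof.
move=> idJ /choice[A JA] ind; rewrite leqNgt; apply/negP => lt21.
pose B : 'M[K]_(#|I1|, #|I2|) := \matrix_(i, j) A (enum_val i) (enum_val j).
have : kermx B != 0.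
  rewrite kermx_eq0 /row_free neq_ltn; apply/orP; left.
  by rewrite (leq_ltn_trans (rank_leq_col _)).
case/rowV0Pn => x /sub_kermxP xB /eqP x0; apply: x0; apply/rowP => i.
rewrite mxE; pose c i := x 0 (enum_rank i).
have := ind c; move=> /(_ _ (enum_val i)); rewrite /c enum_valK; apply.
have -> : \sum_i c i *: u i =
    \sum_i c i *: (u i - \sum_j A i j *: v j) +
    \sum_j (\sum_i c i * A i j) *: v j.
  under [X in _ + X]eq_bigr do rewrite scaler_suml.
  rewrite exchange_big -big_split; apply: eq_bigr => k _ /=.
  rewrite scalerBr scaler_sumr.
  under [X in _ - X]eq_bigr do rewrite scalerA.
  by rewrite subrK.
apply: idealD => //.
  by apply: ideal_sum => // k _; exact: idealZ.
rewrite big1 => [|j _]; first exact: ideal0.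
have /rowP/(_ (enum_rank j)) := xB; rewrite !mxE => xBj.
rewrite [X in X *: _](_ : _ = 0) ?scale0r// -[RHS]xBj.
rewrite (reindex (@enum_val I1 predT)) /=; last first.
  by apply: onW_bij; exists enum_rank; [exact: enum_valK|exact: enum_rankK].
by apply: eq_bigr => k _; rewrite !mxE enum_rankK /c enum_valK.
Qed.

Lemma hilb_sub J M n : J `<=` M -> (hilb M n <= hilb J n)%N.
Proof.
move=> JM; rewrite /hilb !card_sig; apply/subset_leq_card/fintype.subsetP => m.
rewrite !inE; apply: contra => /asboolP /(leadingS JM) ?; exact/asboolP.
Qed.

Lemma hilb_mono J n n' : (n <= n')%N -> (hilb J n <= hilb J n')%N.
Proof.
move=> nn'; rewrite /hilb.
have H (m : 'X_{1..d < n}) : (mdeg m < n')%N by rewrite (leq_trans (bmdeg m)).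
pose f (x : stdT J (n)) :
   stdT J (n') :=
  exist _ (BMultinom (H (val x))) (valP x).
apply: (leq_card f) => x y /(congr1 (fun z => bmnm (val z))) /= xy.
by apply/val_inj/val_inj.
Qed.

Lemma hilb0 J : hilb J 0 = 0%N.
Proof.
by rewrite /hilb; apply: eq_card0 => -[[m i] p]; have := i.
Qed.

Lemma mcoeff_sub_comb n (S : pred 'X_{1..d})
    (c : {m : 'X_{1..d < n} | S (bmnm m)} -> K) (x : {m : 'X_{1..d < n} | S (bmnm m)}) :
  (\sum_k c k *: 'X_[val k])@_(val x) = c x.
Proof.
rewrite raddf_sum (bigD1 x) //= mcoeffZ mcoeffX eqxx mulr1 big1 ?addr0//.
move=> k km; rewrite mcoeffZ mcoeffX; case: eqP => [E|]; last by rewrite mulr0.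
by move/eqP: km; case; exact/val_inj/val_inj.
Qed.

Lemma msupp_sub_comb n (S : pred 'X_{1..d})
    (c : {m : 'X_{1..d < n} | S (bmnm m)} -> K) :
  {in msupp (\sum_k c k *: 'X_[val k]), forall m, S m}.
Proof.
move=> m; rewrite mcoeff_msupp raddf_sum /=; apply: contraR => Sm.
rewrite big1// => k _; rewrite mcoeffZ mcoeffX; case: eqP => [E|].
  by have := valP k; rewrite E (negPf Sm).
by rewrite mulr0.
Qed.

Lemma standard_comb_eq0 J n (c : stdT J (n) -> K) :
  J (\sum_k c k *: 'X_[val k]) -> forall x, c x = 0.
Proof.
move=> /standard_indep/(_ (@msupp_sub_comb _ _ c)) c0 x.
by rewrite -(mcoeff_sub_comb c) c0 mcoeff0.
Qed.

Lemma standard_span J n p : is_ideal J -> (msize p <= n)%N ->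
  exists c : stdT J (n) -> K,
    J (p - \sum_k c k *: 'X_[val k]).
Proof.
move=> idJ pn; have [i [s [pis Ji std _ ss]]] := standard_decomp p idJ.
exists (fun k => s@_(bmnm (val k))).
by rewrite -standard_comb ?pis ?addrK//; exact: leq_trans pn.
Qed.

Definition prime_ideal J :=
  [/\ is_ideal J, ~ J 1 & forall p q, J (p * q) -> J p \/ J q].

(** The products of f with the standard monomials of J and the standard monomials of M are together
    independent modulo J: the former vanish modulo M, which kills the coefficients of the latter,
    and then f cancels because J is prime. Iterating in n bounds a sum of values of [hilb M] by one
    value of [hilb J]. *)
Lemma hilb_prime J M f e n : prime_ideal J -> is_ideal M -> J `<=` M ->
  M f -> ~ J f -> (msize f <= e.+1)%N ->
  (hilb J n + hilb M (n + e) <= hilb J (n + e))%N.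
Proof.
move=> [idJ J1 prJ] idM JM Mf Jf fe; rewrite -card_sum.
pose u (x : stdT J (n) +
    stdT M (n + e)) : P :=
  match x with inl m => f * 'X_[val m] | inr m => 'X_[val m] end.
apply: (card_indep_le_span (u := u)
  (v := fun x : stdT J (n + e) => 'X_[bmnm (val x)]) idJ).
  case=> m /=; apply: standard_span => //; last first.
    by rewrite msizeX; exact: bmdeg.
  have f0 : f != 0 by apply: contra_not_neq Jf => ->; exact: ideal0.
  rewrite msizeM ?mpolyX_neq0// msizeX.
  have := bmdeg (val m); move: fe; set a := mmeasure _ _; set b := mdeg _.
  by clear; lia.
move=> c; rewrite big_sumType /= => Jc.
have c2 : forall x, c (inr x) = 0.
  apply: (@standard_comb_eq0 M); rewrite addrC in Jc.
  apply: (ideal_addr idM _ (JM _ Jc)); apply: ideal_sum => // m _.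
  by rewrite mulrC; apply: idealZ => //; exact: idealM.
have c1 : forall x, c (inl x) = 0.
  apply: (@standard_comb_eq0 J); rewrite [X in _ + X]big1 ?addr0 in Jc.
    by move: Jc; under eq_bigr do rewrite scalerAr; rewrite -mulr_sumr => /prJ[].
  by move=> m _; rewrite c2 scale0r.
by case.
Qed.

Definition ideal_add J f : set P := [set p | exists j q, J j /\ p = j + f * q].

Lemma ideal_add_ideal J f : is_ideal J -> is_ideal (ideal_add J f).
Proof.
move=> idJ; split.
- by exists 0, 0; rewrite mulr0 addr0; split => //; exact: ideal0.
- move=> _ _ [j [q [Jj ->]]] [j' [q' [Jj' ->]]]; exists (j + j'), (q + q').
  by split; [exact: idealD|rewrite addrACA mulrDr].
- move=> p _ [j [q [Jj ->]]]; exists (p * j), (p * q).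
  by split; [exact: idealM|rewrite mulrDr mulrCA].
Qed.

Lemma sub_ideal_add J f : J `<=` ideal_add J f.
Proof. by move=> p Jp; exists p, 0; rewrite mulr0 addr0. Qed.

Lemma mem_ideal_add J f : is_ideal J -> ideal_add J f f.
Proof. by move=> idJ; exists 0, 1; rewrite mulr1 add0r; split => //; case: idJ. Qed.

Lemma graded_ideal_addX J s : graded J -> graded (ideal_add J 'X_s).
Proof.
move=> grJ [|n] _ [j [q [Jj ->]]].
  by exists (trunc 0 j), 0; rewrite mulr0 addr0 !trunc0n -(trunc0n j); split; auto.
exists (trunc n.+1 j), (trunc n q); split; first exact: grJ.
by rewrite linearD /= trunc_mulX.
Qed.

(** Modulo J, the polynomials of degree at most n are spanned by the standard monomials of J + (X_s)
    and by X_s times the standard monomials of J of degree less than n. *)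
Lemma hilb_addX J s n : is_ideal J -> graded J ->
  (hilb J n.+1 <= hilb (ideal_add J 'X_s) n.+1 + hilb J n)%N.
Proof.
move=> idJ grJ; have idM := ideal_add_ideal 'X_s idJ.
set M := ideal_add _ _ in idM *; rewrite -card_sum.
pose v (x : stdT M (n.+1) +
    stdT J (n)) : P :=
  match x with inl m => 'X_[val m] | inr m => 'X_s * 'X_[val m] end.
apply: (card_indep_le_span 
  (u := fun x : stdT J n.+1 => 'X_[bmnm (val x)]) (v := v) idJ); last first.
  exact: standard_comb_eq0.
move=> m; set p := 'X_[_].
have pn : (msize p <= n.+1)%N by rewrite msizeX; exact: bmdeg.
have [c Mc] := standard_span idM pn; set w := \sum_k _ in Mc.
have wn : (msize w <= n.+1)%N.
  apply/msize_leP => k; rewrite mcoeff_msupp raddf_sum /=; apply: contraR => kn.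
  rewrite big1// => l _; rewrite mcoeffZ mcoeffX; case: eqP => [E|].
    by move: kn; rewrite -E bmdeg.
  by rewrite mulr0.
have [j [q [Jj E]]] := Mc.
have [c' Jc'] := standard_span idJ (msize_trunc n q).
exists (fun x => match x with inl k => c k | inr k => c' k end).
rewrite big_sumType /= opprD addrA -/w.
(* The left side has degree at most n, hence equals its own truncation; truncating j + X_s q keeps j
   in J, as J is graded, and cuts q down to degree less than n. *)
have -> : p - w = trunc n.+1 j + 'X_s * trunc n q.
  rewrite -trunc_mulX -linearD -E /= trunc_id//.
  by rewrite (leq_trans (msizeD_le _ _))// geq_max msizeN pn.
under [X in _ - X]eq_bigr do rewrite scalerAr.
rewrite -mulr_sumr -addrA -mulrBr; apply: idealD => //; last exact: idealM.
exact: grJ.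
Qed.

(** By summing [hilb_addX] over the degrees: adjoining a variable lowers the order of growth by at
    most one. *)
Lemma hilb_le_addX J s n : is_ideal J -> graded J ->
  (hilb J n <= n * hilb (ideal_add J 'X_s) n)%N.
Proof.
move=> idJ grJ; have H k : (k <= n ->
    hilb J k <= k * hilb (ideal_add J 'X_s) n)%N.
  elim: k => [_|k IH kn]; first by rewrite hilb0.
  rewrite (leq_trans (hilb_addX s k idJ grJ))// mulSn leq_add//.
    exact: hilb_mono.
  exact/IH/ltnW.
exact: H.
Qed.

(** * The growth of the Hilbert function *)

Definition supported T m := [forall i, (i \notin T) ==> (m i == 0%N)].

Lemma supportedP T m : reflect (forall i, i \notin T -> m i = 0%N) (supported T m).
Proof.
apply: (iffP forallP) => H i; first by move=> iT; apply/eqP; exact: implyP (H i) iT.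
by apply/implyP => iT; apply/eqP; exact: H.
Qed.

(** Let N exceed all exponents of the chosen leading monomials. A standard monomial has fewer than t
    exponents that are at least N, otherwise one of the leading monomials would divide it. So only t
    - 1 exponents vary with n. The factor n on the left avoids the exponent t - 1, and for t = 0
    there are no standard monomials at all. *)
Lemma hilb_upper J t : is_ideal J ->
  (forall T, #|T| = t -> exists2 m, leading J m & supported T m) ->
  exists C, forall n, (n * hilb J n <= C * n ^ t)%N.
Proof.
move=> idJ lead.
have /choice[mT mTP] : forall T, exists m,
    #|T| = t -> leading J m /\ supported T m.
  move=> T; have [Tt|/eqP nTt] := eqVneq #|T| t; last by exists 0%MM => /nTt.
  by have [m ? ?] := lead T Tt; exists m.
pose N := (\max_(T : {set 'I_d}) mdeg (mT T)).+1.
have NP T i : #|T| = t -> (mT T i < N)%N.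
  move=> _; rewrite ltnS; apply: leq_trans (leq_bigmax T).
  by rewrite mdegE (bigD1 i)//= leq_addr.
pose big m := [set i | (N <= m i)%N]%SET.
have bigP m : standard J m -> (#|big m| < t)%N.
  move=> /negP std; rewrite ltnNge; apply/negP => tm; apply: std; apply/asboolP.
  have [T [TA Tt]] : exists T : {set 'I_d}, T \subset big m /\ #|T| = t.
    exists [set i in take t (enum (big m))]%SET; split.
      apply/fintype.subsetP => i; rewrite inE => /mem_take.
      by rewrite mem_enum.
    rewrite cardsE; have /card_uniqP -> : uniq (take t (enum (big m))).
      by rewrite take_uniq// enum_uniq.
    by rewrite size_takel// -cardE.
  have [lm /supportedP sm] := mTP T Tt.
  apply: leading_le lm => //; apply/mnm_lepP => i.
  have [iT|/sm->//] := boolP (i \in T).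
  move/fintype.subsetP : TA => /(_ i iT); rewrite inE => /(leq_trans _)-> //.
  exact/ltnW/NP.
case: t => [|t] in lead mTP NP bigP *.
  exists 0%N => n; rewrite mul0n leqn0 muln_eq0; apply/orP; right.
  rewrite /hilb; apply/eqP/eq_card0 => -[m std].
  by have := bigP _ std; rewrite ltn0.
exists (2 ^ d * N ^ d)%N => -[|n]; first by rewrite mul0n.
rewrite expnS mulnCA leq_pmul2l//.
(* A monomial is encoded by the positions of its large exponents, its small exponents, and the list
   of at most t large exponents padded with 0. At the large positions the second component holds a
   default value that is never read. *)
pose code (x : stdT J (n.+1)) :
    {set 'I_d} * {ffun 'I_d -> 'I_N} * {ffun 'I_t -> 'I_n.+1} :=
  let m := bmnm (val x) in
  (big m, [ffun i => inord (m i)],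
   [ffun k : 'I_t => inord (nth 0%N [seq m i | i <- enum (big m)] k)]).
have : (hilb J n.+1 <=
    #|{: {set 'I_d} * {ffun 'I_d -> 'I_N} * {ffun 'I_t -> 'I_n.+1}}|)%N.
  apply: (@leq_card _ _ code) => x y [E1 E2 E3].
  apply/val_inj/val_inj/mnmP => i /=.
  set m := bmnm (val x) in E1 E2 E3 *; set m' := bmnm (val y) in E1 E2 E3 *.
  have lt_m (z : stdT J (n.+1)) k :
      (bmnm (val z) k < n.+1)%N.
    rewrite ltnS; have := bmdeg (val z); rewrite ltnS; apply: leq_trans.
    by rewrite mdegE (bigD1 k)//= leq_addr.
  have [iA|iA] := boolP (i \in big m); last first.
    have iA' : i \notin big m' by rewrite -E1.
    move: iA iA'; rewrite !inE -!ltnNge => im im'.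
    move/ffunP : E2 => /(_ i)/(congr1 val); rewrite !ffunE /= !inordK//.
  have iA' : i \in big m' by rewrite -E1.
  have lt_i : (index i (enum (big m)) < t)%N.
    have : (#|big m| <= t)%N by rewrite -ltnS bigP//; exact: valP x.
    by apply: leq_trans; rewrite cardE index_mem mem_enum.
  move/ffunP : E3 => /(_ (Ordinal lt_i)) /(congr1 val); rewrite !ffunE /= -E1.
  rewrite !(nth_map i) ?index_mem ?mem_enum// nth_index ?mem_enum//.
  by rewrite (inordK (lt_m x i)) (inordK (lt_m y i)).
have card_sets : #|{set 'I_d}| = (2 ^ d)%N.
  by rewrite -cardsT -powersetT card_powerset cardsT card_ord.
by rewrite !card_prod card_sets !card_ffun !card_ord.
Qed.

Lemma card_supported T n :
  #|{: {ffun {i | i \in T} -> 'I_n.+1}}| = (n.+1 ^ #|T|)%N.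
Proof. by rewrite card_ffun card_ord card_sig. Qed.

(** The monomials in the variables T with all exponents at most n are independent modulo J, and
    their degree is at most n times the size of T. *)
Lemma hilb_lower J T n : is_ideal J ->
  (forall p, J p -> {in msupp p, forall m, supported T m} -> p = 0) ->
  (n.+1 ^ #|T| <= hilb J (#|T| * n).+1)%N.
Proof.
move=> idJ J0; rewrite -card_supported.
pose e (g : {ffun {i | i \in T} -> 'I_n.+1}) : 'X_{1..d} :=
  [multinom oapp (fun x => nat_of_ord (g x)) 0%N (insub i) | i < d].
have eT g : supported T (e g).
  by apply/supportedP => i iT; rewrite mnmE insubN.
have einj : injective e.
  move=> g h /mnmP gh; apply/ffunP => x; apply/val_inj => /=.
  by have := gh (val x); rewrite !mnmE valK.
have edeg g : (mdeg (e g) < (#|T| * n).+1)%N.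
  rewrite ltnS mdegE (bigID (mem T)) /= [X in (_ + X)%N]big1 ?addn0; last first.
    by move=> i iT; exact/supportedP.
  rewrite -sum_nat_const leq_sum// => i iT; rewrite mnmE insubT /= -ltnS.
  exact: ltn_ord.
apply: (card_indep_le_span (u := fun g => 'X_[e g])
  (v := fun x : stdT J (#|T| * n).+1 => 'X_[bmnm (val x)]) idJ).
  by move=> x; apply: standard_span; rewrite ?msizeX.
move=> c /J0 c0 g.
have {}c0 : \sum_g c g *: 'X_[e g] = 0.
  apply: c0 => m; rewrite mcoeff_msupp raddf_sum /=; apply: contraR => Tm.
  rewrite big1// => h _; rewrite mcoeffZ mcoeffX; case: eqP => [E|].
    by rewrite -E eT in Tm.
  by rewrite mulr0.
move/(congr1 (mcoeff (e g))) : c0; rewrite mcoeff0 raddf_sum (bigD1 g)//=.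
rewrite mcoeffZ mcoeffX eqxx mulr1 big1 ?addr0// => h hg.
by rewrite mcoeffZ mcoeffX (inj_eq einj) (negPf hg) mulr0.
Qed.

(** This implies that J contains no nonzero polynomial in the variables T, but it is stronger, as it
    concerns leading monomials of all of J. It is the negation of the hypothesis of [hilb_upper] at
    T. *)
Definition free_set J T := forall m, supported T m -> ~ leading J m.

Lemma free_set_supported J T p : free_set J T -> J p ->
  {in msupp p, forall m, supported T m} -> p = 0.
Proof.
move=> fT Jp pT; apply/eqP/negP => /negP p0; apply: (fT (mlead p)).
  by apply: pT; exact: mlead_supp.
by exists p.
Qed.

(** T' comes from a comparison of growth and need not be a subset of T: without a free set of this
    size, [hilb_upper] bounds n times the Hilbert function of J + (X_s) by C n^t, hence also that of
    J, against the lower bound of order n^(t+1). *)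
Lemma free_set_addX J s T : is_ideal J -> graded J ->
  (forall p, J p -> {in msupp p, forall m, supported T m} -> p = 0) ->
  (0 < #|T|)%N ->
  exists T', #|T'| = #|T|.-1 /\ free_set (ideal_add J 'X_s) T'.
Proof.
move=> idJ grJ J0 T0; set M := ideal_add _ _; set t := #|T|.-1.
have Tt : #|T| = t.+1 by rewrite prednK.
apply: contrapT => noT'.
have [C MC] : exists C, forall n, (n * hilb M n <= C * n ^ t)%N.
  apply: hilb_upper; first exact: ideal_add_ideal.
  move=> T' T't; apply: contrapT => nl; apply: noT'; exists T'; split => // m T'm lm.
  by apply: nl; exists m.
have H n : (n.+1 ^ t.+1 <= (C * t.+2 ^ t) * n.+1 ^ t)%N.
  have := hilb_lower n idJ J0; rewrite Tt => /leq_trans-> //.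
  rewrite (leq_trans (hilb_le_addX s _ idJ grJ))// (leq_trans (MC _))//.
  rewrite -mulnA leq_mul// -expnMn.
  suff : ((t.+1 * n).+1 <= t.+2 * n.+1)%N.
    by case: (t) => [|t'] //; rewrite leq_exp2r.
  by rewrite mulSn mulnS; lia.
(* After cancellation of the power t, the inequality at this n reads n + 1 <= n. *)
have := H (C * t.+2 ^ t)%N; rewrite expnS leq_pmul2r ?expn_gt0//.
by rewrite ltnn.
Qed.

(** * Prime ideals *)

(* Zorn's lemma; [b] restricts it to graded ideals. *)
Lemma maximal_ideal (b : bool) J (S : set P) : is_ideal J -> (b -> graded J) ->
  (forall p, J p -> ~ S p) ->
  exists M, [/\ is_ideal M, b -> graded M, J `<=` M,
    forall p, M p -> ~ S p
    & forall M', is_ideal M' -> (b -> graded M') -> M `<=` M' ->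
        (forall p, M' p -> ~ S p) -> M' `<=` M].
Proof.
move=> idJ grJ JS.
pose good M := [/\ is_ideal M, b -> graded M, J `<=` M & forall p, M p -> ~ S p].
pose Q : set (set P) := [set M | M = set0 \/ good M].
have [|A [QA maxA]] := @Zorn_bigcup P Q.
  move=> F FQ totF.
  have [[M [FM gM]]|noM] := pselect (exists M, F M /\ good M); last first.
    left; rewrite -subset0 => p [M FM Mp].
    have [M0|gM] := FQ _ FM; first by rewrite M0 in Mp.
    by apply: noM; exists M.
  have gF M' p : F M' -> M' p -> good M'.
    by move=> /FQ[->|].
  right; split.
  - split; first by exists M => //; apply: ideal0; case: gM.
      move=> p q [M1 F1 p1] [M2 F2 q2].
      have [M12|M21] := totF _ _ F1 F2.
        by exists M2 => //; have [? _ _ _] := gF _ _ F2 q2; apply: idealD => //; exact: M12.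
      by exists M1 => //; have [? _ _ _] := gF _ _ F1 p1; apply: idealD => //; exact: M21.
    move=> p q [M1 F1 q1]; exists M1 => //.
    by have [? _ _ _] := gF _ _ F1 q1; exact: idealM.
  - move=> hb n p [M1 F1 p1]; exists M1 => //.
    by have [_ grM1 _ _] := gF _ _ F1 p1; exact: grM1.
  - by move=> p Jp; exists M => //; case: gM => _ _ + _; exact.
  - by move=> p [M1 F1 p1]; have [_ _ _ +] := gF _ _ F1 p1; exact.
have gJ : good J by split.
have gA : good A.
  case: QA => // A0; exfalso; apply: (maxA J); last by right.
  rewrite A0 properEneq; split => //; apply/eqP => J0.
  by have := ideal0 idJ; rewrite -J0.
have [idA grA JA AS] := gA; exists A; split => //.
move=> M' idM' grM' AM' M'S p M'p; apply: contrapT => Ap.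
apply: (maxA M'); last by right; split => // q /JA; exact: AM'.
by split => // M'A; apply: Ap; exact: M'A.
Qed.

(** The classical argument for an ideal maximal among those avoiding a multiplicative set.
    Maximality enters only through the given p and q, so that in the graded case it can be applied
    to homogeneous elements, whose addition keeps the ideal graded. *)
Lemma maximal_avoid_prime M (S : set P) p q : is_ideal M ->
  (forall p, M p -> ~ S p) -> (forall p q, S p -> S q -> S (p * q)) ->
  (~ M p -> exists2 s, ideal_add M p s & S s) ->
  (~ M q -> exists2 s, ideal_add M q s & S s) ->
  M (p * q) -> M p \/ M q.
Proof.
move=> idM MS Smul Hp Hq Mpq; apply: contrapT => /not_orP[Mp Mq].
have [_ [j [u [Mj ->]]] Sp] := Hp Mp.
have [_ [k [v [Mk ->]]] Sq] := Hq Mq.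
apply: (MS _ _ (Smul _ _ Sp Sq)).
rewrite mulrDl; apply: idealD => //; first by rewrite mulrC; exact: idealM.
rewrite mulrDr; apply: idealD => //; first exact: idealM.
by rewrite mulrACA mulrC; exact: idealM.
Qed.

Lemma graded_ideal_add J f n : graded J -> f \is n.-homog ->
  graded (ideal_add J f).
Proof.
move=> grJ hf k _ [j [q [Jj ->]]]; exists (trunc k j), (trunc (k - n) q).
split; first exact: grJ.
rewrite linearD; congr (_ + _); apply/mpolyP => m.
rewrite /= mcoeff_trunc !mcoeffM; case: ltnP => mk.
  apply: eq_bigr => -[[a ha] [c hc]] /= /eqP E; rewrite mcoeff_trunc.
  case: ltnP => // knc; have [an|an] := eqVneq (mdeg a) n; last first.
    by rewrite (dhomog_nemf_coeff hf an) !mul0r.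
  by move: mk knc; rewrite E mdegD an; lia.
rewrite big1// => -[[a ha] [c hc]] /= /eqP E; rewrite mcoeff_trunc.
case: ltnP => knc; last by rewrite mulr0.
have [an|an] := eqVneq (mdeg a) n; last first.
  by rewrite (dhomog_nemf_coeff hf an) !mul0r.
by move: mk knc; rewrite E mdegD an; lia.
Qed.

Lemma homog_top p : p - trunc (msize p).-1 p \is (msize p).-1.-homog.
Proof.
apply/dhomogP => m; rewrite mcoeff_msupp mcoeffB mcoeff_trunc.
case: ltnP => [|le1]; first by rewrite subrr eqxx.
rewrite subr0 -mcoeff_msupp => /msize_mdeg_lt => lt2.
by apply/eqP; rewrite eqn_leq le1 andbT; move: lt2; case: (mmeasure _ _).
Qed.

(** Induction on the sum of the degrees: the product of the top components is the top component of p
    q, hence lies in J. So one of the top components lies in J and can be removed. *)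
Lemma graded_prime J : is_ideal J -> graded J ->
  (forall n1 n2 p q, p \is n1.-homog -> q \is n2.-homog ->
     J (p * q) -> J p \/ J q) ->
  forall p q, J (p * q) -> J p \/ J q.
Proof.
move=> idJ grJ hom p q; have [k] := ubnP (msize p + msize q)%N.
elim: k p q => // k IH p q pqk Jpq.
have [->|p0] := eqVneq p 0; first by left; exact: ideal0.
have [->|q0] := eqVneq q 0; first by right; exact: ideal0.
set p' := trunc (msize p).-1 p; set q' := trunc (msize q).-1 q.
have sp : (0 < msize p)%N by rewrite lt0n msize_poly_eq0.
have sq : (0 < msize q)%N by rewrite lt0n msize_poly_eq0.
have lp : (msize p' < msize p)%N.
  by rewrite (leq_ltn_trans (msize_trunc _ _))// prednK.
have lq : (msize q' < msize q)%N.
  by rewrite (leq_ltn_trans (msize_trunc _ _))// prednK.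
have [] : J (p - p') \/ J (q - q').
- apply: hom (homog_top p) (homog_top q) _.
  set u := p - p'; set v := q - q'.
  (* The remaining terms u q' + p' q have smaller degree, so they are exactly the truncation of p
     q. *)
  have -> : u * v = p * q - trunc ((msize p).-1 + (msize q).-1) (p * q).
    have huv : u * v \is ((msize p).-1 + (msize q).-1).-homog.
      by apply: dhomogM; exact: homog_top.
    have -> : p * q = u * v + (u * q' + p' * q).
      by rewrite addrA -mulrDr subrK -mulrDl subrK.
    have uv0 : trunc ((msize p).-1 + (msize q).-1) (u * v) = 0.
      apply/mpolyP => m; rewrite mcoeff_trunc mcoeff0; case: ltnP => // lm.
      by apply: (dhomog_nemf_coeff huv); rewrite neq_ltn lm.
    rewrite linearD /= uv0 add0r trunc_id ?addrK//; apply/msize_leP => m /msuppD_le.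
    have su : (msize u <= msize p)%N.
      rewrite (leq_trans (msizeD_le _ _))// geq_max leqnn msizeN.
      exact: ltnW.
    have degM (f g : P) n : m \in msupp (f * g) ->
        (msize f + msize g < n.+2)%N -> (mdeg m < n)%N.
      move=> /msuppM_le/allpairsP[[a c] /= [fa gc ->]].
      rewrite mdegD; have := msize_mdeg_lt fa; have := msize_mdeg_lt gc.
      by clear; lia.
    rewrite mem_cat => /orP[] /degM; apply.
      by move: su lq sp sq; clear; lia.
    by move: lp sp sq; clear; lia.
  by apply: idealB => //; exact: grJ.
- move=> Ju; have [||Jp'|Jq] := IH p' q.
  + by move: pqk lp; clear; lia.
  + rewrite -[p'](subKr p) mulrBl; apply: idealB => //.
    by rewrite mulrC; exact: idealM.
  + by left; rewrite -(subrK p' p); exact: idealD.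
  + by right.
- move=> Jv; have [||Jp|Jq'] := IH p q'.
  + by move: pqk lq; clear; lia.
  + by rewrite -[q'](subKr q) mulrBr; apply: idealB => //; exact: idealM.
  + by left.
  + by right; rewrite -(subrK q' q); exact: idealD.
Qed.

(** M is maximal among the graded ideals that contain J and no nonzero polynomial in the variables
    T; these polynomials form a multiplicative set. *)
Lemma prime_graded_extension J T : is_ideal J -> graded J -> free_set J T ->
  exists M, [/\ prime_ideal M, graded M, J `<=` M
    & forall p, M p -> {in msupp p, forall m, supported T m} -> p = 0].
Proof.
move=> idJ grJ fT.
pose S : set P := [set p : P | p <> 0 /\ {in msupp p, forall m, supported T m}].
have [|M [idM grM JM MS maxM]] := @maximal_ideal true J S idJ (fun=> grJ).
  by move=> p Jp [p0 pT]; apply: p0; exact: (free_set_supported fT Jp).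
have {}grM := grM isT.
have Smul p q : S p -> S q -> S (p * q).
  move=> [/eqP p0 pT] [/eqP q0 qT]; split; first by apply/eqP; rewrite mulf_neq0.
  move=> m /msuppM_le/allpairsP[[a c] /= [pa qc ->]].
  apply/supportedP => i iT; rewrite mnmDE.
  by rewrite (supportedP _ _ (pT _ pa))// (supportedP _ _ (qT _ qc)).
exists M; split => //; last first.
  by move=> p Mp pT; apply: contrapT => p0; exact: (MS p).
split => //.
  move=> M1; apply: (MS _ M1); split; first exact/eqP/oner_neq0.
  by move=> m; rewrite msupp1 inE => /eqP ->; apply/supportedP => i _; rewrite mnm0E.
apply: graded_prime => // a b p q hp hq.
have H (f : P) n : f \is n.-homog -> ~ M f -> exists2 s, ideal_add M f s & S s.
  move=> hf Mf; apply: contrapT => no; apply: Mf.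
  apply: (maxM (ideal_add M f)).
  - exact: ideal_add_ideal.
  - by move=> _; exact: graded_ideal_add hf.
  - exact: sub_ideal_add.
  - by move=> s fs Ss; apply: no; exists s.
  - exact: mem_ideal_add.
by apply: (maximal_avoid_prime idM MS Smul); [exact: H hp|exact: H hq].
Qed.

End Ideals.

(** * The Nullstellensatz *)

Section Nullstellensatz.
Variables (d : nat) (K : closedFieldType).
Hypothesis uncountable_K : ~ countable [set: K].
Local Notation P := {mpoly K[d]}.
Implicit Types (J M : set P) (p q f : P).

Lemma prime_ideal_prod M (I : Type) (r : seq I) (F : I -> P) :
  prime_ideal M -> M (\prod_(x <- r) F x) -> exists x, M (F x).
Proof.
move=> [idM M1 prM]; elim: r => [|x r IH]; first by rewrite big_nil.
by rewrite big_cons => /prM[?|/IH//]; exists x.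
Qed.

Lemma prime_ideal_exp M f n : prime_ideal M -> M (f ^+ n) -> M f.
Proof.
move=> [idM M1 prM]; elim: n => [|n IH]; first by rewrite expr0.
by rewrite exprS => /prM[//|/IH].
Qed.

(* Expanding at [k + 1] values of [c] elements [g_c] of bounded degree gives a
   linear relation, i.e. a polynomial relation on the variable [X_i]. *)
Lemma coordinate_mod_prime M f i : prime_ideal M -> ~ M f ->
  (forall c : K, exists n, ideal_add M ('X_i - c%:MP) (f ^+ n)) ->
  exists c : K, M ('X_i - c%:MP).
Proof.
move=> prM Mf H; have [idM M1 mulM] := prM.
have /choice[n /choice[g gP]] : forall c : K, exists n, exists g,
    M (f ^+ n - ('X_i - c%:MP) * g).
  by move=> c; have [n [j [g [Mj E]]]] := H c; exists n, g; rewrite E addrK.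
(* There are uncountably many c but only countably many pairs of an exponent and a size, so
   infinitely many c share one pair. *)
pose F (nk : nat * nat) : set K := [set c | n c = nk.1 /\ msize (g c) = nk.2].
have [[n0 k] infF] : exists nk, infinite_set (F nk).
  apply: contrapT => finF; apply: uncountable_K.
  have -> : [set: K] = \bigcup_(nk in [set: nat * nat]) F nk.
    by apply/seteqP; split => // c _; exists (n c, msize (g c)).
  apply: bigcup_countable => [|nk _]; first exact: countableP.
  by apply: finite_set_countable; apply: contrapT => infF; apply: finF; exists nk.
pose N := #|{: 'X_{1..d < k}}|.
have [B BF NB] := infinite_set_fset N.+1 infF.
pose c (j : 'I_N.+1) : K := nth 0 (enum_fset B) j.
have jB (j : 'I_N.+1) : (j < size (enum_fset B))%N by rewrite (leq_trans _ NB).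
have cinj : injective c.
  move=> a b /eqP; rewrite nth_uniq ?jB ?fset_uniq// => /eqP ab.
  exact/val_inj.
have cF j : F (n0, k) (c j) by apply: BF; rewrite /= mem_nth.
(* The rows are the coefficient vectors of N + 1 polynomials in a space of dimension N; a vector of
   the left kernel is a linear relation between the g_c. *)
pose A : 'M[K]_(N.+1, N) := \matrix_(j, m) (g (c j))@_(bmnm (enum_val m)).
have : kermx A != 0.
  by rewrite kermx_eq0 /row_free neq_ltn ltnS rank_leq_col.
case/rowV0Pn => l /sub_kermxP lA l0.
have {lA} lg : \sum_j l 0 j *: g (c j) = 0.
  apply/mpolyP => m; rewrite mcoeff0 raddf_sum /=.
  have [mk|km] := ltnP (mdeg m) k.
    have /rowP/(_ (enum_rank (BMultinom mk))) := lA; rewrite !mxE => E.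
    rewrite -[RHS]E; apply: eq_bigr => j _.
    by rewrite mcoeffZ !mxE enum_rankK.
  rewrite big1// => j _; rewrite mcoeffZ memN_msupp_eq0 ?mulr0//.
  by apply: msize_mdeg_ge; have [_ ->] := cF j.
pose phi (q : {poly K}) : P := (map_poly (@mpolyC d K) q).['X_i].
have phiM : {morph phi : p q / p * q}.
  by move=> p q; rewrite /phi rmorphM hornerM.
have phiX a : phi ('X - a%:P) = 'X_i - a%:MP.
  by rewrite /phi rmorphB /= map_polyX map_polyC hornerD hornerN hornerX hornerC.
have phiZ a (u : {poly K}) : phi (a *: u) = a *: phi u.
  by rewrite /phi map_polyZ hornerZ /= mul_mpolyC.
have phi_sum (I : finType) (u : I -> {poly K}) : phi (\sum_j u j) = \sum_j phi (u j).
  by rewrite /phi rmorph_sum horner_sum.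
(* Lagrange products: q takes at c_j the value of l_j times a nonzero number, so a nontrivial
   relation l gives a nonzero q. *)
pose h j : {poly K} := \prod_(b | b != j) ('X - (c b)%:P).
pose q := \sum_j l 0 j *: h j.
have q0 : q != 0.
  have [j lj] : exists j, l 0 j != 0.
    apply/existsP; apply: contraNT l0; rewrite negb_exists => /forallP l0.
    by apply/eqP/rowP => j; rewrite mxE; apply/eqP; have := l0 j; rewrite negbK.
  apply: contra_neq lj => q0; have : q.[c j] = 0 by rewrite q0 horner0.
  rewrite /q horner_sum (bigD1 j)//= [X in _ + X]big1 ?addr0.
    rewrite hornerZ => /eqP; rewrite mulf_eq0 => /orP[/eqP//|].
    rewrite /h horner_prod prodf_seq_eq0 => /hasP[b _ /andP[bj]].
    by rewrite hornerXsubC subr_eq0 (inj_eq cinj) eq_sym (negPf bj).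
  move=> a aj; rewrite hornerZ /h (bigD1 j) 1?eq_sym//= hornerM hornerXsubC.
  by rewrite subrr mul0r mulr0.
(* Modulo M, f^n0 is (X_i - c_j) g_j for every j, and (X_i - c_j) h_j is the full product of the X_i
   - c_b. So f^n0 q is this product times the vanishing sum of the l_j g_j. As f is not in M, q is
   in M, and one of its linear factors as well. *)
have : M (f ^+ n0 * phi q).
  rewrite phi_sum mulr_sumr.
  have -> : \sum_j f ^+ n0 * phi (l 0 j *: h j) =
      \sum_j (phi (l 0 j *: h j) * (f ^+ n0 - ('X_i - (c j)%:MP) * g (c j)))
      + phi (\prod_b ('X - (c b)%:P)) * \sum_j l 0 j *: g (c j).
    rewrite mulr_sumr -big_split; apply: eq_bigr => j _ /=.
    rewrite (bigD1 j)//= -/(h j) phiM phiX phiZ mulrBr mulrC.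
    rewrite [X in _ - X + _](_ : _ = ('X_i - (c j)%:MP) * phi (h j) * (l 0 j *: g (c j))).
      by rewrite subrK.
    by rewrite -!scalerAl -scalerAr [phi _ * _]mulrCA mulrA.
  rewrite lg mulr0 addr0; apply: ideal_sum => // j _; apply: idealM => //.
  by have [/= <- _] := cF j; exact: gP.
case/mulM => [/(prime_ideal_exp prM)//|].
have [r ->] := closed_field_poly_normal q.
rewrite phiZ => /(idealZ idM (lead_coef q)^-1).
rewrite scalerA mulVf ?lead_coef_eq0// scale1r.
have -> : phi (\prod_(z <- r) ('X - z%:P)) = \prod_(z <- r) ('X_i - z%:MP).
  elim: r => [|z r IH]; first by rewrite !big_nil /phi rmorph1 hornerC.
  by rewrite !big_cons phiM IH phiX.
exact: prime_ideal_prod.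
Qed.

(** An ideal N maximal among those containing M and no power of f is prime, and modulo N every
    variable is congruent to a constant z_i. Hence N contains p - p(z) for all p: elements of M
    vanish at z because N is proper, and f does not because f is outside N. *)
Lemma nullstellensatz M f : prime_ideal M -> ~ M f ->
  exists z, (forall p, M p -> p.@[z] = 0) /\ f.@[z] != 0.
Proof.
move=> prM Mf; have [idM M1 _] := prM.
pose S : set P := [set p | exists n, p = f ^+ n].
have [||N [idN _ MN NS maxN]] := @maximal_ideal d K false M S idM => //.
  by move=> p Mp [n E]; apply: Mf; apply: (@prime_ideal_exp _ _ n prM); rewrite -E.
have addN p : ~ N p -> exists2 s, ideal_add N p s & S s.
  move=> Np; apply: contrapT => no; apply: Np; apply: (maxN (ideal_add N p)).
  - exact: ideal_add_ideal.
  - by [].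
  - exact: sub_ideal_add.
  - by move=> s fs Ss; apply: no; exists s.
  - exact: mem_ideal_add.
have Nf : ~ N f by move/NS; apply; exists 1%N; rewrite expr1.
have prN : prime_ideal N.
  split => //; first by move/NS; apply; exists 0%N; rewrite expr0.
  move=> p q; apply: (maximal_avoid_prime idN NS) => //; [|exact: addN..].
  by move=> _ _ [a ->] [b ->]; exists (a + b)%N; rewrite exprD.
have /choice[z zN] : forall i, exists c : K, N ('X_i - c%:MP).
  move=> i; have [//|no] := pselect (exists c : K, N ('X_i - c%:MP)).
  apply: (coordinate_mod_prime prN Nf) => c.
  have [|s Ns [n E]] := addN ('X_i - c%:MP); first by move=> ?; apply: no; exists c.
  by exists n; rewrite -E.
have Nmul a b x y : N (a - b) -> N (x - y) -> N (a * x - b * y).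
  move=> Nab Nxy; have -> : a * x - b * y = a * (x - y) + y * (a - b).
    by rewrite !mulrBr [y * a]mulrC [y * b]mulrC addrA subrK.
  by apply: idealD => //; exact: idealM.
have NX m : N ('X_[m] - ('X_[m] : P).@[z]%:MP).
  rewrite mevalX mpolyXE_id rmorph_prod /=.
  elim/big_rec2: _ => [|i a b _ ab]; first by rewrite subrr; exact: ideal0.
  apply: (Nmul) => //.
  rewrite rmorphXn /=; elim: (m i) => [|k IH].
    by rewrite !expr0 subrr; exact: ideal0.
  by rewrite !exprS; exact: Nmul.
have Nz p : N (p - p.@[z]%:MP).
  rewrite {1 2}[p]mpolyE (raddf_sum (meval z)) (raddf_sum (@mpolyC d K)) -sumrB /=; apply: ideal_sum => // m _.
  rewrite mevalZ mpolyCM mul_mpolyC -scalerBr; exact: idealZ.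
exists z; split.
  move=> p /MN Np; apply/eqP; apply: contrapT => /negP pz.
  have : N (p.@[z]%:MP) by rewrite -[_%:MP](subKr p); exact: idealB.
  move=> /(idealM idN (p.@[z]^-1)%:MP); rewrite -mpolyCM mulVf// mpolyC1.
  by have [] := prN.
apply/eqP => fz; apply: Nf; have := Nz f.
by rewrite fz mpolyC0 subr0.
Qed.

End Nullstellensatz.

(** * The dimension of the zero locus *)

Section Dimension.
Variables (R : realType) (d : nat).
Local Notation K := (R[i]).
Hypothesis uncountable_K : ~ countable [set: K].
Local Notation P := {mpoly K[d]}.
Implicit Types (J M : set P) (p q f : P) (Z : set ('I_d -> K)).

Definition zeros J : set ('I_d -> K) := [set z | forall p, J p -> p.@[z] = 0].

Definition vanishing (W : set ('I_d -> K)) : set P := [set p | forall z, W z -> p.@[z] = 0].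

Lemma zariski_closed_zeros J : zariski_closed (zeros J).
Proof.
exists (fun p => `[< J p >]); apply/seteqP; split => z Jz p.
  by move=> /asboolP; exact: Jz.
by move=> Jp; apply: Jz; apply/asboolP.
Qed.

Lemma vanishing_ideal W : is_ideal (vanishing W).
Proof.
split.
- by move=> z _; rewrite meval0.
- by move=> p q Wp Wq z Wz; rewrite mevalD Wp// Wq// addr0.
- by move=> p q Wq z Wz; rewrite mevalM Wq// mulr0.
Qed.

Lemma vanishing_prime W : zariski_irreducible W -> prime_ideal (vanishing W).
Proof.
move=> [[z Wz] irr]; split; first exact: vanishing_ideal.
  by move=> /(_ z Wz); rewrite meval1; exact/eqP/oner_neq0.
move=> p q Wpq.
have [||z' Wz'||] := irr (zeros [set p]) (zeros [set q]).
- exact: zariski_closed_zeros.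
- exact: zariski_closed_zeros.
- have /eqP := Wpq _ Wz'; rewrite mevalM mulf_eq0 => /orP[]/eqP E;
    [left|right]; by move=> _ ->.
- by move=> H; left => u /H; apply.
- by move=> H; right => u /H; apply.
Qed.

Lemma zeros_irreducible M : prime_ideal M -> zariski_irreducible (zeros M).
Proof.
move=> prM; have [idM M1 mulM] := prM.
have nss := @nullstellensatz d K uncountable_K M.
split.
  by have [z [Mz _]] := nss 1 prM M1; exists z.
move=> Z1 Z2 [J1 ->] [J2 ->] MJ.
have [|/existsNP[z1 /not_implyP[Mz1 /existsNP[p /not_implyP[Jp pz1]]]]] :=
  pselect (zeros M `<=` zero_locus J1); first by left.
have [|/existsNP[z2 /not_implyP[Mz2 /existsNP[q /not_implyP[Jq qz2]]]]] :=
  pselect (zeros M `<=` zero_locus J2); first by right.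
exfalso; have Mp : ~ M p by move=> /Mz1.
have Mq : ~ M q by move=> /Mz2.
have Mpq : ~ M (p * q) by move=> /mulM[].
have [z [Mz /eqP pqz]] := nss _ prM Mpq; apply: pqz; rewrite mevalM.
by have [/(_ _ Jp)->|/(_ _ Jq)->] := MJ z Mz; rewrite ?mul0r ?mulr0.
Qed.

Definition irreducible_chain Z (W : nat -> set ('I_d -> K)) n :=
  (forall i, (i <= n)%N ->
     [/\ zariski_closed (W i), zariski_irreducible (W i) & W i `<=` Z]) /\
  (forall i, (i < n)%N -> W i `<` W i.+1).

(** Z(M) is put on top of a chain for M + (X_s), with s in T. The last inclusion is strict by the
    Nullstellensatz, as the variable X_s belongs to T and so not to M. *)
Lemma chain_exists J (T : {set 'I_d}) : is_ideal J -> graded J ->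
  free_set J T -> exists W, irreducible_chain (zeros J) W #|T|.
Proof.
move tT : #|T| => t; elim: t J T tT => [|t IH] J T tT idJ grJ fT;
  have [M [prM grM JM MT]] := prime_graded_extension idJ grJ fT;
  have [idM M1 mulM] := prM;
  have MJ : zeros M `<=` zeros J by move=> z Mz p /JM; exact: Mz.
  exists (fun=> zeros M); split => // i _; split => //.
    exact: zariski_closed_zeros.
  exact: zeros_irreducible.
have [s sT] : exists s, s \in T by apply/set0Pn; rewrite -card_gt0 tT.
have [|T' []] := @free_set_addX d K M s T idM grM MT; first by rewrite tT.
rewrite tT /= => tT' fT'.
have [W [W1 W2]] := IH _ _ tT' (ideal_add_ideal 'X_s idM) (graded_ideal_addX grM) fT'.
have MsM : zeros (ideal_add M 'X_s) `<=` zeros M.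
  by move=> z Mz p Mp; apply: Mz; exact: sub_ideal_add.
exists (fun i => if (i <= t)%N then W i else zeros M); split => i it.
  case: ifP => [|_]; last first.
    by split; [exact: zariski_closed_zeros|exact: zeros_irreducible|].
  by move=> /W1[? ? WM]; split => //; exact: subset_trans (subset_trans WM MsM) MJ.
rewrite -ltnS it; case: ltnP => [it'|ti]; first exact: W2.
have Wi : W i `<=` zeros (ideal_add M 'X_s) by have [] := W1 i it.
split; first exact: subset_trans MsM.
have Ms : ~ M 'X_s.
  move=> Ms; have Xs0 : 'X_s = 0 :> P.
    apply: (MT _ Ms) => m; rewrite msuppX inE => /eqP ->.
    apply/supportedP => j jT.
    by rewrite mnm1E; case: eqP jT => // <-; rewrite sT.
  by have := mpolyX_neq0 K U_(s)%MM; rewrite Xs0 eqxx.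
have [z [Mz /eqP zs]] := nullstellensatz uncountable_K prM Ms.
move=> /(_ z Mz)/Wi Msz; apply: zs; apply: Msz; exact: mem_ideal_add.
Qed.

Lemma expnS_le n k : (n.+1 ^ k.+1 <= n ^ k.+1 + k.+1 * n.+1 ^ k)%N.
Proof.
elim: k => [|k IH]; first by rewrite !expn1 expn0 muln1 addn1.
have ba : (n ^ k.+1 <= n.+1 ^ k.+1)%N by rewrite leq_exp2r.
have := leq_mul (leqnn n.+1) IH; rewrite mulnDr mulnCA -!expnS mulSn -expnS => H.
apply: (leq_trans H); rewrite [(k.+2 * _)%N]mulSn addnA leq_add2r addnC.
by rewrite leq_add2l.
Qed.

(** A discrete form of integrating x^k; it raises the exponent by one in [chain_growth]. *)
Lemma expn_le_sum n k : (n ^ k.+1 <= k.+1 * \sum_(j < n) j.+1 ^ k)%N.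
Proof.
elim: n => [|n IH]; first by rewrite exp0n.
by rewrite big_ord_recr mulnDr/= (leq_trans (expnS_le n k))// leq_add2r.
Qed.

(** From one link to the next, the prime ideal of the larger set misses some f of the ideal of the
    smaller one. Adding up [hilb_prime] along multiples of e turns a lower bound of order k^i into
    one of order k^(i+1). *)
Lemma chain_growth Z W n : irreducible_chain Z W n -> forall i, (i <= n)%N ->
  exists C, forall k, (k.+1 ^ i <= C * hilb (vanishing (W i)) k.+1)%N.
Proof.
move=> [W1 W2]; elim => [|i IH] iN.
  exists 1%N => k; rewrite expn0 mul1n (@leq_trans (hilb (vanishing (W 0%N)) 1))//; last first.
    exact: hilb_mono.
  have [_ /vanishing_prime[idW W01 _] _] := W1 0%N isT.
  rewrite /hilb; apply/card_gt0P.
  have std0 : standard (vanishing (W 0%N)) (bmnm (bm0 : 'X_{1..d < 1})).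
    apply/negP => /asboolP[p [Wp p0 lp]]; apply: W01.
    have p1 : (msize p <= 1)%N by rewrite -mlead_deg// lp mdeg0.
    move: (Wp) p0; rewrite (msize1_polyC p1) mpolyC_eq0 => Wc c0.
    have := idealZ idW (p@_0)^-1 Wc.
    by rewrite -mul_mpolyC -mpolyCM mulVf.
  by exists (exist _ bm0 std0).
have [C HC] := IH (ltnW iN).
have [cl1 irr1 _] := W1 i (ltnW iN); have [_ irr2 _] := W1 i.+1 iN.
set M := vanishing (W i) in HC *; set J := vanishing (W i.+1).
have [WW WnW] := W2 i iN.
have JM : J `<=` M by move=> p Jp z /WW; exact: Jp.
have [f [Mf Jf]] : exists f, M f /\ ~ J f.
  have [J0 E] := cl1.
  have /existsNP[z /not_implyP[Wz]] := WnW.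
  rewrite E => /existsNP[f /not_implyP[J0f fz]]; exists f; split.
    by move=> u; rewrite E => /(_ _ J0f).
  by move=> /(_ z Wz).
(* Any bound for the degree of f would do, provided that it is positive: e is the step of a
   progression below. *)
pose e := (msize f).+1.
have step k : (hilb J k + hilb M (k + e) <= hilb J (k + e))%N.
  apply: (hilb_prime k (vanishing_prime irr2) (vanishing_ideal _) JM Mf Jf).
  exact: leqW (leqnSn _).
have sum k : (\sum_(j < k.+1) hilb M (e * j).+1 <= hilb J (e * k).+1)%N.
  elim: k => [|k IHk].
    by rewrite big_ord1 muln0; exact: hilb_sub.
  rewrite big_ord_recr /= mulnS [(e + _)%N]addnC -addSn.
  by apply: leq_trans (step _); rewrite leq_add2r.
exists (e ^ i.+1 * (i.+1 * C))%N => k.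
(* The summed bound is available at the arguments e b + 1 only; monotonicity extends it to k + 1, at
   the cost of the constant e^(i+1). *)
set b := (k %/ e)%N.
have kb : (k.+1 <= e * b.+1)%N.
  by rewrite mulnC mulSn addnC {1}(divn_eq k e) -addnS leq_add2l ltn_pmod.
apply: (@leq_trans ((e * b.+1) ^ i.+1)); first by rewrite leq_exp2r.
rewrite expnMn -mulnA leq_mul2l; apply/orP; right.
apply: (leq_trans (expn_le_sum b.+1 i)); rewrite -mulnA leq_mul2l /=.
apply: (@leq_trans (C * hilb J (e * b).+1)); last first.
  by rewrite leq_mul2l hilb_mono ?orbT// ltnS mulnC leq_trunc_div.
apply: (@leq_trans (C * \sum_(j < b.+1) hilb M (e * j).+1)); last first.
  by rewrite leq_mul2l sum orbT.
rewrite big_distrr; apply: leq_sum => j _ /=.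
apply: (leq_trans (HC j)); rewrite leq_mul2l hilb_mono ?orbT//.
by rewrite ltnS leq_pmull.
Qed.

(** D is the size of a largest free set, the empty set being free as the ideal is proper. No free
    set of size D + 1 gives the upper bound, a largest one gives the lower bound and the chain. A
    longer chain would contradict the upper bound, since the vanishing ideal of its top contains
    J. *)
Theorem hilbert_dimension (I : {pred polynomials R d}) : homogeneous_ideal I ->
  let J := [set p | p \in I] in
  [/\ is_ideal J, graded J & exists D : nat,
    [/\ exists C, forall n, (hilb J n.+1 <= C * n.+1 ^ D)%N,
        forall n, (n.+1 ^ D <= hilb J (D * n).+1)%N,
        exists W, irreducible_chain (zero_locus I) W D
      & forall W n, irreducible_chain (zero_locus I) W n -> (n <= D)%N]].
Proof.
move=> [[I0 I1 IB] homI] J.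
have idJ : is_ideal J.
  split => // [p q Jp Jq|p q Jq]; rewrite /J /=.
    by rewrite -[p]mul1r; exact: IB.
  by rewrite -[_ * _]addr0; exact: IB.
have grJ : graded J.
  elim => [|n IH] p Jp; first by rewrite trunc0n; exact: ideal0.
  rewrite -(subrK (trunc n p) (trunc n.+1 p)); apply: idealD => //; last exact: IH.
  by rewrite trunc_pihomog; exact: homI.
have free0 : free_set J finset.set0.
  move=> m /supportedP m0 [p [Jp p0 pm]].
  have mE : m = 0%MM by apply/mnmP => i; rewrite mnm0E m0// finset.in_set0.
  have p1 : (msize p <= 1)%N by rewrite -mlead_deg// pm mE mdeg0.
  move: (Jp) p0; rewrite (msize1_polyC p1) mpolyC_eq0 => Jc c0.
  have : J 1.
    by have := idealZ idJ (p@_0)^-1 Jc; rewrite -mul_mpolyC -mpolyCM mulVf.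
  by rewrite /J /= (negPf I1).
split => //.
have [T /asboolP fT maxT] := @arg_maxnP _ finset.set0
  (fun T : {set 'I_d} => `[< free_set J T >]) (fun T => #|T|) (asboolT free0).
exists #|T|.
have [C HC] : exists C, forall n, (hilb J n.+1 <= C * n.+1 ^ #|T|)%N.
  have [|C HC] := @hilb_upper d K J #|T|.+1 idJ; last first.
    exists C => n; rewrite -(@leq_pmul2l n.+1)// mulnCA -expnS; exact: HC.
  move=> T' T't; apply: contrapT => no.
  have /maxT : `[< free_set J T' >].
    by apply/asboolP => m Tm lm; apply: no; exists m.
  by rewrite /= T't ltnn.
have ZJ : zeros J = zero_locus I by [].
split; first by exists C.
- by move=> n; apply: hilb_lower => // p Jp; exact: (free_set_supported fT).
- by rewrite -ZJ; exact: chain_exists.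
move=> W n ch; have [C' HC'] := chain_growth ch (leqnn n).
have JW : J `<=` vanishing (W n).
  move=> p Jp z Wz; have [/(_ n (leqnn n))[_ _ +] _] := ch.
  by move=> /(_ z Wz) /(_ p Jp).
rewrite leqNgt; apply/negP => Tn.
have H k : (k.+1 ^ n <= C' * C * k.+1 ^ #|T|)%N.
  apply: (leq_trans (HC' k)); rewrite -mulnA leq_mul2l.
  by rewrite (leq_trans (hilb_sub _ JW))// orbT.
(* At k = C' C even one surplus power of k + 1 exceeds the constant. *)
have := H (C' * C)%N; rewrite -(subnK (ltnW Tn)) expnD leq_pmul2r ?expn_gt0//.
rewrite leqNgt => /negP; apply.
have : (0 < n - #|T|)%N by rewrite subn_gt0.
case: (n - #|T|)%N => // k _; by rewrite expnS leq_pmulr ?expn_gt0.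
Qed.

End Dimension.

(** * The projection of polynomials *)

Section Inner_product.
Variables (R : realType) (d : nat).
Local Notation K := (R[i]).
Local Notation P := {mpoly K[d]}.
Local Notation w := (@da_weight R d).
Implicit Types (J : set P) (p q f : P) (a : power_series R d).

Lemma da_weight_gt0 m : 0 < w m.
Proof.
rewrite /da_weight divr_gt0// ltr0n ?fact_gt0//.
by apply: prodn_gt0 => i; exact: fact_gt0.
Qed.

(* The Drury-Arveson inner product with a polynomial is a finite sum. *)
Definition ip a q : K :=
  \sum_(m <- msupp q) a m * conjc q@_m * (w m)%:C.

Lemma ipE n a q : (msize q <= n)%N ->
  ip a q = \sum_(m : 'X_{1..d < n}) a m * conjc q@_m * (w m)%:C.
Proof.
move=> qn; set I : subFinType _ := 'X_{1..d < n}.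
rewrite /ip (big_mksub I) ?msupp_uniq //=; first last.
  by move=> x /msize_mdeg_lt /leq_trans; apply.
rewrite big_rmcond //= => j /memN_msupp_eq0 ->.
by rewrite conjc0 mulr0 mul0r.
Qed.

Lemma ipDl a b q : ip (a + b) q = ip a q + ip b q.
Proof.
by rewrite /ip -big_split; apply: eq_bigr => m _ /=; rewrite -!mulrDl.
Qed.

Lemma ipNl a q : ip (- a) q = - ip a q.
Proof. by rewrite /ip -sumrN; apply: eq_bigr => m _; rewrite !mulNr. Qed.

Lemma ipBl a b q : ip (a - b) q = ip a q - ip b q.
Proof. by rewrite ipDl ipNl. Qed.

Lemma ipZl c a q : ip (c *: a) q = c * ip a q.
Proof. by rewrite /ip mulr_sumr; apply: eq_bigr => m _; rewrite !mulrA. Qed.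

Lemma ipDr a p q : ip a (p + q) = ip a p + ip a q.
Proof.
set n := maxn (msize p) (msize q).
rewrite (@ipE n)//; last exact: msizeD_le.
rewrite (@ipE n _ p) ?leq_maxl// (@ipE n _ q) ?leq_maxr// -big_split.
by apply: eq_bigr => m _; rewrite mcoeffD rmorphD /= mulrDr mulrDl.
Qed.

Lemma ipZr c a q : ip a (c *: q) = conjc c * ip a q.
Proof.
rewrite (@ipE (msize q)) ?msizeZ_le// (@ipE (msize q))// mulr_sumr.
apply: eq_bigr => m _; rewrite mcoeffZ rmorphM /= !mulrA; congr (_ * _ * _).
exact: mulrC.
Qed.

Lemma ip0r a : ip a 0 = 0. Proof. by rewrite /ip msupp0 big_nil. Qed.

Lemma ipNr a q : ip a (- q) = - ip a q.
Proof. by rewrite -scaleN1r ipZr rmorphN1 mulN1r. Qed.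

Lemma ipBr a p q : ip a (p - q) = ip a p - ip a q.
Proof. by rewrite ipDr ipNr. Qed.

Local Notation cf := (@series_of_poly R d).

Lemma cfD p q : cf (p + q) = cf p + cf q.
Proof. by apply/funext => m; rewrite /series_of_poly mcoeffD. Qed.

Lemma cfZ c p : cf (c *: p) = c *: cf p.
Proof. by apply/funext => m; rewrite /series_of_poly mcoeffZ. Qed.

Lemma cfB p q : cf (p - q) = cf p - cf q.
Proof. by rewrite cfD -scaleN1r cfZ scaleN1r. Qed.

Lemma cf_sum (I : Type) (r : seq I) (Q : pred I) (F : I -> P) :
  cf (\sum_(i <- r | Q i) F i) = \sum_(i <- r | Q i) cf (F i).
Proof.
elim/big_rec2: _ => [|i x y _ <-]; last exact: cfD.
by apply/funext => m; rewrite /series_of_poly mcoeff0.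
Qed.

Lemma conjc_mul3 (x y : K) (r : R) :
  conjc (x * conjc y * r%:C) = y * conjc x * r%:C.
Proof.
case: x y => [a b] [c e]; apply/eqP; rewrite eq_complex /=.
by apply/andP; split; apply/eqP; ring.
Qed.

Lemma ipC p q : ip (cf p) q = conjc (ip (cf q) p).
Proof.
set n := maxn (msize p) (msize q).
rewrite (@ipE n) ?leq_maxr// (@ipE n) ?leq_maxl// rmorph_sum; apply: eq_bigr => m _.
exact/esym/conjc_mul3.
Qed.

Lemma ip_ge0 p : 0 <= ip (cf p) p.
Proof.
apply: sumr_ge0 => m _; rewrite mulr_ge0 ?mulcJ_ge0//.
by rewrite ler0c ltW// da_weight_gt0.
Qed.

Lemma ip_eq0 p : ip (cf p) p = 0 -> p = 0.
Proof.
move=> /eqP; rewrite psumr_eq0; last first.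
  move=> m _; rewrite mulr_ge0 ?mulcJ_ge0//.
  by rewrite ler0c ltW// da_weight_gt0.
move=> /allP H; apply/eqP; rewrite -msupp_eq0; apply/eqP.
case E : (msupp p) => [//|m s]; have := H m; rewrite E mem_head => /(_ isT).
have : p@_m != 0 by rewrite -mcoeff_msupp E mem_head.
move=> pm; rewrite /= !mulf_eq0 /series_of_poly conjc_eq0 (negPf pm)/=.
by rewrite eq_complex /= (gt_eqF (da_weight_gt0 m)).
Qed.

Lemma ip_trunc n p q : ip (cf (trunc n p)) q = ip (cf p) (trunc n q).
Proof.
rewrite (@ipE (msize q))// (@ipE (msize q)); last first.
  apply/msize_leP => m; rewrite mcoeff_msupp mcoeff_trunc.
  by case: ifP; rewrite ?eqxx// -mcoeff_msupp => _ /msize_mdeg_lt.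
apply: eq_bigr => m _; rewrite /series_of_poly !mcoeff_trunc.
by case: ifP => // _; rewrite conjc0 mulr0 !mul0r.
Qed.

(** u is the projection of p to the span of s. That u lies in this span is expressed dually by the
    last clause; V transports any further linear property of s to u. *)
Lemma gram_schmidt (V : set P) (s : seq P) p :
  V 0 -> (forall c u v, V u -> V v -> V (u + c *: v)) ->
  {in s, forall u, V u} ->
  exists u, [/\ V u, {in s, forall x, ip (cf (p - u)) x = 0}
    & forall z, {in s, forall x, ip z x = 0} -> ip z u = 0].
Proof.
move=> V0 Vlin; elim: s p => [|x s IH] p sV.
  by exists 0; split => // z _; exact: ip0r.
have {}IH q : exists u, [/\ V u, {in s, forall x, ip (cf (q - u)) x = 0}
    & forall z, {in s, forall x, ip z x = 0} -> ip z u = 0].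
  by apply: IH => y ys; apply: sV; rewrite inE ys orbT.
have [u [Vu pu us]] := IH p; have [v [Vv xv vs]] := IH x.
have Vx : V x by apply: sV; rewrite mem_head.
set y := x - v in xv; set r := p - u in pu.
have Vy : V y by rewrite /y -scaleN1r; exact: Vlin.
(* Here x depends on the earlier vectors, so orthogonality to x is inherited. *)
have [y0|y0] := eqVneq y 0.
  have xvE : x = v by apply/eqP; rewrite -subr_eq0 -/y y0.
  exists u; split => //.
    move=> t; rewrite inE => /orP[/eqP ->|]; last exact: pu.
    by rewrite xvE; exact: vs.
  by move=> z zs; apply: us => t ts; apply: zs; rewrite inE ts orbT.
have yy0 : ip (cf y) y != 0 by apply: contra_neq y0; exact: ip_eq0.
pose c := ip (cf r) y / ip (cf y) y.
exists (u + c *: y).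
have rE : p - (u + c *: y) = r - c *: y by rewrite opprD addrA.
have rs : {in s, forall t, ip (cf (r - c *: y)) t = 0}.
  by move=> t ts; rewrite cfB cfZ ipBl ipZl pu// xv// mulr0 subr0.
split; first exact: Vlin.
  rewrite rE => t; rewrite inE => /orP[/eqP ->|]; last exact: rs.
  rewrite -[x](subrK v) -/y ipDr (vs _ rs) addr0.
  by rewrite cfB cfZ ipBl ipZl divfK// subrr.
move=> z zs.
have zs' : {in s, forall t, ip z t = 0}.
  by move=> t ts; apply: zs; rewrite inE ts orbT.
by rewrite ipDr ipZr /y ipBr us// vs// zs ?mem_head// subr0 mulr0 addr0.
Qed.

Variables (J : set P) (idJ : is_ideal J) (grJ : graded J).

(** One element of J is chosen for each leading monomial of degree less than n, and Gram-Schmidt is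
    applied to this finite family. By induction on the leading monomial, orthogonality to the family
    extends to all elements of J of size at most n. *)
Lemma ortho_decomp p : exists q, [/\ J (p - q),
  forall j, J j -> ip (cf q) j = 0 & (msize q <= msize p)%N].
Proof.
have /choice[g gP] : forall m, exists g : P,
    leading J m -> [/\ J g, g != 0 & mlead g = m].
  by move=> m; have [[g ?]|nl] := pselect (leading J m); [exists g|exists 0].
set n := msize p.
pose s := [seq g (bmnm x) | x <- enum [pred x : 'X_{1..d < n} | `[< leading J (bmnm x) >]]].
pose V : set P := [set u | J u /\ (msize u <= n)%N].
have [|||u [[Ju un] pu _]] := @gram_schmidt V s p.
- by split; [exact: ideal0|rewrite mmeasure0].
- move=> c u v [Ju un] [Jv vn]; split.
    by apply: idealD => //; exact: idealZ.
  by rewrite (leq_trans (msizeD_le _ _))// geq_max un (leq_trans (msizeZ_le _ _)).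
- move=> _ /mapP[x + ->]; rewrite mem_enum => /asboolW lx.
  by have [Jg g0 gx] := gP _ lx; split => //; rewrite -mlead_deg// gx bmdeg.
have qn : (msize (p - u) <= n)%N.
  by rewrite (leq_trans (msizeD_le _ _))// geq_max leqnn msizeN.
have Jperp j : J j -> (msize j <= n)%N -> ip (cf (p - u)) j = 0.
  have [->|] := eqVneq j 0; first by rewrite ip0r.
  have [m] : exists m, m = mlead j by exists (mlead j).
  elim/(well_founded_ind (@ltom_wf d)) : m j => m IH j jm j0 Jj jn.
  have lm : leading J m by exists j.
  have [Jg g0 gm] := gP _ lm.
  have mn : (mdeg m < n)%N by rewrite jm mlead_deg.
  have gs : g m \in s.
    apply/mapP; exists (BMultinom mn) => //; rewrite mem_enum.
    exact: asboolT.
  pose j' := j - (j@_m / (g m)@_m) *: g m.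
  have -> : j = j' + (j@_m / (g m)@_m) *: g m by rewrite subrK.
  rewrite ipDr ipZr (pu _ gs) mulr0 addr0.
  have [->|j'0] := eqVneq j' 0; first by rewrite ip0r.
  have j'm : (mlead j' < m)%O.
    rewrite lt_neqAle; apply/andP; split.
      apply: contra_neq j'0 => E; apply/eqP; rewrite -mleadc_eq0 E.
      have gm0 : (g m)@_m != 0 by have := mleadc_eq0 (g m); rewrite gm => ->.
      by rewrite mcoeffB mcoeffZ divfK ?subrr.
    rewrite (le_trans (mleadB_le _ _))// leUx -jm lexx/=.
    by rewrite (le_trans (mleadZ_le _ _))// gm.
  apply: (IH _ j'm j' erefl j'0).
    by apply: idealB => //; exact: idealZ.
  rewrite -mlead_deg//; apply: leq_ltn_trans mn.
  exact/lemc_mdeg/ltW.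
exists (p - u); split => //; first by rewrite subKr.
(* The projection only sees the truncation of j, which is still in J because J is graded. *)
move=> j Jj; rewrite -(trunc_id qn) ip_trunc Jperp//; first exact: grJ.
exact: msize_trunc.
Qed.

(* The orthogonal projection of polynomials onto the orthogonal complement of
   the ideal [J]. *)
Definition projQ p : P := projT1 (cid (ortho_decomp p)).

Lemma projQ_sub p : J (p - projQ p).
Proof. by rewrite /projQ; case: cid => q []. Qed.

Lemma projQ_ortho p j : J j -> ip (cf (projQ p)) j = 0.
Proof. by rewrite /projQ; case: cid => q [] /= _ + _ => H /H. Qed.

Lemma msize_projQ p : (msize (projQ p) <= msize p)%N.
Proof. by rewrite /projQ; case: cid => q []. Qed.

Lemma projQ_unique p q : J (p - q) -> (forall j, J j -> ip (cf q) j = 0) ->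
  projQ p = q.
Proof.
move=> Jpq qJ; apply/eqP; rewrite -subr_eq0; apply/eqP/ip_eq0.
have Jd : J (projQ p - q).
  have -> : projQ p - q = (p - q) - (p - projQ p).
    by rewrite opprB [RHS]addrC addrA subrK.
  by apply: idealB => //; exact: projQ_sub.
by rewrite cfB ipBl projQ_ortho// qJ// subrr.
Qed.

Lemma projQ_id p : (forall j, J j -> ip (cf p) j = 0) -> projQ p = p.
Proof. by apply: projQ_unique; rewrite subrr; exact: ideal0. Qed.

Lemma projQK p : projQ (projQ p) = projQ p.
Proof. by apply: projQ_id; exact: projQ_ortho. Qed.

Lemma projQ_eq0 p : J p -> projQ p = 0.
Proof.
move=> Jp; apply: projQ_unique; first by rewrite subr0.
by move=> j _; rewrite /ip big1// => m _; rewrite /series_of_poly mcoeff0 !mul0r.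
Qed.

Fact projQ_is_linear : linear projQ.
Proof.
move=> c p q; apply: projQ_unique.
  rewrite opprD addrACA -scalerBr; apply: idealD => //; last exact: projQ_sub.
  by apply: idealZ => //; exact: projQ_sub.
by move=> j Jj; rewrite cfD cfZ ipDl ipZl !projQ_ortho// mulr0 addr0.
Qed.

HB.instance Definition _ :=
  GRing.isLinear.Build K P P _ projQ projQ_is_linear.

Lemma projQ_congr p q : J (p - q) -> projQ p = projQ q.
Proof.
by move=> /projQ_eq0; rewrite linearB => /eqP; rewrite subr_eq0 => /eqP.
Qed.

Lemma projQ_mul p q : projQ (p * projQ q) = projQ (p * q).
Proof.
apply: projQ_congr; rewrite -mulrBr -opprB mulrN; apply: idealN => //.
by apply: idealM => //; exact: projQ_sub.
Qed.

(** The projection acts degree by degree; this is what allows its extension to power series. *)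
Lemma projQ_trunc n p : projQ (trunc n p) = trunc n (projQ p).
Proof.
apply: projQ_unique; first by rewrite -linearB; apply: grJ; exact: projQ_sub.
by move=> j Jj; rewrite ip_trunc projQ_ortho//; exact: grJ.
Qed.

Lemma ip_projQ p q : ip (cf (projQ p)) (projQ q) = ip (cf p) (projQ q).
Proof.
rewrite -[p in RHS](subrK (projQ p)) cfD ipDl [X in _ = X + _]ipC.
by rewrite (projQ_ortho q (projQ_sub p)) conjc0 add0r.
Qed.

Lemma ip_projQ_sym p q : ip (cf (projQ p)) q = ip (cf p) (projQ q).
Proof.
rewrite -ip_projQ -[q in LHS](subrK (projQ q)) ipDr.
by rewrite (projQ_ortho p (projQ_sub q)) add0r.
Qed.

Lemma ip_projQ_le p : ip (cf (projQ p)) (projQ p) <= ip (cf p) p.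
Proof.
have -> : ip (cf p) p = ip (cf (projQ p)) (projQ p)
    + ip (cf (p - projQ p)) (p - projQ p).
  rewrite cfB ipBl !ipBr (ip_projQ_sym p p) ip_projQ.
  by rewrite subrr subr0 addrC subrK.
by rewrite lerDl; exact: ip_ge0.
Qed.

End Inner_product.

End Hilbert_function.

From mathcomp Require Import finmap.
From mathcomp Require Import -(notations) mpoly.
From mathcomp Require Import all_classical all_reals all_analysis.
From mathcomp Require Import measurable_realfun.

Import Order.TTheory GRing.Theory Num.Theory.
Import Hilbert_function.
Import numFieldNormedType.Exports.
(* [cpoint] of the analysis library shadows the one of [Defs]. *)
Import Defs.

Local Notation normc := ComplexField.Normc.normc.

Local Open Scope classical_set_scope.
Local Open Scope complex_scope.
Local Open Scope ring_scope.

Lemma uncountable_complex (R : realType) : ~ countable [set: R[i]].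
Proof.
move=> /countable_injP[f finj].
have cI : countable (`[(0 : R), 1]%classic).
  apply/countable_injP; exists (fun x : R => f (x%:C)%C) => x y _ _ xy.
  have : (x%:C)%C = (y%:C)%C by apply: finj; rewrite ?in_setT.
  by case.
have := countable_lebesgue_measure0 cI.
by rewrite lebesgue_measure_itv /= lte_fin ltr01 oppr0 adde0 => -[] /eqP; rewrite oner_eq0.
Qed.

(** * Sums over multi-indices *)

Section Multi_sums.
Variables (R : realType) (d : nat).
Local Notation mi := (multiindex d).
Local Notation mN n := (mpoly.bmultinom d n).
Implicit Types (F G : mi -> R) (m : mi).

Definition psum (V : nmodType) n (F : mi -> V) : V := \sum_(m : mN n) F (mpoly.bmnm m).
Arguments psum {V} n F.

Lemma bmnm_inj n : injective (@mpoly.bmnm d n).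
Proof. exact: val_inj. Qed.

Lemma psum_widen (V : nmodType) n n' (F : mi -> V) : (n <= n')%N ->
  psum n F = psum n' (fun m => if (mpoly.mdeg m < n)%N then F m else 0).
Proof.
move=> nn'; rewrite /psum.
have H (m : mN n) : (mpoly.mdeg (mpoly.bmnm m) < n')%N.
  by rewrite (leq_trans (mpoly.bmdeg m)).
rewrite -big_mkcond (reindex_omap (fun m : mN n => mpoly.BMultinom (H m))
  (fun m : mN n' => insub (mpoly.bmnm m))) /=.
  apply: eq_bigl => m; rewrite mpoly.bmdeg /=; apply/esym/eqP.
  by rewrite insubT ?mpoly.bmdeg//= => ?; congr Some; exact: val_inj.
by move=> m mn; rewrite insubT/=; congr Some; exact: val_inj.
Qed.

Lemma psum_mono F n n' : (forall m, 0 <= F m) -> (n <= n')%N ->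
  psum n F <= psum n' F.
Proof.
move=> F0 nn'; rewrite (psum_widen _ nn'); apply: ler_sum => m _.
by case: ifP.
Qed.

Lemma le_psum F G n : (forall m, F m <= G m) -> psum n F <= psum n G.
Proof. by move=> FG; apply: ler_sum => m _. Qed.

Lemma psum_ge0 F n : (forall m, 0 <= F m) -> 0 <= psum n F.
Proof. by move=> F0; apply: sumr_ge0. Qed.

Lemma psum_term F n m : (forall m, 0 <= F m) -> (mpoly.mdeg m < n)%N -> F m <= psum n F.
Proof.
move=> F0 mn; rewrite /psum (bigD1 (mpoly.BMultinom mn)) //= lerDl.
exact: sumr_ge0.
Qed.

Lemma psum_le_esum F n : (forall m, 0 <= F m) ->
  ((psum n F)%:E <= \esum_(m in [set: mi]) (F m)%:E)%E.
Proof.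
move=> F0; rewrite esum_ge//.
pose s := [seq mpoly.bmnm x | x <- enum {: mN n}].
exists [set` s]; first by split => //; exact: finite_seq.
have us : uniq s by rewrite map_inj_uniq ?enum_uniq//; exact: bmnm_inj.
by rewrite -fsbig_seq// sumEFin lee_fin /s big_map big_enum.
Qed.

Lemma esum_le_psum F (B : \bar R) : (forall m, 0 <= F m) ->
  (forall n, (psum n F)%:E <= B)%E ->
  (\esum_(m in [set: mi]) (F m)%:E <= B)%E.
Proof.
move=> F0 FB; apply: ge_ereal_sup => _ [A [finA _]] <-.
pose t := finmap.enum_fset (fset_set A).
have ut : uniq t by exact: finmap.fset_uniq.
pose n := (\max_(m <- t) mpoly.mdeg m).+1.
apply: (le_trans _ (FB n)); rewrite fsbig_finite//= sumEFin lee_fin -/t.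
have tn m : m \in t -> (mpoly.mdeg m < n)%N.
  by move=> mt; rewrite ltnS (bigD1_seq m)//= leq_maxl.
set s := [seq mpoly.bmnm x | x <- enum {: mN n}].
have us : uniq s by rewrite map_inj_uniq ?enum_uniq//; exact: bmnm_inj.
have -> : psum n F = \sum_(m <- s) F m by rewrite /s big_map big_enum.
rewrite [leRHS](bigID (mem t)) /= -[X in _ <= X + _]big_filter.
rewrite (@perm_big _ _ _ _ [seq i <- s | i \in t] t).
  by rewrite lerDl sumr_ge0.
apply: uniq_perm; rewrite ?filter_uniq// => m.
rewrite mem_filter; case: (boolP (m \in t)) => //= /tn mn; apply/mapP.
by exists (@mpoly.BMultinom d n m mn) => //; rewrite mem_enum.
Qed.

Lemma psum_cvg F (B : R) : (forall m, 0 <= F m) -> (forall n, psum n F <= B) ->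
  [/\ cvgn (psum ^~ F), forall n, psum n F <= limn (psum ^~ F)
    & limn (psum ^~ F) <= B].
Proof.
move=> F0 FB; have cF : cvgn (psum ^~ F).
  apply: nondecreasing_is_cvgn; first by move=> n n'; exact: psum_mono.
  by exists B => _ [n _ <-]; exact: FB.
split => // [n|].
  by apply: nondecreasing_cvgn_le => // a b; exact: psum_mono.
by apply: limr_le => //; exact: nearW.
Qed.

(** Summability, as in [entire] or in the Drury-Arveson norm, is replaced from here on by
    boundedness of the sums over |m| < n. *)
Lemma esum_bound F : (forall m, 0 <= F m) ->
  (\esum_(m in [set: mi]) (F m)%:E < +oo)%E <-> exists B, forall n, psum n F <= B.
Proof.
move=> F0; split=> [Foo|[B FB]]; last first.
  apply: (@le_lt_trans _ _ B%:E); last exact: ltry.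
  by apply: esum_le_psum => // n; rewrite lee_fin.
have E0 : (0 <= \esum_(m in [set: mi]) (F m)%:E)%E.
  by apply: esum_ge0 => m _; rewrite lee_fin.
exists (fine (\esum_(m in [set: mi]) (F m)%:E)) => n.
by rewrite -lee_fin fineK ?psum_le_esum// ge0_fin_numE.
Qed.

Lemma psum_abs_cvg F (B : R) : (forall n, psum n (fun m => `|F m|) <= B) ->
  cvgn (psum ^~ F).
Proof.
move=> FB; pose G m := `|F m| + F m.
have G0 m : 0 <= G m by rewrite /G -lerBlDr sub0r -normrN ler_norm.
have -> : psum ^~ F = (fun n => psum n G) - (fun n => psum n (fun m => `|F m|)).
  apply/funext => n; rewrite /= !fctE /psum -sumrB; apply: eq_bigr => m _.
  by rewrite /G addrC addKr.
apply: is_cvgB.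
  have [] // := @psum_cvg G (2 * B) G0; move=> n.
  rewrite mulr_natl mulr2n; apply: (@le_trans _ _ (psum n (fun m => `|F m| + `|F m|))).
    by apply: le_psum => m; rewrite lerD2l ler_norm.
  by rewrite /psum big_split /= lerD// FB.
by have [] := psum_cvg _ FB.
Qed.

Lemma psumZ (c : R) n F : psum n (fun m => c * F m) = c * psum n F.
Proof. by rewrite /psum mulr_sumr. Qed.

(* The sum of [r ^ |m|] over a box is a power of a geometric sum. *)
Lemma psum_geometric (r : R) n : 0 <= r -> r < 1 ->
  psum n (fun m => r ^+ mpoly.mdeg m) <= ((1 - r)^-1) ^+ d.
Proof.
move=> r0 r1.
have -> : psum n (fun m => r ^+ mpoly.mdeg m) =
    \sum_(f : {ffun 'I_d -> 'I_n} | (\sum_i f i < n)%N) \prod_(i < d) r ^+ f i.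
  have ltm (m : mN n) i : (mpoly.bmnm m i < n)%N.
    rewrite (leq_ltn_trans _ (mpoly.bmdeg m))//.
    by rewrite mpoly.mdegE (bigD1 i)//= leq_addr.
  pose h (m : mN n) : {ffun 'I_d -> 'I_n} := [ffun i => Ordinal (ltm m i)].
  pose k (f : {ffun 'I_d -> 'I_n}) : option (mN n) :=
    insub (mpoly.Multinom [tuple nat_of_ord (f i) | i < d]).
  have deg (f : {ffun 'I_d -> 'I_n}) :
      mpoly.mdeg (mpoly.Multinom [tuple nat_of_ord (f i) | i < d]) = (\sum_i f i)%N.
    by rewrite mpoly.mdegE; apply: eq_bigr => i _; rewrite mpoly.mnmE.
  rewrite [RHS](reindex_omap h k); last first.
    move=> f fn; rewrite /k insubT ?deg//= => fn'; congr Some.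
    by apply/ffunP => i; apply/val_inj; rewrite ffunE /= mpoly.mnmE.
  apply: eq_big => [m|m _]; last first.
    rewrite mpoly.mdegE prodrXr; congr (_ ^+ _).
    by apply: eq_bigr => i _; rewrite ffunE.
  apply/esym/andP; split.
    rewrite (_ : (\sum_i h m i)%N = mpoly.mdeg (mpoly.bmnm m)) ?mpoly.bmdeg//.
    by rewrite mpoly.mdegE; apply: eq_bigr => i _; rewrite ffunE.
  have hm : mpoly.Multinom [tuple nat_of_ord (h m i) | i < d] = mpoly.bmnm m.
    by apply/mpoly.mnmP => i; rewrite mpoly.mnmE ffunE.
  by rewrite /k hm; apply/eqP; rewrite insubT ?mpoly.bmdeg//= => ?; congr Some; exact: val_inj.
apply: (@le_trans _ _ (\sum_(f : {ffun 'I_d -> 'I_n}) \prod_(i < d) r ^+ f i)).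
  rewrite [leRHS](bigID (fun f : {ffun 'I_d -> 'I_n} => (\sum_i f i < n)%N)) /= lerDl.
  by apply: sumr_ge0 => f _; apply: prodr_ge0 => i _; exact: exprn_ge0.
rewrite -(bigA_distr_bigA (fun (i : 'I_d) (j : 'I_n) => r ^+ j)) /=.
rewrite prodr_const card_ord; apply: lerXn2r; rewrite ?nnegrE.
- by apply: sumr_ge0 => j _; exact: exprn_ge0.
- by rewrite invr_ge0 subr_ge0 ltW.
rewrite -[leRHS]mul1r ler_pdivlMr ?subr_gt0// mulrC -opprB mulNr -subrX1 opprB.
by rewrite lerBlDr lerDl exprn_ge0.
Qed.

End Multi_sums.
Arguments psum {d V} n F.

(** * Entire functions in the Drury-Arveson space *)

Section Complex_limits.
Variable R : realType.
Implicit Types (u v : nat -> R[i]) (x y : R[i]).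

Lemma normc_ge0 x : 0 <= normc x.
Proof. by case: x => a b; exact: sqrtr_ge0. Qed.

Lemma normcE2 x : normc x ^+ 2 = complex.Re x ^+ 2 + complex.Im x ^+ 2.
Proof. by case: x => a b; rewrite /= sqr_sqrtr// addr_ge0// sqr_ge0. Qed.

Lemma Re_le_normc x : `|complex.Re x| <= normc x.
Proof.
rewrite -(@ler_pXn2r _ 2)// ?nnegrE ?normc_ge0// real_normK ?num_real//.
by rewrite normcE2 lerDl sqr_ge0.
Qed.

Lemma Im_le_normc x : `|complex.Im x| <= normc x.
Proof.
rewrite -(@ler_pXn2r _ 2)// ?nnegrE ?normc_ge0// real_normK ?num_real//.
by rewrite normcE2 lerDr sqr_ge0.
Qed.

Lemma ReM_conj x (r : R) : complex.Re (x * conjc x * r%:C) = normc x ^+ 2 * r.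
Proof. by rewrite normcE2; case: x => a b /=; ring. Qed.

Lemma normcMC x (r : R) : 0 <= r -> normc (x * r%:C) = normc x * r.
Proof.
move=> r0; rewrite ComplexField.Normc.normcM; congr (_ * _).
by rewrite /= expr0n addr0 sqrtr_sqr ger0_norm.
Qed.

Lemma normc_conj x : normc (conjc x) = normc x.
Proof. by case: x => a b /=; rewrite sqrrN. Qed.

Lemma normcX x n : normc (x ^+ n) = normc x ^+ n.
Proof.
elim: n => [|n IH]; first by rewrite !expr0 ComplexField.Normc.normc1.
by rewrite !exprS ComplexField.Normc.normcM IH.
Qed.

Lemma normc_prod (I : finType) (F : I -> R[i]) :
  normc (\prod_i F i) = \prod_i normc (F i).
Proof.
apply: (big_morph _ _ (ComplexField.Normc.normc1 _)).
exact: ComplexField.Normc.normcM.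
Qed.

Lemma normc_real (r : R) : 0 <= r -> normc r%:C = r.
Proof. by move=> r0; rewrite /= expr0n addr0 sqrtr_sqr ger0_norm. Qed.

Lemma normc_sum (I : Type) (r : seq I) (Q : pred I) (F : I -> R[i]) :
  normc (\sum_(i <- r | Q i) F i) <= \sum_(i <- r | Q i) normc (F i).
Proof.
elim/big_rec2: _ => [|i x y _ xy]; first by rewrite ComplexField.Normc.normc0.
by rewrite (le_trans (le_normcD _ _))// lerD2l.
Qed.

Lemma normcB_sq x y : normc (x - y) ^+ 2 <= 2 * normc x ^+ 2 + 2 * normc y ^+ 2.
Proof.
rewrite !normcE2; case: x y => [a b] [c e] /=.
have := sqr_ge0 (a + c); have := sqr_ge0 (b + e); nra.
Qed.

Definition ccvg u x := (fun n => complex.Re (u n)) @ \oo --> complex.Re x /\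
  (fun n => complex.Im (u n)) @ \oo --> complex.Im x.

Lemma ccvg_unique u x y : ccvg u x -> ccvg u y -> x = y.
Proof.
move=> [u1 u2] [v1 v2]; apply/eqP; rewrite eq_complex.
apply/andP; split; apply/eqP.
  by apply: cvg_unique u1 v1.
by apply: cvg_unique u2 v2.
Qed.

Lemma ccvg_near u x : (\forall n \near \oo, u n = x) -> ccvg u x.
Proof.
move=> H; split; apply: cvg_near_cst; apply: filterS H => n -> //.
Qed.

End Complex_limits.

Section Multisum.
Variables (R : realType) (d : nat).
Local Notation mi := (multiindex d).
Implicit Types (F G : mi -> R[i]) (m : mi).

Lemma multisum_ccvg F x : ccvg (fun n => psum n F) x -> multisum F = x.
Proof.
move=> [H1 H2]; rewrite /multisum; apply/eqP; rewrite eq_complex /=.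
by apply/andP; split; apply/eqP; exact: cvg_lim.
Qed.

Lemma Re_psum n F : complex.Re (psum n F) = psum n (fun m => complex.Re (F m)).
Proof. by rewrite /psum raddf_sum. Qed.

Lemma Im_psum n F : complex.Im (psum n F) = psum n (fun m => complex.Im (F m)).
Proof. by rewrite /psum raddf_sum. Qed.

Lemma ccvg_multisum F (B : R) : (forall n, psum n (fun m => normc (F m)) <= B) ->
  ccvg (fun n => psum n F) (multisum F).
Proof.
move=> FB.
have H1 : cvgn (fun n => complex.Re (psum n F)).
  rewrite (_ : (fun _ => _) = psum ^~ (fun m => complex.Re (F m))).
    apply: (@psum_abs_cvg _ _ _ B) => n; apply: le_trans (FB n).
    by apply: le_psum => m; exact: Re_le_normc.
  by apply/funext => n; exact: Re_psum.
have H2 : cvgn (fun n => complex.Im (psum n F)).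
  rewrite (_ : (fun _ => _) = psum ^~ (fun m => complex.Im (F m))).
    apply: (@psum_abs_cvg _ _ _ B) => n; apply: le_trans (FB n).
    by apply: le_psum => m; exact: Im_le_normc.
  by apply/funext => n; exact: Im_psum.
by split.
Qed.

Lemma psum_sq_le (F : mi -> R) n : (forall m, 0 <= F m) ->
  psum n (fun m => F m ^+ 2) <= psum n F ^+ 2.
Proof.
move=> F0; rewrite expr2 {2}/psum mulr_sumr; apply: ler_sum => m _.
rewrite expr2 ler_wpM2r// psum_term//; exact: mpoly.bmdeg.
Qed.

End Multisum.

Section Entire.
Variables (R : realType) (d : nat).
Local Notation mi := (multiindex d).
Local Notation w := (@da_weight R d).
Implicit Types (a b v : power_series R d) (m : mi).

Lemma normc_monomial (z : 'I_d -> R[i]) m :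
  normc (monomial z m) = \prod_(i < d) normc (z i) ^+ m i.
Proof. by rewrite normc_prod; apply: eq_bigr => i _; exact: normcX. Qed.

(** By absolute convergence at the diagonal point (r, ..., r). *)
Lemma entire_bound a (r : R) : entire a -> 0 <= r -> exists C, forall n,
  psum n (fun m => normc (a m) * r ^+ mpoly.mdeg m) <= C.
Proof.
move=> ea r0; have /esum_bound[|C HC] := ea (fun=> r%:C).
  by move=> m; exact: normc_ge0.
exists C => n; rewrite (_ : psum _ _ = psum n (fun m => normc (a m * monomial (fun=> r%:C) m)))//.
apply: eq_bigr => m _; rewrite ComplexField.Normc.normcM normc_monomial.
rewrite mpoly.mdegE -prodrXr; congr (_ * _).
by apply: eq_bigr => i _; rewrite normc_real.
Qed.

Lemma monomial_le (z : 'I_d -> R[i]) m :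
  normc (monomial z m) <= (\sum_i normc (z i)) ^+ mpoly.mdeg m.
Proof.
rewrite normc_monomial mpoly.mdegE -prodrXr; apply: ler_prod => i _.
rewrite exprn_ge0 ?normc_ge0//= lerXn2r ?nnegrE ?normc_ge0//.
  by apply: sumr_ge0 => j _; exact: normc_ge0.
by rewrite (bigD1 i)//= lerDl sumr_ge0// => j _; exact: normc_ge0.
Qed.

Lemma entire_of_bound a : (forall s : R, 0 < s ->
    exists C, forall m, normc (a m) * s ^+ mpoly.mdeg m <= C) -> entire a.
Proof.
move=> H z; apply/esum_bound; first by move=> m; exact: normc_ge0.
set t := \sum_i normc (z i).
have t0 : 0 <= t by apply: sumr_ge0 => i _; exact: normc_ge0.
(* At this radius the factor 2 leaves a geometric series of ratio 1/2, and the summand 1 keeps the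
   radius positive. *)
have t20 : 0 < 2 * (t + 1) by rewrite mulr_gt0// ltr_wpDl.
have [C HC] := H (2 * (t + 1)) t20.
have C0 : 0 <= C.
  apply: le_trans _ (HC (@mpoly.mnm0 d)).
  by rewrite mulr_ge0 ?normc_ge0// exprn_ge0// ltW.
exists (C * ((1 - 2^-1)^-1) ^+ d) => n.
apply: (@le_trans _ _ (psum n (fun m => C * (2^-1) ^+ mpoly.mdeg m))).
  apply: le_psum => m; rewrite ComplexField.Normc.normcM.
  apply: (@le_trans _ _ (normc (a m) * t ^+ mpoly.mdeg m)).
    by rewrite ler_wpM2l ?normc_ge0// monomial_le.
  apply: (@le_trans _ _ (normc (a m) * (2 * (t + 1)) ^+ mpoly.mdeg m * 2^-1 ^+ mpoly.mdeg m)).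
    rewrite -mulrA -exprMn ler_wpM2l ?normc_ge0// lerXn2r ?nnegrE//.
      by rewrite mulr_ge0 ?invr_ge0// ltW.
    by rewrite mulrAC divff ?mul1r ?lerDl.
  by rewrite ler_wpM2r// exprn_ge0.
rewrite psumZ ler_wpM2l// psum_geometric//.
by rewrite invf_lt1// ltr1n.
Qed.

Definition sq a m : R := normc (a m) ^+ 2 * w m.

Lemma da_weight_ge0 m : 0 <= w m. Proof. exact/ltW/da_weight_gt0. Qed.

Lemma sq_ge0 a m : 0 <= sq a m.
Proof. by rewrite mulr_ge0 ?sqr_ge0// da_weight_ge0. Qed.

Lemma prod_fact_le (s : seq 'I_d) (f : 'I_d -> nat) :
  (\prod_(i <- s) (f i)`! <= (\sum_(i <- s) f i)`!)%N.
Proof.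
elim: s => [|i s IH]; first by rewrite !big_nil.
rewrite !big_cons -(@bin_fact (f i + \sum_(j <- s) f j) (f i)) ?leq_addr//.
rewrite addKn (leq_trans (leq_mul (leqnn _) IH))// leq_pmull// bin_gt0.
exact: leq_addr.
Qed.

Lemma bin_le_exp2 n k : ('C(n, k) <= 2 ^ n)%N.
Proof.
have [kn|nk] := leqP k n; last by rewrite bin_small.
have := expnDn 1 1 n; rewrite addn1 => ->.
rewrite (bigD1 (Ordinal (kn : (k < n.+1)%N)))//= !exp1n !muln1.
exact: leq_addr.
Qed.

Lemma fact_sum_le (s : seq 'I_d) (f : 'I_d -> nat) :
  ((\sum_(i <- s) f i)`! <=
   \prod_(i <- s) (f i)`! * 2 ^ (size s * \sum_(i <- s) f i))%N.
Proof.
elim: s => [|i s IH]; first by rewrite !big_nil muln0.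
rewrite !big_cons -(@bin_fact (f i + \sum_(j <- s) f j) (f i)) ?leq_addr//.
rewrite addKn mulnCA -mulnA leq_mul2l; apply/orP; right.
rewrite [(size (_ :: _) * _)%N]mulSn expnD mulnCA leq_mul ?bin_le_exp2//.
apply: (leq_trans IH); rewrite leq_mul2l leq_exp2l// leq_mul2l leq_addl.
by rewrite !orbT.
Qed.

Lemma da_weight_le1 m : w m <= 1.
Proof.
rewrite /da_weight ler_pdivrMr ?ltr0n ?fact_gt0// mul1r ler_nat mpoly.mdegE.
exact: prod_fact_le.
Qed.

(** A multinomial coefficient is a product of d binomial coefficients, each at most 2^|m|. So
    Drury-Arveson norms control coefficients up to a geometric factor, which is harmless for entire
    functions. *)
Lemma da_weight_lower m : 1 <= w m * (2 ^ d)%:R ^+ mpoly.mdeg m.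
Proof.
rewrite /da_weight mulrAC ler_pdivlMr ?ltr0n ?fact_gt0// mul1r.
rewrite -natrX -natrM ler_nat -expnM mpoly.mdegE.
have := fact_sum_le (index_enum 'I_d) m.
suff -> : size (index_enum 'I_d) = d by [].
by rewrite -[RHS](card_ord d) cardT enumT; unlock index_enum.
Qed.

Lemma sq_le_entire a : entire a -> exists B, forall n, psum n (sq a) <= B.
Proof.
move=> ea; have [C HC] := entire_bound ea ler01.
exists (C ^+ 2) => n.
apply: (@le_trans _ _ (psum n (fun m => normc (a m) * 1 ^+ mpoly.mdeg m) ^+ 2)).
  apply: (@le_trans _ _ (psum n (fun m => (normc (a m) * 1 ^+ mpoly.mdeg m) ^+ 2))).
    apply: le_psum => m; rewrite expr1n mulr1 -[leRHS]mulr1.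
    by rewrite ler_wpM2l ?sqr_ge0// da_weight_le1.
  apply: psum_sq_le => m; by rewrite mulr_ge0 ?normc_ge0// exprn_ge0.
have n0 : 0 <= psum n (fun m => normc (a m) * 1 ^+ mpoly.mdeg m).
  by apply: psum_ge0 => m; rewrite mulr_ge0 ?normc_ge0// exprn_ge0.
by rewrite lerXn2r ?nnegrE// (le_trans n0).
Qed.

Local Notation DA := (drury_arveson R d).

Lemma entire_DA a : entire a -> hdom DA a.
Proof.
move=> ea; split; first by move=> z _; exact: ea.
by apply/esum_bound => [m|]; [exact: sq_ge0|exact: sq_le_entire].
Qed.

Lemma DA_bound a : hdom DA a -> exists B, forall n, psum n (sq a) <= B.
Proof. by move=> [_] /esum_bound; apply => m; exact: sq_ge0. Qed.

Lemma sqB_bound a b B C : (forall n, psum n (sq a) <= B) ->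
  (forall n, psum n (sq b) <= C) ->
  forall n, psum n (sq (a - b)) <= 2 * B + 2 * C.
Proof.
move=> HB HC n; apply: (@le_trans _ _ (psum n (fun m => 2 * sq a m + 2 * sq b m))).
  apply: le_psum => m.
  have -> : 2 * sq a m + 2 * sq b m =
    (2 * normc (a m) ^+ 2 + 2 * normc (b m) ^+ 2) * w m by rewrite /sq; ring.
  rewrite /sq ler_wpM2r ?da_weight_ge0//.
  exact: (normcB_sq (a m) (b m)).
rewrite /psum big_split /= -!mulr_sumr.
by apply: lerD; rewrite ler_pM2l//; [exact: HB|exact: HC].
Qed.

Lemma hnorm_lim a B : (forall n, psum n (sq a) <= B) ->
  hnorm DA a = Num.sqrt (limn (psum ^~ (sq a))).
Proof.
move=> HB; rewrite /hnorm; congr Num.sqrt.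
have [cv _ _] := psum_cvg (@sq_ge0 a) HB.
suff -> : hinner DA a a = (limn (psum ^~ (sq a)))%:C by [].
apply: multisum_ccvg; split.
  rewrite (_ : (fun n => _) = psum ^~ (sq a))//.
  apply/funext => n; rewrite Re_psum; apply: eq_bigr => m _.
  exact: ReM_conj.
rewrite (_ : (fun n => _) = fun=> 0); first exact: cvg_cst.
apply/funext => n; rewrite Im_psum /psum big1// => m _.
by case: (a _) => x y /=; ring.
Qed.

Lemma hnorm_ge_psum a B : (forall n, psum n (sq a) <= B) ->
  forall n, psum n (sq a) <= hnorm DA a ^+ 2.
Proof.
move=> HB n; rewrite (hnorm_lim HB); have [_ Hl _] := psum_cvg (@sq_ge0 a) HB.
by rewrite sqr_sqrtr// (le_trans _ (Hl n))// psum_ge0// => m; exact: sq_ge0.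
Qed.

Lemma hnorm_le a B : (forall n, psum n (sq a) <= B) -> hnorm DA a <= Num.sqrt B.
Proof.
move=> HB; rewrite (hnorm_lim HB); have [_ _ Hl] := psum_cvg (@sq_ge0 a) HB.
exact: ler_wsqrtr.
Qed.

Lemma hnorm_ge_coef a B m : (forall n, psum n (sq a) <= B) ->
  sq a m <= hnorm DA a ^+ 2.
Proof.
move=> HB; apply: le_trans (hnorm_ge_psum HB (mpoly.mdeg m).+1).
by apply: psum_term => // k; exact: sq_ge0.
Qed.

Lemma hinner_poly a q : hinner DA a (series_of_poly q) = ip a q.
Proof.
apply: multisum_ccvg; apply: ccvg_near; exists (mpoly.msize q) => // n /= qn.
by rewrite (ipE _ qn).
Qed.

Lemma entire_poly (q : polynomials R d) : entire (series_of_poly q).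
Proof.
apply: entire_of_bound => s s0.
exists (\sum_(m <- mpoly.msupp q) normc (series_of_poly q m) * s ^+ mpoly.mdeg m) => m.
have H k : 0 <= normc (series_of_poly q k) * s ^+ mpoly.mdeg k.
  by rewrite mulr_ge0 ?normc_ge0// exprn_ge0// ltW.
have [mq|mq] := boolP (m \in mpoly.msupp q).
  by rewrite (bigD1_seq m) ?mpoly.msupp_uniq//= lerDl sumr_ge0.
rewrite /series_of_poly mpoly.memN_msupp_eq0// ComplexField.Normc.normc0 mul0r.
by apply: sumr_ge0 => k _; exact: H.
Qed.

End Entire.

(** * The operator iota *)

Lemma cvg_ext (R : realType) (f g : nat -> R) (l : R) :
  (forall n, f n = g n) -> f @ \oo --> l -> g @ \oo --> l.
Proof. by move=> /funext ->. Qed.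

Lemma seq_cst (R : realType) (c : R) : (fun _ : nat => c) @ \oo --> c.
Proof. exact: cvg_cst. Qed.
Arguments seq_cst {R} c.

Lemma seqM (R : realType) (f g : nat -> R) (a b : R) : f @ \oo --> a ->
  g @ \oo --> b -> (fun n => f n * g n) @ \oo --> a * b.
Proof. by move=> fa gb; exact: cvgM. Qed.

Lemma seq_add (R : realType) (f g : nat -> R) (a b : R) : f @ \oo --> a ->
  g @ \oo --> b -> (fun n => f n + g n) @ \oo --> a + b.
Proof. by move=> fa gb; exact: cvgD. Qed.

Lemma seqB (R : realType) (f g : nat -> R) (a b : R) : f @ \oo --> a ->
  g @ \oo --> b -> (fun n => f n - g n) @ \oo --> a - b.
Proof. by move=> fa gb; exact: cvgB. Qed.

Lemma seq_sqrt (R : realType) (f : nat -> R) (a : R) : f @ \oo --> a ->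
  (fun n => Num.sqrt (f n)) @ \oo --> Num.sqrt a.
Proof. by move=> fa; apply: continuous_cvg => //; exact: sqrt_continuous. Qed.

Lemma seq_le (R : realType) (f g : nat -> R) (a b : R) : f @ \oo --> a ->
  g @ \oo --> b -> (forall n, f n <= g n) -> a <= b.
Proof.
move=> fa gb fg; rewrite -(cvg_lim _ fa)// -(cvg_lim _ gb)//.
by apply: ler_lim; [apply/cvg_ex; exists a|apply/cvg_ex; exists b|exact: nearW].
Qed.

(** * Truncated power series and their inner products with polynomials *)

Section Truncation.
Variables (R : realType) (d : nat).
Local Notation P := (polynomials R d).
Local Notation cf := (@series_of_poly R d).
Local Notation "''X_' i" := (mpoly.mpolyX R[i] (mpoly.mnm1 i)).
Implicit Types (v x y : power_series R d) (p q : P).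

Definition tpoly n v : P :=
  \sum_(m : mpoly.bmultinom d n) v (mpoly.bmnm m) *: mpoly.mpolyX _ (mpoly.bmnm m).

Lemma mcoeff_tpoly n v m :
  mpoly.mcoeff m (tpoly n v) = if (mpoly.mdeg m < n)%N then v m else 0.
Proof.
case: ltnP => [mn|nm]; first exact: (mpoly.mcoeff_mpoly v mn).
rewrite raddf_sum big1//= => k _; rewrite mpoly.mcoeffZ mpoly.mcoeffX.
case: eqP => [E|]; last by rewrite mulr0.
by have := mpoly.bmdeg k; rewrite E ltnNge nm.
Qed.

Lemma msize_tpoly n v : (mpoly.msize (tpoly n v) <= n)%N.
Proof.
apply/msize_leP => m; rewrite mpoly.mcoeff_msupp mcoeff_tpoly.
by case: ifP; rewrite ?eqxx.
Qed.

Lemma trunc_tpoly k n v : (k <= n)%N -> trunc k (tpoly n v) = tpoly k v.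
Proof.
move=> kn; apply/mpoly.mpolyP => m; rewrite mcoeff_trunc !mcoeff_tpoly.
by case: ltnP => // mk; rewrite (leq_trans mk).
Qed.

Lemma ip_tpoly n v q : ip (cf (tpoly n v)) q = ip v (trunc n q).
Proof.
rewrite (ipE _ (leqnn _)) (@ipE _ _ (mpoly.msize q)); last first.
  apply/msize_leP => m; rewrite mpoly.mcoeff_msupp mcoeff_trunc.
  by case: ifP; rewrite ?eqxx// -mpoly.mcoeff_msupp => _ /mpoly.msize_mdeg_lt.
apply: eq_bigr => m _; rewrite /series_of_poly mcoeff_tpoly mcoeff_trunc.
by case: ifP => // _; rewrite conjc0 mulr0 !mul0r.
Qed.

Lemma ip_tpoly_id n v q : (mpoly.msize q <= n)%N -> ip (cf (tpoly n v)) q = ip v q.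
Proof. by move=> qn; rewrite ip_tpoly trunc_id. Qed.

Lemma psum_ip_tpoly n x y :
  psum n (fun m => x m * conjc (y m) * (da_weight R m)%:C) = ip x (tpoly n y).
Proof.
rewrite (ipE _ (msize_tpoly n y)); apply: eq_bigr => m _.
by rewrite mcoeff_tpoly mpoly.bmdeg.
Qed.

Lemma psum_sq n v : psum n (sq v) = complex.Re (ip (cf (tpoly n v)) (tpoly n v)).
Proof.
rewrite ip_tpoly_id ?msize_tpoly// -psum_ip_tpoly Re_psum.
by apply: eq_bigr => m _; exact/esym/ReM_conj.
Qed.

Lemma hinner_poly_l q x : hinner (drury_arveson R d) (cf q) x = conjc (ip x q).
Proof.
apply: multisum_ccvg; apply: ccvg_near; exists (mpoly.msize q) => // n /= qn.
rewrite psum_ip_tpoly ipC ip_tpoly_id//.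
Qed.

(** Continuity of the inner product with a fixed polynomial. As the weights are at most 1, the sum
    of the absolute values of the coefficients of q is a suitable constant. *)
Lemma ip_bound q : exists2 C : R, 0 <= C & forall x B,
  (forall n, psum n (sq x) <= B) ->
  normc (ip x q) <= C * hnorm (drury_arveson R d) x.
Proof.
exists (\sum_(m <- mpoly.msupp q) normc (mpoly.mcoeff m q)).
  by apply: sumr_ge0 => m _; exact: normc_ge0.
move=> x B HB; rewrite (le_trans (normc_sum _ _ _))// mulr_suml.
apply: ler_sum => m _; rewrite normcMC ?da_weight_ge0//.
rewrite ComplexField.Normc.normcM normc_conj mulrAC mulrC ler_wpM2l ?normc_ge0//.
have h0 : 0 <= hnorm (drury_arveson R d) x by exact: sqrtr_ge0.
rewrite -(@ler_pXn2r _ 2)// ?nnegrE ?mulr_ge0 ?normc_ge0 ?da_weight_ge0//.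
rewrite exprMn; apply: le_trans (hnorm_ge_coef m HB).
rewrite /sq ler_wpM2l ?sqr_ge0// expr2 -[leRHS]mulr1.
by rewrite ler_wpM2l ?da_weight_ge0// da_weight_le1.
Qed.

Lemma mult_coord_poly i p : mult_coord i (cf p) = cf ('X_i * p).
Proof.
apply/funext => m; rewrite /mult_coord /series_of_poly mulrC.
case: ltnP => [mi|]; last first.
  rewrite leqn0 => /eqP m0; apply/esym/mpoly.memN_msupp_eq0/negP.
  move=> /mpoly.msuppM_le/allpairsP[[a b] /= [_]].
  rewrite mpoly.msuppX inE => /eqP -> E; move: m0; rewrite E mpoly.mnmDE mpoly.mnm1E.
  by rewrite eqxx addn1.
have le1 : mpoly.lem (mpoly.mnm1 i) m by rewrite mpoly.lep1mP -lt0n.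
by rewrite -[in RHS](mpoly.submK le1) mpoly.addmC mpoly.mcoeffMX.
Qed.

End Truncation.

(** * The quotient space, the tuple S, and iota as a degreewise projection *)

Section Quotient.
Variables (R : realType) (d : nat) (I : {pred polynomials R d}).
Local Notation P := (polynomials R d).
Local Notation cf := (@series_of_poly R d).
Local Notation DA := (drury_arveson R d).
Local Notation "''X_' i" := (mpoly.mpolyX R[i] (mpoly.mnm1 i)).
Local Notation J := [set p | p \in I].
Hypothesis (idJ : is_ideal J) (grJ : graded J).
Local Notation Q := (projQ idJ grJ).
Implicit Types (v x y : power_series R d) (p q : P).

(** In bounded degree the ideal is already closed. With q the projection of the truncation of y, the
    square norm of q is the inner product of y - j with q for every j in J, and y - j can be made
    arbitrarily small. *)
Lemma P_ideal_tpoly y n : P_ideal I y -> J (tpoly n y).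
Proof.
move=> [domy Hy]; set p := tpoly n y; set q := Q p.
suff q0 : q = 0 by have := projQ_sub idJ grJ p; rewrite -/q q0 subr0.
apply: ip_eq0; have [C C0 HC] := ip_bound q.
have qn : (mpoly.msize q <= n)%N.
  exact: leq_trans (msize_projQ _ _ _) (msize_tpoly _ _).
apply: ComplexField.eq0_normC; apply/eqP; rewrite eq_complex /= eqxx andbT.
rewrite eq_le normc_ge0 andbT; apply/ler_addgt0Pr => e e0; rewrite add0r.
have [_ [j Jj ->] yj] := Hy (e / (C + 1)) (divr_gt0 e0 (ltr_wpDl C0 ltr01)).
have [B1 HB1] := DA_bound domy.
have [B2 HB2] := DA_bound (entire_DA (entire_poly j)).
have -> : ip (cf q) q = ip (y - cf j) q.
  rewrite ipBl (ipC j) (projQ_ortho _ _ _ Jj) conjc0 subr0.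
  by rewrite ip_projQ ip_tpoly_id.
apply: (le_trans (HC _ _ (sqB_bound HB1 HB2))).
apply: (@le_trans _ _ (C * (e / (C + 1)))); first by rewrite ler_wpM2l// ltW.
rewrite mulrCA; apply: ler_piMr; first exact: ltW.
by rewrite ler_pdivrMr ?mul1r ?lerDl// ltr_wpDl.
Qed.

(** Orthogonality to the closure reduces to J itself: by [P_ideal_tpoly], every partial sum of the
    inner product with an element of the closure vanishes. *)
Lemma Q_idealP x : Q_ideal I x <-> hdom DA x /\ forall p, J p -> ip x p = 0.
Proof.
split=> [[domx Hx]|[domx Hx]]; split => //.
  move=> p Jp; rewrite -hinner_poly; apply: Hx; split.
    exact/entire_DA/entire_poly.
  move=> e e0; exists (cf p); first by exists p.
  apply: le_lt_trans e0; rewrite subrr (le_trans (@hnorm_le _ _ _ 0 _)) ?sqrtr0//.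
  move=> n; rewrite /psum big1// => m _.
  by rewrite /sq ComplexField.Normc.normc0 expr0n mul0r.
move=> y Py; apply: multisum_ccvg; apply: ccvg_near; apply: nearW => n.
by rewrite psum_ip_tpoly; apply: Hx; exact: P_ideal_tpoly.
Qed.

Lemma Q_ideal_poly p : Q_ideal I (cf (Q p)).
Proof.
apply/Q_idealP; split; first exact/entire_DA/entire_poly.
by move=> j Jj; exact: projQ_ortho.
Qed.

Lemma Q_ideal_tpoly x n : Q_ideal I x -> Q (tpoly n x) = tpoly n x.
Proof.
move=> /Q_idealP[_ Hx]; apply: projQ_id => j Jj.
by rewrite ip_tpoly Hx//; exact: grJ.
Qed.

(** [Q_proj] is a choice, so a second candidate y has to be excluded: its truncated difference from
    [Q p] is fixed by [Q] and orthogonal to itself. *)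
Lemma Q_proj_poly p : Q_proj I (cf p) = cf (Q p).
Proof.
apply: xget_unique.
  split; first exact: Q_ideal_poly.
  move=> z /Q_idealP[_ Hz]; rewrite -cfB hinner_poly_l Hz ?conjc0//.
  exact: projQ_sub.
move=> y [Qy Hy]; apply/funext => m; pose n := (mpoly.mdeg m).+1.
pose s := tpoly n y - trunc n (Q p).
have Qs : Q s = s.
  by rewrite linearB /= Q_ideal_tpoly// projQ_trunc projQK.
have sn : (mpoly.msize s <= n)%N.
  rewrite (leq_trans (mpoly.msizeD_le _ _))// geq_max mpoly.msizeN.
  by rewrite msize_tpoly msize_trunc.
have s0 : s = 0.
  apply: ip_eq0; rewrite {1}/s cfB ipBl ip_tpoly_id// ip_trunc (trunc_id sn).
  rewrite -{2}Qs -ip_projQ_sym; rewrite -{1}Qs.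
  have := Hy _ (Q_ideal_poly s); rewrite hinner_poly ipBl.
  rewrite projQK ip_projQ_sym => /eqP; rewrite subr_eq0 => /eqP ->.
  by rewrite subrr.
have := congr1 (mpoly.mcoeff m) s0.
rewrite mpoly.mcoeffB mcoeff_tpoly mcoeff_trunc ltnSn mpoly.mcoeff0 => /eqP.
by rewrite subr_eq0 => /eqP.
Qed.

Lemma S_tuple_iter i k p :
  iter k (S_tuple I i) (cf (Q p)) = cf (Q ('X_i ^+ k * p)).
Proof.
elim: k => [|k IH]; first by rewrite expr0 mul1r.
by rewrite iterS IH /S_tuple /= mult_coord_poly Q_proj_poly projQ_mul mulrA -exprS.
Qed.

Lemma tuple_power_S m :
  tuple_power (S_tuple I) m (e_vector I) = cf (Q (mpoly.mpolyX _ m)).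
Proof.
rewrite mpoly.mpolyXE_id /tuple_power -big_enum /=.
elim: (enum 'I_d) => [|i s IH]; first by rewrite big_nil /= /e_vector Q_proj_poly.
by rewrite /= IH S_tuple_iter big_cons.
Qed.

Lemma iota_sum n v : \sum_(m : mpoly.bmultinom d n)
    v (mpoly.bmnm m) *: tuple_power (S_tuple I) (mpoly.bmnm m) (e_vector I)
  = cf (Q (tpoly n v)).
Proof.
rewrite linear_sum cf_sum; apply: eq_bigr => m _.
by rewrite tuple_power_S linearZ cfZ.
Qed.

(* The degreewise projection of a power series *)
Definition Qseries v : power_series R d :=
  fun m => mpoly.mcoeff m (Q (tpoly (mpoly.mdeg m).+1 v)).

Lemma Qseries_coef n v m : (mpoly.mdeg m < n)%N ->
  mpoly.mcoeff m (Q (tpoly n v)) = Qseries v m.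
Proof.
move=> mn; rewrite /Qseries -(trunc_tpoly v mn) projQ_trunc mcoeff_trunc.
by rewrite ltnSn.
Qed.

Lemma tpoly_Qseries n v : tpoly n (Qseries v) = Q (tpoly n v).
Proof.
apply/mpoly.mpolyP => m; rewrite mcoeff_tpoly; case: ltnP => mn.
  by rewrite (Qseries_coef v mn).
apply/esym/mpoly.memN_msupp_eq0/mpoly.msize_mdeg_ge.
exact: leq_trans (leq_trans (msize_projQ _ _ _) (msize_tpoly _ _)) mn.
Qed.

Lemma ip_Qseries n v q : (mpoly.msize q <= n)%N ->
  ip (Qseries v) q = ip (cf (Q (tpoly n v))) q.
Proof. by move=> qn; rewrite -tpoly_Qseries ip_tpoly_id. Qed.

(** The projection is a contraction on each homogeneous component, and the other components of v do
    not affect the coefficient at m. *)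
Lemma sq_Qseries_le v m :
  sq (Qseries v) m <= psum (mpoly.mdeg m).+1
    (fun k => if mpoly.mdeg k == mpoly.mdeg m then sq v k else 0).
Proof.
set n := mpoly.mdeg m.
pose u : power_series R d := fun k => if mpoly.mdeg k == n then v k else 0.
have -> : (fun k => if mpoly.mdeg k == n then sq v k else 0) = sq u.
  apply/funext => k; rewrite /sq /u; case: ifP => // _.
  by rewrite ComplexField.Normc.normc0 expr0n mul0r.
have -> : sq (Qseries v) m = sq (Qseries u) m.
  rewrite /sq /Qseries -/n.
  have -> : tpoly n.+1 v = tpoly n.+1 u + tpoly n v.
    apply/mpoly.mpolyP => k; rewrite mpoly.mcoeffD !mcoeff_tpoly /u ltnS.
    by case: ltngtP; rewrite ?addr0 ?add0r.
  rewrite linearD mpoly.mcoeffD /= [X in _ + X]mpoly.memN_msupp_eq0 ?addr0//.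
  apply: mpoly.msize_mdeg_ge.
  exact: leq_trans (msize_projQ _ _ _) (msize_tpoly _ _).
apply: (@le_trans _ _ (psum n.+1 (sq (Qseries u)))).
  by apply: psum_term => // k; exact: sq_ge0.
rewrite !psum_sq tpoly_Qseries.
by have := ip_projQ_le idJ grJ (tpoly n.+1 u); rewrite lecE => /andP[].
Qed.

(** Returning from norms to coefficients costs at most c^|m| with c = 2^d; this is absorbed by
    estimating v at the radius s c instead of s. *)
Lemma Qseries_entire v : entire v -> entire (Qseries v).
Proof.
move=> ev; apply: entire_of_bound => s s0.
set c : R := (2 ^ d)%:R.
have c1 : 1 <= c by rewrite /c -[1]/(1%:R) ler_nat expn_gt0.
have c0 : 0 <= c by exact: le_trans c1.
have sc0 : 0 <= s * c by rewrite mulr_ge0// ltW.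
have [C HC] := entire_bound ev sc0.
have C0 : 0 <= C.
  apply: le_trans (HC 0%N); apply: psum_ge0 => m.
  by rewrite mulr_ge0 ?normc_ge0// exprn_ge0.
exists C => m; set n := mpoly.mdeg m.
have sn0 : 0 <= s ^+ n by rewrite exprn_ge0// ltW.
rewrite -(@ler_pXn2r _ 2)// ?nnegrE ?mulr_ge0 ?normc_ge0// exprMn.
apply: (@le_trans _ _ (sq (Qseries v) m * c ^+ n * (s ^+ n) ^+ 2)).
  rewrite ler_wpM2r ?sqr_ge0// /sq -mulrA -[leLHS]mulr1.
  by rewrite ler_wpM2l ?sqr_ge0// da_weight_lower.
apply: (@le_trans _ _ (sq (Qseries v) m * ((s * c) ^+ n) ^+ 2)).
  rewrite -mulrA ler_wpM2l ?sq_ge0// exprMn [leRHS]exprMn mulrC.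
  rewrite ler_wpM2l ?sqr_ge0// expr2 ler_peMr ?exprn_ge0//.
  exact: exprn_ege1.
apply: (@le_trans _ _ (psum n.+1 (fun k => (normc (v k) * (s * c) ^+ mpoly.mdeg k) ^+ 2))).
  apply: (@le_trans _ _ (psum n.+1 (fun k => if mpoly.mdeg k == n then sq v k else 0)
     * ((s * c) ^+ n) ^+ 2)).
    by rewrite ler_wpM2r ?sqr_ge0// sq_Qseries_le.
  rewrite /psum mulr_suml; apply: ler_sum => k _; case: eqP => [->|_].
    rewrite [leRHS]exprMn ler_wpM2r ?sqr_ge0// /sq -[leRHS]mulr1.
    by rewrite ler_wpM2l ?sqr_ge0// da_weight_le1.
  by rewrite mul0r sqr_ge0.
have F0 k : 0 <= normc (v k) * (s * c) ^+ mpoly.mdeg k.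
  by rewrite mulr_ge0 ?normc_ge0// exprn_ge0.
apply: (le_trans (psum_sq_le _ F0)).
by rewrite lerXn2r ?nnegrE// psum_ge0.
Qed.

Lemma Q_ideal_Qseries v : entire v -> Q_ideal I (Qseries v).
Proof.
move=> ev; apply/Q_idealP; split; first exact/entire_DA/Qseries_entire.
by move=> p Jp; rewrite (ip_Qseries v (leqnn _)) projQ_ortho.
Qed.

(** Coefficients are continuous in the norm, since every weight is positive. Uniqueness is required
    because [hlim] is a choice. *)
Lemma hcvg_unique (u : nat -> P) x y :
  hcvg (Q_space I) (fun n => cf (u n)) x ->
  hcvg (Q_space I) (fun n => cf (u n)) y -> x = y.
Proof.
move=> [Qx Hx] [Qy Hy]; apply/funext => m.
have [B1 HB1] := DA_bound (proj1 Qx).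
have [B2 HB2] := DA_bound (proj1 Qy).
have key z B : (forall n, psum n (sq z) <= B) ->
    (fun n => hnorm DA (cf (u n) - z)) @ \oo --> (0 : R) ->
    (fun n => normc (cf (u n) m - z m) ^+ 2 * da_weight R m) @ \oo --> (0 : R).
  move=> HB Hz; have Hz2 : (fun n => hnorm DA (cf (u n) - z) ^+ 2) @ \oo --> (0 : R).
    by have H := seqM Hz Hz; rewrite mulr0 in H; apply: (cvg_ext _ H) => n; rewrite expr2.
  apply: (squeeze_cvgr _ (cvg_cst 0) Hz2); apply: nearW => n.
  rewrite mulr_ge0 ?sqr_ge0 ?da_weight_ge0//=.
  have [C HC] := DA_bound (entire_DA (entire_poly (u n))).
  exact: (hnorm_ge_coef m (sqB_bound HC HB)).
have kx := key _ _ HB1 Hx; have ky := key _ _ HB2 Hy.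
have H := seq_add (seqM (seq_cst (2 : R)) kx) (seqM (seq_cst (2 : R)) ky).
rewrite !mulr0 addr0 in H.
set c := normc (x m - y m) ^+ 2 * da_weight R m.
have c0 : c <= 0.
  apply: (seq_le (seq_cst c) H) => n.
  rewrite (mulrA 2) (mulrA 2 (normc (_ - y m) ^+ 2)) -mulrDl.
  rewrite ler_wpM2r ?da_weight_ge0//.
  have -> : x m - y m = (cf (u n) m - y m) - (cf (u n) m - x m).
    by rewrite opprB [RHS]addrC addrA subrK.
  by rewrite (le_trans (normcB_sq _ _))// addrC.
have : c == 0 by rewrite eq_le c0 mulr_ge0 ?sqr_ge0// da_weight_ge0.
rewrite mulf_eq0 (gt_eqF (da_weight_gt0 _ _)) orbF sqrf_eq0 => /eqP.
by move=> /ComplexField.Normc.eq0_normc/eqP; rewrite subr_eq0 => /eqP.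
Qed.

Lemma hcvg_Qseries v : entire v ->
  hcvg (Q_space I) (fun n => cf (Q (tpoly n v))) (Qseries v).
Proof.
move=> ev; split; first exact: Q_ideal_Qseries.
have [B HB] := sq_le_entire (Qseries_entire ev).
have [cv le_lim _] := psum_cvg (@sq_ge0 _ _ (Qseries v)) HB.
set L := limn _ in le_lim.
(* The difference consists of the terms of degree at least n, so its square norm is a tail of a
   convergent series. *)
have tail n : hnorm DA (cf (Q (tpoly n v)) - Qseries v) <=
    Num.sqrt (L - psum n (sq (Qseries v))).
  apply: hnorm_le => k; set z := _ - _.
  pose N := maxn n k.
  apply: (@le_trans _ _ (psum N (sq z))).
    by apply: psum_mono; [exact: sq_ge0|exact: leq_maxr].
  rewrite lerBrDr (psum_widen _ (leq_maxl n k)) -/N /psum -big_split /=.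
  apply: le_trans (le_lim N); apply: ler_sum => m _.
  have zE : z (mpoly.bmnm m) = mpoly.mcoeff (mpoly.bmnm m) (Q (tpoly n v))
      - Qseries v (mpoly.bmnm m) by [].
  rewrite /sq zE; case: ltnP => mn.
    rewrite (Qseries_coef v mn) subrr ComplexField.Normc.normc0.
    by rewrite expr0n mul0r add0r.
  rewrite addr0 mpoly.memN_msupp_eq0 ?sub0r ?normcN//.
  apply: mpoly.msize_mdeg_ge.
  exact: leq_trans (leq_trans (msize_projQ _ _ _) (msize_tpoly _ _)) mn.
have H0 : (fun n => Num.sqrt (L - psum n (sq (Qseries v)))) @ \oo --> (0 : R).
  have HL : (fun n => L - psum n (sq (Qseries v))) @ \oo --> (0 : R).
    by have := seqB (seq_cst L) cv; rewrite subrr.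
  by have := seq_sqrt HL; rewrite sqrtr0.
apply: (squeeze_cvgr _ (cvg_cst 0) H0); apply: nearW => n.
by rewrite sqrtr_ge0 /= tail.
Qed.

Lemma iota_Qseries v : entire v ->
  iota_op (Q_space I) (S_tuple I) (e_vector I) v = Qseries v.
Proof.
move=> ev; rewrite /iota_op.
under [fun n => _]funext do rewrite iota_sum.
apply: xget_unique; first exact: hcvg_Qseries.
by move=> y Hy; exact: hcvg_unique Hy (hcvg_Qseries ev).
Qed.

End Quotient.

(** * Gaussian integrals *)

Section Plane_rotation.
Variable R : realType.
Local Notation leb := (@lebesgue_measure R).
Local Notation rT := (measurableTypeR R).

Lemma measurable_addr (c : R) : measurable_fun setT ((fun x => x + c) : rT -> rT).
Proof. exact: measurable_funD. Qed.

Lemma lebesgue_translation (c : R) (A : set R) : measurable A ->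
  leb ((fun x => x + c) @^-1` A) = leb A.
Proof.
move=> mA; have mc := measurable_addr c.
apply/esym; apply: (@lebesgue_measure_unique R (pushforward leb (fun x : rT => x + c : rT))) => //.
move=> _ [[a b] /= _ <-]; rewrite /pushforward.
have -> : (fun x => x + c) @^-1` `]a, b]%classic = `](a - c), (b - c)]%classic.
  by apply/seteqP; split => x /=; rewrite !in_itv /= ltrBlDr lerBrDr.
rewrite !lebesgue_measure_itv /= !lte_fin ltrD2r.
by case: ifP => // _; rewrite -!EFinB; congr (_%:E)%E; ring.
Qed.

Lemma integral_translation (c : R) (f : rT -> \bar R) : measurable_fun setT f ->
  (forall x, 0 <= f x)%E ->
  (\int[leb]_x f (x + c)%R = \int[leb]_x f x)%E.
Proof.
move=> mf f0; have mc := measurable_addr c.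
rewrite [RHS](@eq_measure_integral _ _ _ _
   (pushforward leb (fun x : rT => x + c : rT))); last first.
  by move=> A mA _; exact/esym/(lebesgue_translation c mA).
by rewrite ge0_integral_pushforward//= preimage_setT.
Qed.

Local Notation leb2 := (leb \x leb)%E.
Local Notation pT := (rT * rT)%type.

(** A rotation by theta is a product of three shears with parameters - tan (theta / 2), sin theta
    and - tan (theta / 2); for (3 + 4i) / 5 these are -1/2, 4/5 and -1/2. *)
Definition shear1 (t : R) (z : pT) : pT := (z.1 + t * z.2, z.2).
Definition shear2 (t : R) (z : pT) : pT := (z.1, z.2 + t * z.1).

Lemma measurable_shear1 t : measurable_fun setT (shear1 t).
Proof.
apply: measurable_fun_pair => //.
by apply: measurable_funD => //; apply: measurable_funM.
Qed.

Lemma measurable_shear2 t : measurable_fun setT (shear2 t).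
Proof.
apply: measurable_fun_pair => //.
by apply: measurable_funD => //; apply: measurable_funM.
Qed.

Lemma integral_shear1 t (f : pT -> \bar R) : measurable_fun setT f ->
  (forall x, 0 <= f x)%E ->
  (\int[leb2]_z f (shear1 t z) = \int[leb2]_z f z)%E.
Proof.
move=> mf f0.
have mft : measurable_fun setT (f \o shear1 t).
  exact: measurableT_comp (measurable_shear1 t).
transitivity (\int[leb]_y \int[leb]_x f (shear1 t (x, y)))%E.
  exact: (fubini_tonelli2 _ mft (fun=> f0 _)).
transitivity (\int[leb]_y \int[leb]_x f (x, y))%E; last first.
  exact/esym/(fubini_tonelli2 _ mf f0).
apply: eq_integral => y _.
apply: (@integral_translation (t * y) (fun x => f (x, y))) => //.
exact: measurableT_comp mf (pair2_measurable y).
Qed.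

Lemma integral_shear2 t (f : pT -> \bar R) : measurable_fun setT f ->
  (forall x, 0 <= f x)%E ->
  (\int[leb2]_z f (shear2 t z) = \int[leb2]_z f z)%E.
Proof.
move=> mf f0.
have mft : measurable_fun setT (f \o shear2 t).
  exact: measurableT_comp (measurable_shear2 t).
transitivity (\int[leb]_x \int[leb]_y f (shear2 t (x, y)))%E.
  exact: (fubini_tonelli1 _ mft (fun=> f0 _)).
transitivity (\int[leb]_x \int[leb]_y f (x, y))%E; last first.
  exact/esym/(fubini_tonelli1 _ mf f0).
apply: eq_integral => x _.
apply: (@integral_translation (t * x) (fun y => f (x, y))) => //.
exact: measurableT_comp mf (pair1_measurable x).
Qed.

(* Multiplication by (3 + 4i) / 5, which is not a root of unity *)
Definition plane_rot (z : pT) : pT :=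
  (3 / 5 * z.1 - 4 / 5 * z.2, 4 / 5 * z.1 + 3 / 5 * z.2).

(* Shears preserve Lebesgue measure by Fubini and translation invariance. *)
Lemma rot_shears z : plane_rot z = shear1 (- 2^-1) (shear2 (4 / 5) (shear1 (- 2^-1) z)).
Proof. by rewrite /plane_rot /shear1 /shear2 /=; congr (_, _); field. Qed.

Lemma measurable_rot : measurable_fun setT plane_rot.
Proof.
rewrite (_ : plane_rot = shear1 (- 2^-1) \o (shear2 (4 / 5) \o shear1 (- 2^-1))).
  apply: measurableT_comp; first exact: measurable_shear1.
  by apply: measurableT_comp; [exact: measurable_shear2|exact: measurable_shear1].
by apply/funext => z; exact: rot_shears.
Qed.

Lemma integral_rot (f : pT -> \bar R) : measurable_fun setT f ->
  (forall x, 0 <= f x)%E ->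
  (\int[leb2]_z f (plane_rot z) = \int[leb2]_z f z)%E.
Proof.
move=> mf f0; under eq_integral do rewrite rot_shears.
have m1 := measurableT_comp mf (measurable_shear1 (- 2^-1)).
have m2 := measurableT_comp m1 (measurable_shear2 (4 / 5)).
rewrite (integral_shear1 (- 2^-1) m2)//= (integral_shear2 (4 / 5) m1)//=.
exact: integral_shear1.
Qed.

End Plane_rotation.

(** * Gaussian moments on the real line *)

Section Gaussian_moments.
Variable R : realType.
Local Notation leb := (@lebesgue_measure R).
Local Notation rT := (measurableTypeR R).

Definition moment_fun (j : nat) (x : R) : R := x ^+ (2 * j) * gauss_fun x.
(** Not a primitive of [moment_fun j]: its derivative is a combination of two consecutive moment
    functions, which yields the recursion by integration over symmetric intervals. *)
Definition moment_prim (j : nat) (x : R) : R := x ^+ (2 * j).+1 * gauss_fun x.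

Lemma is_derive_gauss (x : R) : is_derive x 1 (@gauss_fun R) (- (2 * x) * gauss_fun x).
Proof.
rewrite (_ : @gauss_fun R = expR \o (fun y => - (y ^+ 2))); last by apply/funext.
have H : is_derive x 1 (fun y : R => - (y ^+ 2)) (- (2 * x)).
  by apply: is_derive_eq; rewrite /GRing.scale /= mulr1; ring.
by apply: is_derive_eq; rewrite mulrC.
Qed.

Lemma is_derive_moment j (x : R) : is_derive x 1 (moment_prim j)
  ((2 * j).+1%:R * moment_fun j x - 2 * moment_fun j.+1 x).
Proof.
have H := is_derive_gauss x.
have HX := @is_deriveX R R id (2 * j).+1 x 1 1 (is_derive_id x 1).
have := is_deriveM HX H.
have -> : (id : R -> R) ^+ (2 * j).+1 * gauss_fun = moment_prim j.
  by apply/funext => y; rewrite /moment_prim fctE /= fctE.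
move=> HM; apply: is_derive_eq; rewrite /= fctE /moment_fun /GRing.scale /= mulr1.
have -> : (2 * j.+1 = (2 * j).+2)%N by rewrite mulnS.
by rewrite !exprS; ring.
Qed.

Lemma moment_fun_ge0 j x : 0 <= moment_fun j x.
Proof. by rewrite mulr_ge0 ?gauss_fun_ge0// exprM exprn_ge0// sqr_ge0. Qed.

Lemma continuous_moment_fun j : continuous (moment_fun j).
Proof.
move=> x; apply: cvgM; first exact: exprn_continuous.
exact: continuous_gauss_fun.
Qed.

Lemma continuous_moment_prim j : continuous (moment_prim j).
Proof.
move=> x; apply: cvgM; first exact: exprn_continuous.
exact: continuous_gauss_fun.
Qed.

Lemma measurable_moment_fun j : measurable_fun setT (moment_fun j).
Proof. by apply: continuous_measurable_fun; exact: continuous_moment_fun. Qed.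

Definition box (n : nat) : set R := `[(- n.+1%:R : R), n.+1%:R]%classic.

Lemma integrable_box f n : continuous f -> leb.-integrable (box n) (EFin \o f).
Proof.
move=> cf; apply: continuous_compact_integrable; first exact: segment_compact.
exact: continuous_subspaceT.
Qed.

Lemma moment_int_fin j n : leb.-integrable (box n) (EFin \o moment_fun j).
Proof. apply: integrable_box; exact: continuous_moment_fun. Qed.

Lemma moment_box_rec j n :
  \int[leb]_(x in box n) moment_fun j.+1 x =
  (2 * j).+1%:R / 2 * (\int[leb]_(x in box n) moment_fun j x)
  - moment_prim j n.+1%:R.
Proof.
set N : R := n.+1%:R.
have N0 : - N < N by rewrite gtrN// ltr0n.
pose f x := (2 * j).+1%:R * moment_fun j x - 2 * moment_fun j.+1 x.
have cf : continuous f.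
  move=> x; apply: cvgB; apply: cvgMr; exact: continuous_moment_fun.
have E : (\int[leb]_(x in `[(- N)%R, N]) (f x)%:E =
    (moment_prim j N)%:E - (moment_prim j (- N))%:E)%E.
  apply: continuous_FTC2 => //.
  - exact: continuous_subspaceT.
  - split.
    + by move=> x _; have [] := is_derive_moment j x.
    + exact/cvg_at_right_filter/continuous_moment_prim.
    + exact/cvg_at_left_filter/continuous_moment_prim.
  - by move=> x _; rewrite derive1E; have [_ ->] := is_derive_moment j x.
have primN : moment_prim j (- N) = - moment_prim j N.
  rewrite /moment_prim /gauss_fun sqrrN exprNn -signr_odd /= oddM /= expr1.
  by rewrite mulN1r mulNr.
rewrite primN EFinN oppeK in E.
have mb : measurable (box n) by exact: measurable_itv.
have int_f : \int[leb]_(x in box n) f x =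
    (2 * j).+1%:R * (\int[leb]_(x in box n) moment_fun j x)
    - 2 * \int[leb]_(x in box n) moment_fun j.+1 x.
  rewrite RintegralB//; last 2 first.
  - by apply: integrable_box => x; apply: cvgMr; exact: continuous_moment_fun.
  - by apply: integrable_box => x; apply: cvgMr; exact: continuous_moment_fun.
  by rewrite !RintegralZl//; exact: moment_int_fin.
have : \int[leb]_(x in box n) f x = 2 * moment_prim j N.
  by rewrite /Rintegral E /= mulr_natl mulr2n.
rewrite int_f; move: (Rintegral _ _ _) (Rintegral _ _ _) (moment_prim _ _).
clear; move=> a b c; lra.
Qed.

Lemma moment_prim_cvg0 j : (fun n => moment_prim j n.+1%:R) @ \oo --> (0 : R).
Proof.
(* The majorant comes from the exponential series: e^(x^2) is at least x^(2j+2) / (j+1)!. *)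
have H : (fun n : nat => j.+1`!%:R * n.+1%:R^-1) @ \oo --> (0 : R).
  by have := seqM (seq_cst (j.+1`!%:R : R)) (@cvg_harmonic R); rewrite mulr0.
apply: (squeeze_cvgr _ (cvg_cst 0) H); apply: nearW => n.
set x : R := n.+1%:R; have x0 : 0 < x by rewrite ltr0n.
rewrite /moment_prim mulr_ge0 ?gauss_fun_ge0 ?exprn_ge0 ?(ltW x0)//=.
rewrite /gauss_fun expRN ler_pdivrMr ?expR_gt0// mulrAC ler_pdivlMr//.
have f0 : 0 < j.+1`!%:R :> R by rewrite ltr0n fact_gt0.
rewrite -exprSr -ler_pdivrMl// mulrC.
apply: le_trans (expR_ge1Dxn j (sqr_ge0 x)).
by rewrite -exprM mulnS lerDr.
Qed.

Lemma box_bigcup : \bigcup_n box n = [set: R].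
Proof.
apply/seteqP; split => // x _; have [n xn] : exists n : nat, `|x| <= n.+1%:R.
  exists (Num.truncn `|x|); exact/ltW/truncnS_gt.
by exists n => //; rewrite /box /= in_itv /= -ler_norml.
Qed.

Lemma moment_box_cvg j :
  (\int[leb]_(x in box n) (moment_fun j x)%:E)%E @[n --> \oo] -->
  (\int[leb]_x (moment_fun j x)%:E)%E.
Proof.
rewrite -box_bigcup; apply: ge0_nondecreasing_set_cvg_integral.
- apply/nondecreasing_seqP => n; apply/subsetPset => x; rewrite /box /= !in_itv /=.
  move=> /andP[x1 x2]; rewrite (le_trans _ x1) ?(le_trans x2)//.
    by rewrite ler_nat.
  by rewrite lerN2 ler_nat.
- by move=> n; exact: measurable_itv.
- by move=> n; apply/measurable_EFinP/measurable_funTS; exact: measurable_moment_fun.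
- by move=> n x _; rewrite lee_fin moment_fun_ge0.
Qed.

(** The values of the Gamma function at j + 1/2. *)
Fixpoint moment (j : nat) : R :=
  if j is k.+1 then (2 * k).+1%:R / 2 * moment k else Num.sqrt pi.

Lemma integral_moment j : (\int[leb]_x (moment_fun j x)%:E = (moment j)%:E)%E.
Proof.
elim: j => [|j IH].
  by rewrite -integralT_gauss; apply: eq_integral => x _; rewrite /moment_fun expr0 mul1r.
have H := @moment_box_cvg j; rewrite IH in H.
have rE k n : (\int[leb]_(x in box n) (moment_fun k x)%:E)%E =
    (\int[leb]_(x in box n) moment_fun k x)%:E.
  rewrite /Rintegral fineK//; apply: integrable_fin_num; last exact: moment_int_fin.
  exact: measurable_itv.
have {}H : (fun n => \int[leb]_(x in box n) moment_fun j x) @ \oo --> moment j.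
  exact: fine_fcvg H.
have H2 := @moment_box_cvg j.+1.
have H3 : (fun n => \int[leb]_(x in box n) moment_fun j.+1 x) @ \oo --> moment j.+1.
  have := seqB (seqM (seq_cst ((2 * j).+1%:R / 2 : R)) H) (@moment_prim_cvg0 j).
  by rewrite subr0 => H'; apply: (cvg_ext _ H') => n; rewrite moment_box_rec.
apply: cvg_unique H2 _ => //.
apply/fine_cvgP; split; first by apply: nearW => n; rewrite rE.
by apply: (cvg_ext _ H3) => n.
Qed.

End Gaussian_moments.

Section Plane_gauss.
Variable R : realType.
Local Notation leb := (@lebesgue_measure R).
Local Notation rT := (measurableTypeR R).
Local Notation leb2 := (leb \x leb)%E.
Local Notation pT := (rT * rT)%type.

Definition sqmod (z : pT) : R := z.1 ^+ 2 + z.2 ^+ 2.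

Lemma sqmod_ge0 z : 0 <= sqmod z.
Proof. by rewrite addr_ge0// sqr_ge0. Qed.

Lemma measurable_sqmod : measurable_fun setT sqmod.
Proof. by apply: measurable_funD; apply: measurable_funX. Qed.

Lemma measurable_plane_moment n a b : measurable_fun setT
  (fun z : pT => sqmod z ^+ n * (moment_fun a z.1 * moment_fun b z.2)).
Proof.
apply: measurable_funM; first exact: measurable_funX measurable_sqmod.
apply: measurable_funM.
  exact: measurableT_comp (@measurable_moment_fun R a) _.
exact: measurableT_comp (@measurable_moment_fun R b) _.
Qed.

(** Induction on n with a and b generalized, in place of polar coordinates: a factor x^2 + y^2
    raises a or b by one, and (a + 1/2) + (b + 1/2) = a + b + 1 is the new factor. *)
Lemma integral_plane_moment n a b :
  (\int[leb2]_z (sqmod z ^+ n * (moment_fun a z.1 * moment_fun b z.2))%:E =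
   (moment R a * moment R b * \prod_(k < n) (a + b + k).+1%:R)%:E)%E.
Proof.
elim: n a b => [|n IH] a b.
  rewrite big_ord0 mulr1; under eq_integral do rewrite expr0 mul1r.
  have m0 := measurable_plane_moment 0 a b.
  have {}m0 : measurable_fun setT (fun z : pT => (moment_fun a z.1 * moment_fun b z.2)%:E).
    by apply/measurable_EFinP; move: m0; under eq_fun do rewrite expr0 mul1r.
  transitivity (\int[leb]_x \int[leb]_y (moment_fun a x * moment_fun b y)%:E)%E.
    have f0 (z : pT) : (0 <= (moment_fun a z.1 * moment_fun b z.2)%:E)%E.
      by rewrite lee_fin mulr_ge0 ?moment_fun_ge0.
    exact: (fubini_tonelli1 _ m0 f0).
  pose g (x : rT) : \bar R := ((moment R b)%:E * (moment_fun a x)%:E)%E.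
  apply: (@eq_trans _ _ (\int[leb]_x g x)%E).
    apply: eq_integral => x _; under eq_integral do rewrite EFinM.
    rewrite ge0_integralZl//.
    - by rewrite integral_moment /g muleC.
    - by apply/measurable_EFinP; exact: measurable_moment_fun.
    - by move=> y _; rewrite lee_fin moment_fun_ge0.
    - by rewrite lee_fin moment_fun_ge0.
  rewrite /g ge0_integralZl//.
  - by rewrite integral_moment -EFinM mulrC.
  - by apply/measurable_EFinP; exact: measurable_moment_fun.
  - by move=> x _; rewrite lee_fin moment_fun_ge0.
  - rewrite lee_fin -lee_fin -integral_moment integral_ge0// => x _.
    by rewrite lee_fin moment_fun_ge0.
transitivity (\int[leb2]_z
   ((sqmod z ^+ n * (moment_fun a.+1 z.1 * moment_fun b z.2))%:E +
    (sqmod z ^+ n * (moment_fun a z.1 * moment_fun b.+1 z.2))%:E))%E.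
  apply: eq_integral => z _; rewrite -EFinD; congr (_%:E)%E.
  rewrite /sqmod /moment_fun !mulnS !exprS; ring.
have ge0 n' a' b' (z : pT) :
    (0 <= (sqmod z ^+ n' * (moment_fun a' z.1 * moment_fun b' z.2))%:E)%E.
  by rewrite lee_fin mulr_ge0 ?exprn_ge0 ?sqmod_ge0// mulr_ge0 ?moment_fun_ge0.
have mP n' a' b' : measurable_fun setT (fun z : pT =>
    (sqmod z ^+ n' * (moment_fun a' z.1 * moment_fun b' z.2))%:E).
  by apply/measurable_EFinP; exact: measurable_plane_moment.
rewrite ge0_integralD//.
rewrite !IH -EFinD; congr (_%:E)%E; rewrite big_ord_recl /= addn0.
rewrite addSn addnS.
have -> : \prod_(k < n) (a + b + bump 0 k).+1%:R = \prod_(k < n) ((a + b).+1 + k).+1%:R :> R.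
  by apply: eq_bigr => k _; rewrite /bump leq0n add1n addnS addSn.
have -> : ((a + b).+1%:R : R) = a%:R + b%:R + 1 by rewrite -natr1 natrD.
have e2 k : ((2 * k).+1%:R : R) = 2 * k%:R + 1 by rewrite -natr1 natrM.
by rewrite /= !e2; field.
Qed.

Lemma integral_plane_gauss n :
  (\int[leb2]_z (sqmod z ^+ n * (pi^-1 * expR (- sqmod z)))%:E = (n`!%:R)%:E)%E.
Proof.
transitivity (\int[leb2]_z ((pi^-1)%:E *
   (sqmod z ^+ n * (moment_fun 0 z.1 * moment_fun 0 z.2))%:E))%E.
  apply: eq_integral => z _; rewrite -EFinM; congr (_%:E)%E.
  rewrite /moment_fun !expr0 !mul1r /gauss_fun /sqmod opprD expRD; ring.
have pi0 : 0 < pi :> R by exact: pi_gt0.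
rewrite ge0_integralZl//.
- rewrite integral_plane_moment -EFinM; congr (_%:E)%E.
  rewrite /= -expr2 sqr_sqrtr ?ltW// mulrA mulVf ?gt_eqF// mul1r.
  rewrite -natr_prod; congr (_%:R); rewrite fact_prod big_add1 /= big_mkord.
  by apply: eq_bigr => k _; rewrite add0n.
- by apply/measurable_EFinP; exact: measurable_plane_moment.
- by move=> z _; rewrite lee_fin mulr_ge0 ?exprn_ge0 ?sqmod_ge0// mulr_ge0 ?moment_fun_ge0.
- by rewrite lee_fin invr_ge0 ltW.
Qed.

End Plane_gauss.

Section Tonelli.
Context {d1 d2 : measure_display} {T1 : measurableType d1}
  {T2 : measurableType d2} {R : realType}.
Variables (m1 : {sigma_finite_measure set T1 -> \bar R})
  (m2 : {sigma_finite_measure set T2 -> \bar R}).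

Lemma integral_prod_fun (f : T1 -> R) (g : T2 -> R) :
  measurable_fun setT f -> measurable_fun setT g ->
  (forall x, 0 <= f x) -> (forall x, 0 <= g x) ->
  (\int[m1 \x m2]_z (f z.1 * g z.2)%:E =
   (\int[m1]_x (f x)%:E) * \int[m2]_y (g y)%:E)%E.
Proof.
move=> mf mg f0 g0.
have mfg : measurable_fun setT (fun z : T1 * T2 => (f z.1 * g z.2)%:E).
  apply/measurable_EFinP/measurable_funM.
    exact: measurableT_comp mf _.
  exact: measurableT_comp mg _.
have fg0 (z : T1 * T2) : (0 <= (f z.1 * g z.2)%:E)%E.
  by rewrite lee_fin mulr_ge0.
have ig0 : (0 <= \int[m2]_w (g w)%:E)%E.
  by apply: integral_ge0 => w _; rewrite lee_fin.
rewrite (fubini_tonelli1 _ mfg fg0) /fubini_F.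
have inner x : (\int[m2]_y (f x * g y)%:E = (f x)%:E * \int[m2]_y (g y)%:E)%E.
  under eq_integral do rewrite EFinM.
  rewrite ge0_integralZl//.
  - by apply/measurable_EFinP.
  - by move=> w _; rewrite lee_fin.
  - by rewrite lee_fin.
under eq_integral do rewrite inner.
rewrite ge0_integralZr//.
- by apply/measurable_EFinP.
- by move=> w _; rewrite lee_fin.
Qed.

Lemma eq_tonelli1 (f h : T1 * T2 -> \bar R) :
  measurable_fun setT f -> measurable_fun setT h ->
  (forall z, 0 <= f z)%E -> (forall z, 0 <= h z)%E ->
  (forall x, \int[m2]_y f (x, y) = \int[m2]_y h (x, y))%E ->
  (\int[m1 \x m2]_z f z = \int[m1 \x m2]_z h z)%E.
Proof.
move=> mf mh f0 h0 fh.
rewrite (fubini_tonelli1 _ mf f0) (fubini_tonelli1 _ mh h0).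
by apply: eq_integral => x _; exact: fh.
Qed.

Lemma eq_tonelli2 (f h : T1 * T2 -> \bar R) :
  measurable_fun setT f -> measurable_fun setT h ->
  (forall z, 0 <= f z)%E -> (forall z, 0 <= h z)%E ->
  (forall y, \int[m1]_x f (x, y) = \int[m1]_x h (x, y))%E ->
  (\int[m1 \x m2]_z f z = \int[m1 \x m2]_z h z)%E.
Proof.
move=> mf mh f0 h0 fh.
rewrite (fubini_tonelli2 _ mf f0) (fubini_tonelli2 _ mh h0).
by apply: eq_integral => x _; exact: fh.
Qed.

End Tonelli.

(** * Integration over C^d: Gaussian integrals and rotation of one coordinate *)

Section Cspace.
Variable R : realType.
Local Notation leb := (@lebesgue_measure R).
Local Notation rT := (measurableTypeR R).
Definition plane_measure : set (rT * rT)%type -> \bar R := (leb \x leb)%E.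
HB.instance Definition _ := Measure.copy plane_measure (leb \x leb)%E.
Let plane_sigma_finite : sigma_finite setT plane_measure.
Proof. by apply: product_sigma_finite; exact: sigma_finiteT. Qed.
HB.instance Definition _ := Measure_isSigmaFinite.Build _ _ _ plane_measure
  plane_sigma_finite.
Local Notation leb2 := plane_measure.
Local Notation pT := (rT * rT)%type.
Local Notation cT d := (d.-tuple pT).
Local Notation mu d := (lebesgue_cspace R d).

Lemma integral_cspace0 (f : cT 0 -> \bar R) : measurable_fun setT f ->
  (\int[mu 0]_w f w = f [tuple])%E.
Proof. by move=> mf; rewrite /= integral_dirac// diracT mul1e. Qed.

Lemma integral_cspaceS d (f : cT d.+1 -> \bar R) : measurable_fun setT f ->
  (forall w, 0 <= f w)%E ->
  (\int[mu d.+1]_w f w = \int[leb2 \x mu d]_z f (cspace_cons z))%E.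
Proof.
move=> mf f0; have mc := @measurable_cspace_cons R d.
rewrite (@eq_measure_integral _ _ _ _
  (pushforward (leb2 \x mu d)%E (@cspace_cons R d)))//.
by rewrite ge0_integral_pushforward//= preimage_setT.
Qed.

Lemma sqmod_normc (x : pT) : normc (x.1 +i* x.2) ^+ 2 = sqmod x.
Proof. by rewrite normcE2. Qed.

Lemma measurable_gauss_density d : measurable_fun setT (@gauss_density R d).
Proof.
apply: measurable_funM => //; apply: measurableT_comp => //.
apply: measurableT_comp => //.
rewrite /sqnorm; apply: measurable_sum => i; rewrite /cpoint.
under eq_fun do rewrite sqmod_normc.
by apply: measurableT_comp (@measurable_sqmod R) _; exact: measurable_tnth.
Qed.

Lemma gauss_density_ge0 d (w : cT d) : 0 <= gauss_density w.
Proof. by rewrite mulr_ge0 ?expR_ge0// invr_ge0 exprn_ge0// pi_ge0. Qed.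

Lemma sqnorm_cons d (x : pT) (w : cT d) :
  sqnorm (cpoint (cspace_cons (x, w))) = sqmod x + sqnorm (cpoint w).
Proof.
rewrite /sqnorm big_ord_recl /cpoint /= sqmod_normc; congr (_ + _).
by apply: eq_bigr => i _; rewrite tnthS.
Qed.

Lemma gauss_density_cons d (x : pT) (w : cT d) :
  gauss_density (cspace_cons (x, w)) =
  (pi^-1 * expR (- sqmod x)) * gauss_density w.
Proof.
rewrite /gauss_density sqnorm_cons opprD expRD exprS invfM; ring.
Qed.

Lemma measurable_cprod d (f : 'I_d -> nat) : measurable_fun setT
  (fun w : cT d => (\prod_(i < d) sqmod (tnth w i) ^+ f i) * gauss_density w).
Proof.
apply: measurable_funM; last exact: measurable_gauss_density.
apply: measurable_prod => i _; apply: measurable_funX.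
by apply: measurableT_comp (@measurable_sqmod R) _; exact: measurable_tnth.
Qed.

Lemma integral_cprod d (f : 'I_d -> nat) :
  (\int[mu d]_w ((\prod_(i < d) sqmod (tnth w i) ^+ f i) * gauss_density w)%:E
   = ((\prod_(i < d) (f i)`!)%:R)%:E)%E.
Proof.
elim: d f => [|d IH] f.
  rewrite integral_cspace0; last by apply/measurable_EFinP; exact: measurable_cprod.
  by rewrite !big_ord0 /gauss_density /sqnorm big_ord0 oppr0 expR0 expr0 invr1 !mul1r.
rewrite integral_cspaceS; last 2 first.
- by apply/measurable_EFinP; exact: measurable_cprod.
- move=> w; rewrite lee_fin mulr_ge0 ?gauss_density_ge0//.
  by apply: prodr_ge0 => i _; rewrite exprn_ge0// sqmod_ge0.
pose F (x : pT) := sqmod x ^+ f ord0 * (pi^-1 * expR (- sqmod x)).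
pose G (w : cT d) := (\prod_(i < d) sqmod (tnth w i) ^+ f (lift ord0 i)) * gauss_density w.
apply: (@eq_trans _ _ (\int[leb2 \x mu d]_z (F z.1 * G z.2)%:E)%E).
  apply: eq_integral => -[x w] _; congr (_%:E)%E.
  rewrite gauss_density_cons big_ord_recl /F /G /=.
  under eq_bigr do rewrite tnthS.
  ring.
rewrite (integral_prod_fun leb2 (mu d)).
- by rewrite /F integral_plane_gauss IH -EFinM big_ord_recl natrM.
- apply: measurable_funM; first exact: measurable_funX (@measurable_sqmod R).
  apply: measurable_funM => //; apply: measurableT_comp => //.
  by apply: measurableT_comp => //; exact: measurable_sqmod.
- exact: measurable_cprod.
- move=> x; rewrite mulr_ge0 ?exprn_ge0 ?sqmod_ge0// mulr_ge0 ?expR_ge0//.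
  by rewrite invr_ge0 pi_ge0.
- move=> w; rewrite mulr_ge0 ?gauss_density_ge0//.
  by apply: prodr_ge0 => i _; rewrite exprn_ge0// sqmod_ge0.
Qed.

Definition rotc d (i : 'I_d) (w : cT d) : cT d :=
  [tuple (if j == i then plane_rot (tnth w j) else tnth w j) | j < d].

Lemma measurable_rotc d (i : 'I_d) : measurable_fun setT (rotc i).
Proof.
apply/measurable_fun_tnthP => j.
have -> : (@tnth d pT)^~ j \o rotc i =
    fun w => if j == i then plane_rot (tnth w j) else tnth w j.
  by apply/funext => w; rewrite /= tnth_mktuple.
case: (j == i); last exact: measurable_tnth.
by apply: measurableT_comp (@measurable_rot R) _; exact: measurable_tnth.
Qed.

Lemma rotc_ord0 d (x : pT) (w : cT d) :
  rotc ord0 (cspace_cons (x, w)) = cspace_cons (plane_rot x, w).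
Proof.
apply: eq_from_tnth => j; rewrite tnth_mktuple.
by case: (unliftP ord0 j) => [k ->|->] //=; rewrite !tnthS.
Qed.

Lemma rotc_lift d (i : 'I_d) (x : pT) (w : cT d) :
  rotc (lift ord0 i) (cspace_cons (x, w)) = cspace_cons (x, rotc i w).
Proof.
apply: eq_from_tnth => j; rewrite tnth_mktuple.
case: (unliftP ord0 j) => [k ->|->] //=; rewrite !tnthS tnth_mktuple.
by rewrite (inj_eq lift_inj).
Qed.

(** Induction on d by Tonelli: the first coordinate is rotated in the plane, any other one inside
    the remaining factor. *)
Lemma integral_rotc d (i : 'I_d) (f : cT d -> \bar R) : measurable_fun setT f ->
  (forall w, 0 <= f w)%E ->
  (\int[mu d]_w f (rotc i w) = \int[mu d]_w f w)%E.
Proof.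
elim: d i f => [|d IH] i f mf f0; first by case: i.
have mfr : measurable_fun setT (f \o rotc i).
  by apply: measurableT_comp mf _; exact: measurable_rotc.
have mc := @measurable_cspace_cons R d.
have mfc := measurableT_comp mf mc; have mfrc := measurableT_comp mfr mc.
apply: (@eq_trans _ _ _ _ (integral_cspaceS mfr (fun=> f0 _))).
apply/esym/(@eq_trans _ _ _ _ (integral_cspaceS mf f0))/esym.
case: (unliftP ord0 i) mfr mfrc => [j ->|->] mfr mfrc.
  apply: (eq_tonelli1 leb2 mfrc mfc (fun=> f0 _) (fun=> f0 _)) => x.
  apply: (@eq_trans _ _ (\int[mu d]_w f (cspace_cons (x, rotc j w)))%E).
    by apply: eq_integral => w _; rewrite /= rotc_lift.
  apply: (IH j (fun w => f (cspace_cons (x, w)))) => //.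
  exact: measurableT_comp mfc (pair1_measurable x).
apply: (eq_tonelli2 (mu d) mfrc mfc (fun=> f0 _) (fun=> f0 _)) => w.
apply: (@eq_trans _ _ (\int[leb2]_x f (cspace_cons (plane_rot x, w)))%E).
  by apply: eq_integral => x _; rewrite /= rotc_ord0.
apply: (@integral_rot _ (fun x => f (cspace_cons (x, w)))) => //.
exact: measurableT_comp mfc (pair2_measurable w).
Qed.

Lemma Rintegral_rotc d (i : 'I_d) (f : cT d -> R) : measurable_fun setT f ->
  \int[mu d]_w f (rotc i w) = \int[mu d]_w f w.
Proof.
move=> mf; rewrite /Rintegral; congr fine.
have mfE : measurable_fun setT (EFin \o f) by apply/measurable_EFinP.
rewrite [LHS]integralE [RHS]integralE; congr (_ - _)%E.
  rewrite -(integral_rotc i (measurable_funepos mfE) (funepos_ge0 _)).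
  by apply: eq_integral => w _; rewrite !funeposE.
rewrite -(integral_rotc i (measurable_funeneg mfE) (funeneg_ge0 _)).
by apply: eq_integral => w _; rewrite !funenegE.
Qed.

End Cspace.

(** * The Fock space *)

Section Complex_integral.
Context {dd : measure_display} {T : measurableType dd} {R : realType}.
Variable mu : {measure set T -> \bar R}.
Implicit Types (F G : T -> R[i]) (g : T -> R).

Definition cmeas F : Prop := measurable_fun setT (fun w => complex.Re (F w)) /\
  measurable_fun setT (fun w => complex.Im (F w)).

Definition cint F : R[i] := (\int[mu]_w (complex.Re (F w)))%R +i*
  (\int[mu]_w (complex.Im (F w)))%R.

Definition cintegrable F : Prop :=
  cmeas F /\ mu.-integrable setT (fun w => (normc (F w))%:E).

Lemma cmeas_cst (c : R[i]) : cmeas (fun=> c).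
Proof. by split; exact: measurable_cst. Qed.

Lemma cmeas_add F G : cmeas F -> cmeas G -> cmeas (fun w => F w + G w).
Proof.
move=> [F1 F2] [G1 G2]; split.
  by under eq_fun do rewrite raddfD; exact: measurable_funD.
by under eq_fun do rewrite raddfD; exact: measurable_funD.
Qed.

Lemma Re_mul (x y : R[i]) : complex.Re (x * y) =
  complex.Re x * complex.Re y - complex.Im x * complex.Im y.
Proof. by case: x y => a b [c e]. Qed.

Lemma Im_mul (x y : R[i]) : complex.Im (x * y) =
  complex.Re x * complex.Im y + complex.Im x * complex.Re y.
Proof. by case: x y => a b [c e]. Qed.

Lemma cmeas_mul F G : cmeas F -> cmeas G -> cmeas (fun w => F w * G w).
Proof.
move=> [F1 F2] [G1 G2]; split.
  by under eq_fun do rewrite Re_mul; apply: measurable_funB; exact: measurable_funM.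
by under eq_fun do rewrite Im_mul; apply: measurable_funD; exact: measurable_funM.
Qed.

Lemma cmeas_real g : measurable_fun setT g -> cmeas (fun w => (g w)%:C).
Proof. by move=> mg; split => //=; exact: measurable_cst. Qed.

Lemma cmeas_conj F : cmeas F -> cmeas (fun w => conjc (F w)).
Proof.
have E1 (x : R[i]) : complex.Re (conjc x) = complex.Re x by case: x.
have E2 (x : R[i]) : complex.Im (conjc x) = - complex.Im x by case: x.
move=> [F1 F2]; split; first by under eq_fun do rewrite E1.
by under eq_fun do rewrite E2; exact: measurable_funN.
Qed.

Lemma cmeas_sum (I : Type) (s : seq I) (H : I -> T -> R[i]) :
  (forall i, cmeas (H i)) -> cmeas (fun w => \sum_(i <- s) H i w).
Proof.
move=> mH; elim: s => [|i s IH].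
  by under [X in cmeas X]eq_fun do rewrite big_nil; exact: cmeas_cst.
by under [X in cmeas X]eq_fun do rewrite big_cons; exact: cmeas_add.
Qed.

Lemma cmeas_prod (I : Type) (s : seq I) (H : I -> T -> R[i]) :
  (forall i, cmeas (H i)) -> cmeas (fun w => \prod_(i <- s) H i w).
Proof.
move=> mH; elim: s => [|i s IH].
  by under [X in cmeas X]eq_fun do rewrite big_nil; exact: cmeas_cst.
by under [X in cmeas X]eq_fun do rewrite big_cons; exact: cmeas_mul.
Qed.

Lemma cmeas_exp F n : cmeas F -> cmeas (fun w => F w ^+ n).
Proof.
move=> mF; elim: n => [|n IH]; first exact: cmeas_cst.
by under [X in cmeas X]eq_fun do rewrite exprS; exact: cmeas_mul.
Qed.

Lemma cmeas_cvg (u : nat -> T -> R[i]) F : (forall n, cmeas (u n)) ->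
  (forall w, ccvg (u ^~ w) (F w)) -> cmeas F.
Proof.
move=> mu_ uF; split.
  by apply: (measurable_fun_cvg (h := fun n w => complex.Re (u n w)));
     [move=> n; exact: (mu_ n).1 | move=> w _; exact: (uF w).1].
by apply: (measurable_fun_cvg (h := fun n w => complex.Im (u n w)));
   [move=> n; exact: (mu_ n).2 | move=> w _; exact: (uF w).2].
Qed.

Lemma measurable_normc_sq F : cmeas F -> measurable_fun setT (fun w => normc (F w) ^+ 2).
Proof.
move=> [F1 F2]; under eq_fun do rewrite normcE2.
by apply: measurable_funD; exact: measurable_funX.
Qed.

Lemma measurable_normc F : cmeas F -> measurable_fun setT (fun w => normc (F w)).
Proof.
move=> mF; rewrite (_ : (fun w => _) = Num.sqrt \o (fun w => normc (F w) ^+ 2)).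
  by apply: measurableT_comp (measurable_normc_sq mF) => //; exact: continuous_measurable_fun (@sqrt_continuous R).
by apply/funext => w /=; rewrite sqrtr_sqr ger0_norm ?normc_ge0.
Qed.

Lemma cintegrable_le F g : cmeas F -> mu.-integrable setT (EFin \o g) ->
  (forall w, normc (F w) <= g w) -> cintegrable F.
Proof.
move=> mF ig Fg; split=> //; apply: le_integrable ig => //.
  by apply/measurable_EFinP; exact: measurable_normc.
move=> w _ /=; rewrite lee_fin ger0_norm ?normc_ge0//.
exact: le_trans (Fg w) (ler_norm _).
Qed.

Lemma cintegrable_Re F : cintegrable F ->
  mu.-integrable setT (EFin \o (fun w => complex.Re (F w))).
Proof.
move=> [mF iF]; apply: le_integrable iF => //.
  by apply/measurable_EFinP; exact: mF.1.
by move=> w _ /=; rewrite lee_fin (ger0_norm (normc_ge0 _)) Re_le_normc.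
Qed.

Lemma cintegrable_Im F : cintegrable F ->
  mu.-integrable setT (EFin \o (fun w => complex.Im (F w))).
Proof.
move=> [mF iF]; apply: le_integrable iF => //.
  by apply/measurable_EFinP; exact: mF.2.
by move=> w _ /=; rewrite lee_fin (ger0_norm (normc_ge0 _)) Im_le_normc.
Qed.

Lemma cintegrableD F G : cintegrable F -> cintegrable G ->
  cintegrable (fun w => F w + G w).
Proof.
move=> iF iG; apply: (@cintegrable_le _ (fun w => normc (F w) + normc (G w))).
- exact: cmeas_add iF.1 iG.1.
- exact: integrableD iF.2 iG.2.
- by move=> w; exact: le_normcD.
Qed.

Lemma cintegrableZ (c : R[i]) F : cintegrable F -> cintegrable (fun w => c * F w).
Proof.
move=> iF; apply: (@cintegrable_le _ (fun w => normc c * normc (F w))).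
- exact: cmeas_mul (cmeas_cst c) iF.1.
- exact: integrableZl iF.2.
- by move=> w; rewrite ComplexField.Normc.normcM.
Qed.

Lemma cintD F G : cintegrable F -> cintegrable G ->
  cint (fun w => F w + G w) = cint F + cint G.
Proof.
move=> iF iG; rewrite /cint; apply/eqP; rewrite eq_complex /=; apply/andP; split; apply/eqP.
  rewrite -RintegralD//; try exact: cintegrable_Re.
  by congr Rintegral; apply/funext => w; rewrite raddfD.
rewrite -RintegralD//; try exact: cintegrable_Im.
by congr Rintegral; apply/funext => w; rewrite raddfD.
Qed.

Lemma cintZ (c : R[i]) F : cintegrable F -> cint (fun w => c * F w) = c * cint F.
Proof.
move=> iF; have [i1 i2] := (cintegrable_Re iF, cintegrable_Im iF).
have iZ1 r : mu.-integrable setT (EFin \o (fun w => r * complex.Re (F w))).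
  exact: integrableZl i1.
have iZ2 r : mu.-integrable setT (EFin \o (fun w => r * complex.Im (F w))).
  exact: integrableZl i2.
apply/eqP; rewrite eq_complex Re_mul Im_mul /=; apply/andP; split; apply/eqP.
  rewrite -mulNr -!RintegralZl// -RintegralD//.
  by congr Rintegral; apply/funext => w; rewrite Re_mul mulNr.
rewrite -!RintegralZl// -RintegralD//.
by congr Rintegral; apply/funext => w; rewrite Im_mul.
Qed.

Lemma cint0 : cint (fun=> 0) = 0.
Proof. by rewrite /cint /Rintegral integral0. Qed.

Lemma cintegrable0 : cintegrable (fun=> 0).
Proof.
split; first exact: cmeas_cst.
rewrite (_ : (fun=> _) = cst 0%E); first exact: integrable0.
by apply/funext => w; rewrite ComplexField.Normc.normc0.
Qed.

Lemma cintegrable_sum (I : Type) (s : seq I) (H : I -> T -> R[i]) :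
  (forall i, cintegrable (H i)) -> cintegrable (fun w => \sum_(i <- s) H i w).
Proof.
move=> iH; elim: s => [|i s IH].
  by under [X in cintegrable X]eq_fun do rewrite big_nil; exact: cintegrable0.
by under [X in cintegrable X]eq_fun do rewrite big_cons; exact: cintegrableD.
Qed.

Lemma cint_sum (I : Type) (s : seq I) (H : I -> T -> R[i]) :
  (forall i, cintegrable (H i)) ->
  cint (fun w => \sum_(i <- s) H i w) = \sum_(i <- s) cint (H i).
Proof.
move=> iH; elim: s => [|i s IH].
  by under eq_fun do rewrite big_nil; rewrite big_nil cint0.
under eq_fun do rewrite big_cons.
by rewrite cintD ?IH ?big_cons//; exact: cintegrable_sum.
Qed.

Lemma cint_conj F : cintegrable F -> cint (fun w => conjc (F w)) = conjc (cint F).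
Proof.
have E1 (x : R[i]) : complex.Re (conjc x) = complex.Re x by case: x.
have E2 (x : R[i]) : complex.Im (conjc x) = -1 * complex.Im x.
  by rewrite mulN1r; case: x.
move=> iF; rewrite /cint /=; congr (_ +i* _).
  by congr Rintegral; apply/funext => w.
rewrite -[RHS]mulN1r -RintegralZl//; last exact: cintegrable_Im.
by congr Rintegral; apply/funext => w.
Qed.

Lemma Rintegral_dominated_cvg (f : nat -> T -> R) (h g : T -> R) :
  (forall n, measurable_fun setT (f n)) -> (forall w, f ^~ w @ \oo --> h w) ->
  mu.-integrable setT (EFin \o g) -> (forall n w, `|f n w| <= g w) ->
  (fun n => \int[mu]_w f n w)%R @ \oo --> (\int[mu]_w h w)%R.
Proof.
move=> mf fh ig fg.
have mh : measurable_fun setT h by apply: (measurable_fun_cvg mf) => w _; exact: fh.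
have hg w : `|h w| <= g w.
  have H : (fun n => `|f n w|) @ \oo --> `|h w| by apply: cvg_norm; exact: fh.
  by apply: (cvgr_to_le H); exact: nearW.
have ih : mu.-integrable setT (EFin \o h).
  apply: le_integrable ig => //; first exact/measurable_EFinP.
  by move=> w _ /=; rewrite lee_fin (le_trans (hg w)) ?ler_norm.
apply: fine_cvg; rewrite fineK; last exact: integrable_fin_num.
apply: (@dominated_cvg _ _ _ mu setT measurableT (fun n => EFin \o f n) (EFin \o h) (EFin \o g)) => //.
- by move=> n; apply/measurable_EFinP.
- by move=> w _; apply: cvg_EFin; [exact: nearW | exact: fh].
- by move=> n w _ /=; rewrite lee_fin.
Qed.

Lemma cint_cvg (u : nat -> T -> R[i]) F g : (forall n, cmeas (u n)) ->
  (forall w, ccvg (u ^~ w) (F w)) -> mu.-integrable setT (EFin \o g) ->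
  (forall n w, normc (u n w) <= g w) -> ccvg (fun n => cint (u n)) (cint F).
Proof.
move=> mu_ uF ig ug; split => /=.
  apply: (Rintegral_dominated_cvg (g := g)) => //.
  - by move=> n; exact: (mu_ n).1.
  - by move=> w; exact: (uF w).1.
  - by move=> n w; exact: le_trans (Re_le_normc _) (ug n w).
apply: (Rintegral_dominated_cvg (g := g)) => //.
- by move=> n; exact: (mu_ n).2.
- by move=> w; exact: (uF w).2.
- by move=> n w; exact: le_trans (Im_le_normc _) (ug n w).
Qed.

End Complex_integral.

Section Omega.
Variable R : realType.

Definition omega : R[i] := (3 / 5) +i* (4 / 5).

(* Modulo 5 all positive powers of 3 + 4i are equal to 3 + 4i. *)
Lemma omega_exp k : exists x y : int,
  (5 * omega) ^+ k.+1 = (5 * x + 3)%:~R +i* (5 * y + 4)%:~R.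
Proof.
have E : 5 * omega = 3 +i* 4.
  rewrite -[5](rmorph_nat (real_complex R)) /omega; simpc.
  by congr (_ +i* _); field.
elim: k => [|k [x [y IH]]].
  by exists 0, 0; rewrite expr1 E mulr0 !add0r.
exists (3 * x - 4 * y - 2), (4 * x + 3 * y + 4).
rewrite exprS IH E; simpc; congr (_ +i* _);
  rewrite !(rmorphD, rmorphM, rmorphB) /=; ring.
Qed.

(** Otherwise 5^k would be a power of 3 + 4i, whose imaginary part is 4 modulo 5 and so not 0. *)
Lemma omega_exp_neq1 k : (0 < k)%N -> omega ^+ k != 1.
Proof.
case: k => // k _; apply/eqP => w1.
have [x [y]] := omega_exp k; rewrite exprMn w1 mulr1.
have -> : (5 ^+ k.+1 : R[i]) = (5 ^+ k.+1 : R)%:C by rewrite rmorphXn rmorph_nat.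
move=> [_ /esym/eqP]; rewrite intr_eq0 => /eqP; lia.
Qed.

Lemma omega_conj : omega * conjc omega = 1.
Proof. by rewrite /omega /=; simpc; congr (_ +i* _); field. Qed.

Lemma omega_exp_conj_neq1 a b : a != b -> omega ^+ a * conjc omega ^+ b != 1.
Proof.
move=> ab; apply/eqP => E.
have {E} : omega ^+ a = omega ^+ b.
  have := congr1 (fun z => z * omega ^+ b) E.
  by rewrite mul1r -mulrA -exprMn (mulrC (conjc _)) omega_conj expr1n mulr1.
have w0 k : omega ^+ k \is a GRing.unit.
  rewrite unitrX// unitfE; apply/eqP => w0.
  by move: omega_conj; rewrite w0 mul0r => /eqP; rewrite eq_sym oner_eq0.
wlog lab : a b ab / (a < b)%N => [H|].
  case: (ltngtP a b) (ab) => // l _; first exact: H.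
  by move=> /esym; apply: H => //; rewrite eq_sym.
rewrite -(subnK (ltnW lab)) exprD -[X in X = _]mul1r => /(mulIr (w0 a))/esym/eqP.
by apply/negP/omega_exp_neq1; rewrite subn_gt0.
Qed.

End Omega.

(** * Taylor coefficients as Gaussian integrals against monomials *)

Section Fock_pairing.
Variables (R : realType) (d : nat).
Local Notation mi := (multiindex d).
Local Notation cT := (cspace R d).
Local Notation mu := (lebesgue_cspace R d).
Local Notation gauss := (@gauss_density R d).
Implicit Types (v : power_series R d) (m : mi) (w : cT).

Definition ev v w : R[i] := eval_series v (cpoint w).
Definition mono m w : R[i] := monomial (cpoint w) m.

Lemma cmeas_mono m : cmeas (mono m).
Proof.
apply: cmeas_prod => i; apply: cmeas_exp; split => /=.
  by apply: measurableT_comp; [exact: measurable_fst|exact: measurable_tnth].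
by apply: measurableT_comp; [exact: measurable_snd|exact: measurable_tnth].
Qed.

Lemma eval_series_ccvg v z : entire v ->
  ccvg (fun n => psum n (fun m => v m * monomial z m)) (eval_series v z).
Proof.
move=> /(_ z)/esum_bound[|B HB]; first by move=> m; exact: normc_ge0.
exact: ccvg_multisum HB.
Qed.

Lemma cmeas_ev v : entire v -> cmeas (ev v).
Proof.
move=> ev_; apply: cmeas_cvg (fun w => eval_series_ccvg (cpoint w) ev_) => n.
by apply: cmeas_sum => m; apply: cmeas_mul; [exact: cmeas_cst|exact: cmeas_mono].
Qed.

Lemma normc_mono_sq m w : normc (mono m w) ^+ 2 = \prod_(i < d) sqmod (tnth w i) ^+ m i.
Proof.
rewrite normc_monomial -prodrXl; apply: eq_bigr => i _.
by rewrite exprAC sqmod_normc.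
Qed.

Lemma integral_mono m :
  (\int[mu]_w (normc (mono m w) ^+ 2 * gauss w)%:E = ((\prod_(i < d) (m i)`!)%:R)%:E)%E.
Proof.
rewrite -(integral_cprod R (fun i => m i)).
by apply: eq_integral => w _; rewrite normc_mono_sq.
Qed.

Lemma integrable_ge0 (g : cT -> R) : measurable_fun setT g -> (forall w, 0 <= g w) ->
  (\int[mu]_w (g w)%:E < +oo)%E -> mu.-integrable setT (EFin \o g).
Proof.
move=> mg g0 ig; apply/integrableP; split; first exact/measurable_EFinP.
by under eq_integral do rewrite /= ger0_norm//.
Qed.

Lemma integrable_mono m :
  mu.-integrable setT (EFin \o (fun w => normc (mono m w) ^+ 2 * gauss w)).
Proof.
apply: integrable_ge0.
- apply: measurable_funM; last exact: measurable_gauss_density.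
  exact: measurable_normc_sq (cmeas_mono m).
- by move=> w; rewrite mulr_ge0 ?gauss_density_ge0// sqr_ge0.
- by rewrite integral_mono ltry.
Qed.

Lemma integrable_gauss : mu.-integrable setT (EFin \o gauss).
Proof.
have := integrable_mono mpoly.mnm0; congr (mu.-integrable _ (EFin \o _)).
apply/funext => w; rewrite normc_mono_sq big1 ?mul1r// => i _.
by rewrite mpoly.mnmE expr0.
Qed.

Lemma integrable_fock v : hdom (fock_space R d) v ->
  mu.-integrable setT (EFin \o (fun w => normc (ev v w) ^+ 2 * gauss w)).
Proof.
move=> [ev_ iv]; apply: integrable_ge0 => //.
- apply: measurable_funM; last exact: measurable_gauss_density.
  exact: measurable_normc_sq (cmeas_ev ev_).
- by move=> w; rewrite mulr_ge0 ?gauss_density_ge0// sqr_ge0.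
Qed.

Lemma cpoint_rotc i w : cpoint (rotc i w) =
  fun j => (if j == i then omega R else 1) * cpoint w j.
Proof.
apply/funext => j; rewrite /cpoint tnth_mktuple.
case: (j == i); last by rewrite mul1r.
by rewrite /omega /plane_rot /=; simpc; congr (_ +i* _); field.
Qed.

Lemma mono_rotc i m w : mono m (rotc i w) = omega R ^+ m i * mono m w.
Proof.
rewrite /mono cpoint_rotc /monomial.
under eq_bigr do rewrite exprMn.
rewrite big_split /= (bigD1 i)//= eqxx [X in _ * X * _]big1 ?mulr1// => j /negPf ->.
by rewrite expr1n.
Qed.

Lemma normc_omega : normc (omega R) = 1.
Proof.
have := omega_conj R; move=> /(congr1 (@normc R)).
rewrite ComplexField.Normc.normcM normc_conj ComplexField.Normc.normc1 -expr2.
by move/eqP; rewrite sqrf_eq1 => /orP[/eqP//|/eqP E]; have := normc_ge0 (omega R); rewrite E; lra.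
Qed.

Lemma sqnorm_rotc i w : sqnorm (cpoint (rotc i w)) = sqnorm (cpoint w).
Proof.
apply: eq_bigr => j _; rewrite cpoint_rotc ComplexField.Normc.normcM.
by case: ifP => _; rewrite ?normc_omega ?ComplexField.Normc.normc1 mul1r.
Qed.

Lemma gauss_rotc i w : gauss (rotc i w) = gauss w.
Proof. by rewrite /gauss_density sqnorm_rotc. Qed.

Definition cball (r : R) : set cT := [set w | sqnorm (cpoint w) <= r].

(** The Gaussian density cut off to a ball, still invariant under rotations. On a ball the partial
    sums of an entire series are uniformly bounded, which justifies integration term by term; the
    radius tends to infinity only afterwards. *)
Definition wt r w : R := \1_(cball r) w * gauss w.

Lemma measurable_cball r : measurable (cball r).
Proof.
have -> : cball r = (fun w => sqnorm (cpoint w)) @^-1` `]-oo, r].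
  by apply/seteqP; split => w /=; rewrite in_itv.
rewrite -[X in measurable X]setTI.
have ms : measurable_fun setT (fun w : cT => sqnorm (cpoint w)).
  rewrite /sqnorm; apply: measurable_sum => i; rewrite /cpoint.
  under eq_fun do rewrite sqmod_normc.
  by apply: measurableT_comp (@measurable_sqmod R) _; exact: measurable_tnth.
by apply: ms => //; exact: measurable_itv.
Qed.

Lemma measurable_wt r : measurable_fun setT (wt r).
Proof.
apply: measurable_funM; last exact: measurable_gauss_density.
exact: measurable_indic (measurable_cball r).
Qed.

Lemma wt_ge0 r w : 0 <= wt r w.
Proof. by rewrite mulr_ge0 ?gauss_density_ge0// indicE. Qed.

Lemma wt_le r w : wt r w <= gauss w.
Proof.
by rewrite -[leRHS]mul1r ler_wpM2r ?gauss_density_ge0// indicE; case: (_ \in _).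
Qed.

Lemma wt_rotc r i w : wt r (rotc i w) = wt r w.
Proof.
rewrite /wt gauss_rotc !indicE; congr ((nat_of_bool _)%:R * _).
by apply/idP/idP; rewrite !in_setE /cball /= sqnorm_rotc.
Qed.

Lemma wt_out r w : ~ cball r w -> wt r w = 0.
Proof. by move=> nb; rewrite /wt indicE memNset// mul0r. Qed.

(* The inner product of F against the monomial m on the ball of radius sqrt r *)
Definition pairing r (F : cT -> R[i]) m : R[i] :=
  cint mu (fun w => F w * conjc (mono m w) * (wt r w)%:C).

Lemma cint_rotc i (F : cT -> R[i]) : cmeas F ->
  cint mu (fun w => F (rotc i w)) = cint mu F.
Proof.
move=> [m1 m2]; rewrite /cint; congr (_ +i* _).
  exact: (Rintegral_rotc i m1).
exact: (Rintegral_rotc i m2).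
Qed.

Lemma cball_mono r m w : 0 <= r -> cball r w ->
  normc (mono m w) <= (1 + r) ^+ mpoly.mdeg m.
Proof.
move=> r0 wr; rewrite normc_monomial mpoly.mdegE -prodrXr; apply: ler_prod => i _.
have H : normc (cpoint w i) ^+ 2 <= r.
  apply: le_trans wr; rewrite /sqnorm (bigD1 i)//= lerDl.
  by apply: sumr_ge0 => j _; exact: sqr_ge0.
move: (normc_ge0 (cpoint w i)); move: (normc _) H => x H x0.
rewrite exprn_ge0//= lerXn2r ?nnegrE//; first lra.
by have := sqr_ge0 (x - 1); nra.
Qed.

Lemma cintegrable_wt r (F : cT -> R[i]) C : cmeas F -> 0 <= C ->
  (forall w, cball r w -> normc (F w) <= C) ->
  cintegrable mu (fun w => F w * (wt r w)%:C).
Proof.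
move=> mF C0 FC; apply: (@cintegrable_le _ _ _ _ _ (fun w => C * gauss w)).
- by apply: cmeas_mul => //; apply: cmeas_real; exact: measurable_wt.
- exact: integrableZl integrable_gauss.
- move=> w; rewrite normcMC ?wt_ge0//.
  have [wr|nwr] := pselect (cball r w).
    by rewrite ler_pM ?normc_ge0 ?wt_ge0 ?wt_le// FC.
  by rewrite wt_out// mulr0 mulr_ge0 ?gauss_density_ge0.
Qed.

Lemma cmeas_pairing (F : cT -> R[i]) r m : cmeas F ->
  cmeas (fun w => F w * conjc (mono m w) * (wt r w)%:C).
Proof.
move=> mF; apply: cmeas_mul; last by apply: cmeas_real; exact: measurable_wt.
by apply: cmeas_mul => //; apply: cmeas_conj; exact: cmeas_mono.
Qed.

Lemma cintegrable_mono_wt r m k : 0 <= r ->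
  cintegrable mu (fun w => mono m w * conjc (mono k w) * (wt r w)%:C).
Proof.
move=> r0.
apply: (@cintegrable_wt r (fun w => mono m w * conjc (mono k w))
  ((1 + r) ^+ mpoly.mdeg m * (1 + r) ^+ mpoly.mdeg k)).
- by apply: cmeas_mul; [|apply: cmeas_conj]; exact: cmeas_mono.
- by rewrite mulr_ge0 ?exprn_ge0//; lra.
- move=> w wr; rewrite ComplexField.Normc.normcM normc_conj.
  by rewrite ler_pM ?normc_ge0// cball_mono.
Qed.

(** If m and k differ at i, rotating the i-th coordinate preserves the integral but multiplies the
    integrand by a constant different from 1. *)
Lemma pairing_ortho r m k : 0 <= r -> m != k -> pairing r (mono m) k = 0.
Proof.
move=> r0 mk; have [i mki] : exists i, m i != k i.
  apply/existsP; apply: contraR mk => /existsPn H; apply/eqP/mpoly.mnmP => i.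
  by apply/eqP; have := H i; rewrite negbK.
pose F w := mono m w * conjc (mono k w) * (wt r w)%:C.
have mF : cmeas F by apply: cmeas_pairing; exact: cmeas_mono.
have := cint_rotc i mF.
pose c := omega R ^+ m i * conjc (omega R) ^+ k i.
have -> : (fun w => F (rotc i w)) = (fun w => c * F w).
  apply/funext => w; rewrite /F !mono_rotc wt_rotc rmorphM rmorphXn /c /=; ring.
rewrite cintZ; last exact: cintegrable_mono_wt.
move/eqP; rewrite -subr_eq0 -[X in _ - X]mul1r -mulrBl mulf_eq0 subr_eq0.
by rewrite (negPf (omega_exp_conj_neq1 _ mki)) => /eqP.
Qed.

Lemma ccvgZ (c : R[i]) u x : ccvg u x -> ccvg (fun n => c * u n) (c * x).
Proof.
move=> [H1 H2]; split.
  rewrite Re_mul; under eq_fun do rewrite Re_mul.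
  exact: seqB (seqM (seq_cst _) H1) (seqM (seq_cst _) H2).
rewrite Im_mul; under eq_fun do rewrite Im_mul.
exact: seq_add (seqM (seq_cst _) H2) (seqM (seq_cst _) H1).
Qed.

(** By dominated convergence on the ball; orthogonality leaves only the term of index k as soon as n
    exceeds its degree. *)
Lemma pairing_series r v k : 0 <= r -> entire v ->
  pairing r (ev v) k = v k * pairing r (mono k) k.
Proof.
move=> r0 ev_.
have r1 : 0 <= 1 + r by lra.
pose s n w := psum n (fun m => v m * mono m w).
have ms n : cmeas (s n).
  by apply: cmeas_sum => m; apply: cmeas_mul; [exact: cmeas_cst|exact: cmeas_mono].
have [C HC] := entire_bound ev_ r1.
have sC n w : cball r w -> normc (s n w) <= C.
  move=> wr; apply: le_trans (HC n); rewrite /s /psum (le_trans (normc_sum _ _ _))//.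
  apply: ler_sum => m _; rewrite ComplexField.Normc.normcM ler_wpM2l ?normc_ge0//.
  exact: cball_mono.
have C0 : 0 <= C.
  by apply: le_trans (HC 0); apply: psum_ge0 => m; rewrite mulr_ge0 ?normc_ge0// exprn_ge0.
apply: (@ccvg_unique _ (fun n => pairing r (s n) k)).
  apply: (@cint_cvg _ _ _ _ _ _ (fun w => C * (1 + r) ^+ mpoly.mdeg k * gauss w)).
  - by move=> n; exact: cmeas_pairing.
  - move=> w; under [X in ccvg X]eq_fun do rewrite -mulrA mulrC.
    rewrite -mulrA [X in ccvg _ X]mulrC; apply: ccvgZ; exact: eval_series_ccvg.
  - exact: integrableZl integrable_gauss.
  - move=> n w; rewrite normcMC ?wt_ge0//.
    have [wr|nwr] := pselect (cball r w).
      rewrite ler_pM ?normc_ge0 ?wt_ge0 ?wt_le//.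
      rewrite ComplexField.Normc.normcM normc_conj.
      by rewrite ler_pM ?normc_ge0 ?sC// cball_mono.
    by rewrite wt_out// mulr0 mulr_ge0 ?gauss_density_ge0// mulr_ge0// exprn_ge0.
apply: ccvg_near; exists (mpoly.mdeg k).+1 => // n /= kn.
have -> : pairing r (s n) k = psum n (fun m => v m * pairing r (mono m) k).
  have E m : v m * pairing r (mono m) k = cint mu (fun w =>
      v m * (mono m w * conjc (mono k w) * (wt r w)%:C)).
    by rewrite cintZ//; exact: cintegrable_mono_wt.
  rewrite /psum; under [RHS]eq_bigr do rewrite E.
  rewrite -cint_sum; last by move=> m; exact/cintegrableZ/cintegrable_mono_wt.
  congr cint; apply/funext => w; rewrite /s /psum !mulr_suml.
  by apply: eq_bigr => m _; rewrite !mulrA.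
rewrite /psum (bigD1 (mpoly.BMultinom kn))//= big1 ?addr0// => m mk.
by rewrite pairing_ortho ?mulr0.
Qed.

Lemma wt_cvg w : (fun n => wt n%:R w) @ \oo --> gauss w.
Proof.
apply: cvg_near_cst; exists `|Num.ceil (sqnorm (cpoint w))|%N => // n /= H.
rewrite /wt indicE mem_set ?mul1r// /cball /=.
apply: (le_trans (ceil_ge _)); rewrite pmulrn ler_int.
by apply: le_trans (ler_norm _) _; rewrite -abszE lez_nat.
Qed.

Lemma le_mul_sq (x y : R) : x * y <= x ^+ 2 + y ^+ 2.
Proof. have := sqr_ge0 (x - y); have := sqr_ge0 x; have := sqr_ge0 y; nra. Qed.

Lemma pairing_cvg (F : cT -> R[i]) m : cmeas F ->
  mu.-integrable setT (EFin \o (fun w => normc (F w) ^+ 2 * gauss w)) ->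
  ccvg (fun n => pairing n%:R F m)
    (cint mu (fun w => F w * conjc (mono m w) * (gauss w)%:C)).
Proof.
move=> mF iF.
apply: (@cint_cvg _ _ _ _ _ _ (fun w => normc (F w) ^+ 2 * gauss w + normc (mono m w) ^+ 2 * gauss w)).
- by move=> n; exact: cmeas_pairing.
- move=> w; apply: ccvgZ; split => /=; last exact: seq_cst.
  exact: wt_cvg.
- exact: integrableD iF (integrable_mono m).
- move=> n w; rewrite normcMC ?wt_ge0// ComplexField.Normc.normcM normc_conj -mulrDl.
  by rewrite ler_pM ?wt_ge0 ?wt_le ?le_mul_sq// mulr_ge0 ?normc_ge0.
Qed.

Lemma cint_mono m :
  cint mu (fun w => mono m w * conjc (mono m w) * (gauss w)%:C) =
  (\prod_(i < d) (m i)`!)%:R.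
Proof.
have E w : mono m w * conjc (mono m w) * (gauss w)%:C =
    (normc (mono m w) ^+ 2 * gauss w)%:C.
  by rewrite normcE2; case: (mono m w) => a b /=; simpc; congr (_ +i* _); ring.
under eq_fun do rewrite E.
rewrite /cint /= /Rintegral integral_mono integral0 /=.
by rewrite -[RHS](rmorph_nat (real_complex R)).
Qed.

(** Both sides are limits of [pairing_series] as the radius grows. Membership in the Fock space
    supplies the integrable majorant |v|^2 + |z^m|^2 times the density. *)
Lemma cint_ev_mono v m : hdom (fock_space R d) v ->
  cint mu (fun w => ev v w * conjc (mono m w) * (gauss w)%:C) =
  v m * (\prod_(i < d) (m i)`!)%:R.
Proof.
move=> Fv; apply: (ccvg_unique (pairing_cvg m (cmeas_ev Fv.1) (integrable_fock Fv))).
under [X in ccvg X]eq_fun do rewrite (pairing_series _ _ Fv.1)//.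
apply: ccvgZ; rewrite -cint_mono; apply: pairing_cvg; first exact: cmeas_mono.
exact: integrable_mono.
Qed.

End Fock_pairing.

(** * Fock inner products with polynomials *)

Section Fock_poly.
Variables (R : realType) (d : nat).
Local Notation mi := (multiindex d).
Local Notation P := (polynomials R d).
Local Notation cf := (@series_of_poly R d).
Local Notation F2 := (fock_space R d).
Local Notation mu := (lebesgue_cspace R d).
Local Notation gauss := (@gauss_density R d).
Implicit Types (v x y : power_series R d) (p q : P).

Lemma eval_series_poly p z :
  eval_series (cf p) z = \sum_(m <- mpoly.msupp p) mpoly.mcoeff m p * monomial z m.
Proof.
apply: multisum_ccvg; apply: ccvg_near; exists (mpoly.msize p) => // n /= pn.
set I : subFinType _ := mpoly.bmultinom d n.
rewrite [RHS](ssrcomplements.big_mksub I) ?mpoly.msupp_uniq //=; first last.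
  by move=> m /mpoly.msize_mdeg_lt /leq_trans; apply.
rewrite big_rmcond //= => j /mpoly.memN_msupp_eq0 ->.
by rewrite mul0r.
Qed.

Lemma fock_innerE x y : fock_inner x y =
  cint mu (fun w => ev x w * conjc (ev y w) * (gauss w)%:C).
Proof.
rewrite /fock_inner /cint; congr (_ +i* _); congr Rintegral; apply/funext => w.
  by rewrite Re_mul /= mulr0 subr0.
by rewrite Im_mul /= mulr0 add0r.
Qed.

Lemma cintegrable_ev_mono v m : hdom F2 v ->
  cintegrable mu (fun w => ev v w * conjc (mono m w) * (gauss w)%:C).
Proof.
move=> Fv; have mg := cmeas_real (@measurable_gauss_density R d).
apply: (@cintegrable_le _ _ _ _ _
  (fun w => normc (ev v w) ^+ 2 * gauss w + normc (mono m w) ^+ 2 * gauss w)).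
- apply: cmeas_mul mg; apply: cmeas_mul; first exact: cmeas_ev Fv.1.
  by apply: cmeas_conj; exact: cmeas_mono.
- exact: (integrableD measurableT (integrable_fock Fv) (integrable_mono R m)).
- move=> w; rewrite normcMC ?gauss_density_ge0// ComplexField.Normc.normcM normc_conj.
  by rewrite -mulrDl ler_wpM2r ?gauss_density_ge0 ?le_mul_sq.
Qed.

Lemma fock_inner_poly v p : hdom F2 v -> fock_inner v (cf p) =
  \sum_(m <- mpoly.msupp p)
     v m * conjc (mpoly.mcoeff m p) * (\prod_(i < d) (m i)`!)%:R.
Proof.
move=> Fv; rewrite fock_innerE.
have E m : v m * conjc (mpoly.mcoeff m p) * (\prod_(i < d) (m i)`!)%:R =
    cint mu (fun w => conjc (mpoly.mcoeff m p) *
      (ev v w * conjc (mono m w) * (gauss w)%:C)).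
  by rewrite cintZ ?cint_ev_mono//; [ring|exact: cintegrable_ev_mono].
under [RHS]eq_bigr do rewrite E.
rewrite -cint_sum; last by move=> m; exact/cintegrableZ/cintegrable_ev_mono.
congr cint; apply/funext => w; rewrite /ev [in X in conjc X]eval_series_poly.
rewrite rmorph_sum mulr_sumr mulr_suml; apply: eq_bigr => m _.
by rewrite rmorphM /mono /=; ring.
Qed.

Lemma fock_inner_poly_l v p : hdom F2 v ->
  fock_inner (cf p) v = conjc (fock_inner v (cf p)).
Proof.
move=> Fv; rewrite !fock_innerE -cint_conj.
  by congr cint; apply/funext => w; rewrite conjc_mul3.
have -> : (fun w => ev v w * conjc (ev (cf p) w) * (gauss w)%:C) =
  (fun w => \sum_(m <- mpoly.msupp p) conjc (mpoly.mcoeff m p) *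
      (ev v w * conjc (mono m w) * (gauss w)%:C)).
  apply/funext => w; rewrite /ev [in X in conjc X]eval_series_poly.
  rewrite rmorph_sum mulr_sumr mulr_suml; apply: eq_bigr => m _.
  by rewrite rmorphM /mono /=; ring.
by apply: cintegrable_sum => m; exact/cintegrableZ/cintegrable_ev_mono.
Qed.

Lemma hdom_fock_poly p : hdom F2 (cf p).
Proof.
split; first exact: entire_poly.
have H (s : seq mi) : mu.-integrable setT (EFin \o (fun w =>
    normc (\sum_(m <- s) mpoly.mcoeff m p * mono m w) ^+ 2 * gauss w)).
  have ms s' : cmeas (fun w => \sum_(m <- s') mpoly.mcoeff m p * mono m w).
    by apply: cmeas_sum => m; apply: cmeas_mul; [exact: cmeas_cst|exact: cmeas_mono].
  have mi s' : measurable_fun setT (EFin \o (fun w =>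
      normc (\sum_(m <- s') mpoly.mcoeff m p * mono m w) ^+ 2 * gauss w)).
    apply/measurable_EFinP; apply: measurable_funM; last exact: measurable_gauss_density.
    exact: measurable_normc_sq (ms s').
  elim: s => [|m s IH].
    apply: le_integrable (@integrable_gauss R d) => //.
    move=> w _ /=; rewrite big_nil ComplexField.Normc.normc0 expr0n mul0r normr0.
    by rewrite lee_fin.
  (* Monomials are added one at a time, by |a + b|^2 <= 2 |a|^2 + 2 |b|^2. *)
  apply: (@le_integrable _ _ _ mu setT measurableT _ (EFin \o (fun w =>
     (2 * normc (mpoly.mcoeff m p) ^+ 2) * (normc (mono m w) ^+ 2 * gauss w) +
     2 * (normc (\sum_(m <- s) mpoly.mcoeff m p * mono m w) ^+ 2 * gauss w)))) => //.
    move=> w _ /=; rewrite lee_fin ger0_norm; last first.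
      by rewrite mulr_ge0 ?gauss_density_ge0 ?sqr_ge0.
    apply: le_trans (ler_norm _).
    rewrite big_cons (mulrA (2 * _)) (mulrA 2 (_ ^+ 2) (gauss w)) -mulrDl ler_wpM2r ?gauss_density_ge0//.
    have := normcB_sq (mpoly.mcoeff m p * mono m w)
      (- \sum_(m <- s) mpoly.mcoeff m p * mono m w).
    rewrite opprK normcN ComplexField.Normc.normcM exprMn mulrA.
    by apply.
  have -> : EFin \o (fun w =>
     (2 * normc (mpoly.mcoeff m p) ^+ 2) * (normc (mono m w) ^+ 2 * gauss w) +
     2 * (normc (\sum_(m <- s) mpoly.mcoeff m p * mono m w) ^+ 2 * gauss w)) =
    ((fun w => (2 * normc (mpoly.mcoeff m p) ^+ 2)%:E * (normc (mono m w) ^+ 2 * gauss w)%:E) \+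
     (fun w => 2%:E * (normc (\sum_(m <- s) mpoly.mcoeff m p * mono m w) ^+ 2 * gauss w)%:E))%E.
    by apply/funext.
  apply: integrableD => //; apply: integrableZl => //.
  exact: integrable_mono.
have /integrableP[_] := H (mpoly.msupp p).
apply: le_lt_trans; apply: ge0_le_integral => //.
- by move=> w _; rewrite lee_fin mulr_ge0 ?gauss_density_ge0 ?sqr_ge0.
- apply/measurable_EFinP; apply: measurable_funM; last exact: measurable_gauss_density.
  exact: measurable_normc_sq (cmeas_ev (entire_poly p)).
- have /integrableP[mm _] := H (mpoly.msupp p).
  exact: measurableT_comp.
- by move=> w _; rewrite eval_series_poly /= lee_fin ler_norm.
Qed.


End Fock_poly.

(** * Eigenspaces of L *)

Section Eigenspaces.
Variables (R : realType) (d : nat) (I : {pred polynomials R d}).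
Local Notation mi := (multiindex d).
Local Notation P := (polynomials R d).
Local Notation cf := (@series_of_poly R d).
Local Notation F2 := (fock_space R d).
Local Notation DA := (drury_arveson R d).
Local Notation "''X_[' m ]" := (mpoly.mpolyX R[i] m).
Local Notation J := [set p | p \in I].
Local Notation L := (L_op (Q_space I) (S_tuple I) (e_vector I)).
Local Notation iota := (iota_op (Q_space I) (S_tuple I) (e_vector I)).
Hypothesis (idJ : is_ideal J) (grJ : graded J).
Local Notation Q := (projQ idJ grJ).
Local Notation Qseries := (Qseries idJ grJ).
Implicit Types (v x y : power_series R d) (p q : P) (m a : mi).

Lemma fock_inner_polyE n v p : hdom F2 v -> (mpoly.msize p <= n)%N ->
  fock_inner v (cf p) = psum n (fun m =>
     v m * conjc (mpoly.mcoeff m p) * (\prod_(i < d) (m i)`!)%:R).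
Proof.
move=> Fv pn; rewrite fock_inner_poly//.
set T : subFinType _ := mpoly.bmultinom d n.
rewrite (ssrcomplements.big_mksub T) ?mpoly.msupp_uniq //=; first last.
  by move=> m /mpoly.msize_mdeg_lt /leq_trans; apply.
rewrite big_rmcond //= => j /mpoly.memN_msupp_eq0 ->.
by rewrite conjc0 mulr0 mul0r.
Qed.

(** The quotient |m|! of the weights of the two spaces is the source of the eigenvalues 1 / n!. *)
Lemma da_weight_fact m : (da_weight R m)%:C * (mpoly.mdeg m)`!%:R =
  (\prod_(i < d) (m i)`!)%:R.
Proof.
rewrite /da_weight -(rmorph_nat (real_complex R)) -rmorphM /= divfK ?rmorph_nat//.
Qed.

Lemma ip_mpolyX v m : ip v 'X_[m] = v m * (da_weight R m)%:C.
Proof. by rewrite /ip mpoly.msuppX big_seq1 mpoly.mcoeffX eqxx conjc1 mulr1. Qed.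

Lemma tpoly_poly n p : tpoly n (cf p) = trunc n p.
Proof. by apply/mpoly.mpolyP => m; rewrite mcoeff_tpoly mcoeff_trunc. Qed.

Lemma Qseries_poly p : Qseries (cf p) = cf (Q p).
Proof.
apply/funext => m; rewrite -(Qseries_coef _ _ _ (leqnn _)) tpoly_poly projQ_trunc.
by rewrite mcoeff_trunc ltnSn.
Qed.

Lemma mcoeff_projQX a m : mpoly.mdeg m != mpoly.mdeg a ->
  mpoly.mcoeff m (Q 'X_[a]) = 0.
Proof.
have [H +] : trunc (mpoly.mdeg a) (Q 'X_[a]) = 0 /\ trunc (mpoly.mdeg a).+1 (Q 'X_[a]) = Q 'X_[a].
  rewrite -!projQ_trunc [trunc _.+1 _]trunc_id ?mpoly.msizeX//; split=> //.
  rewrite (_ : trunc _ _ = 0) ?linear0//; apply/mpoly.mpolyP => k.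
  rewrite mcoeff_trunc mpoly.mcoeffX mpoly.mcoeff0; case: ltnP => // ka.
  by case: eqP => // E; rewrite E ltnn in ka.
move=> H2; rewrite neq_ltn => /orP[ma|am].
  by have := congr1 (mpoly.mcoeff m) H; rewrite mcoeff_trunc ma mpoly.mcoeff0.
by rewrite -H2 mcoeff_trunc ltnS leqNgt am.
Qed.

Definition adjoint_at x : set (power_series R d) := [set y | hdom F2 y /\
  forall v, hdom F2 v -> hinner (Q_space I) (iota v) (iota x) = hinner F2 v y].

Lemma ip_Qseries_projQX x a :
  ip (Qseries x) (Q 'X_[a]) = Qseries x a * (da_weight R a)%:C.
Proof.
have sa : (mpoly.msize (Q 'X_[a]) <= (mpoly.mdeg a).+1)%N.
  by rewrite (leq_trans (msize_projQ _ _ _))// mpoly.msizeX.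
by rewrite (ip_Qseries _ _ _ sa) ip_projQ -ip_projQ_sym ip_mpolyX.
Qed.

(** Testing against the monomial of exponent a alone determines y at a; so in degree n an adjoint
    vector is the projection of x divided by n!. *)
Lemma adjoint_at_coef x y a : hdom F2 x -> adjoint_at x y ->
  Qseries x a = (mpoly.mdeg a)`!%:R * y a.
Proof.
move=> Fx [Fy Hy]; have := Hy _ (hdom_fock_poly 'X_[a]).
have fa0 : ((mpoly.mdeg a)`!%:R : R[i]) != 0 by rewrite pnatr_eq0 -lt0n fact_gt0.
have wa0 : (da_weight R a)%:C != 0.
  by apply/negP => /eqP [w0]; have := da_weight_gt0 R a; rewrite w0 ltxx.
rewrite !(iota_Qseries idJ grJ) ?Qseries_poly; [|exact: Fx.1|exact: entire_poly].
rewrite -[hinner (Q_space I) _ _]/(hinner DA _ _) hinner_poly_l.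
rewrite -[hinner F2 _ _]/(fock_inner _ _) fock_inner_poly_l// => /(can_inj (@conjcK R)).
rewrite ip_Qseries_projQX fock_inner_poly// mpoly.msuppX big_seq1 mpoly.mcoeffX eqxx.
rewrite conjc1 mulr1 -da_weight_fact mulrCA [RHS]mulrC => /(mulIf wa0) ->.
exact: mulrC.
Qed.

Lemma adjoint_at_unique x y y' : hdom F2 x -> adjoint_at x y -> adjoint_at x y' ->
  y = y'.
Proof.
move=> Fx /(adjoint_at_coef _ Fx) Hy /(adjoint_at_coef _ Fx) Hy'.
apply/funext => a; have := Hy a; rewrite (Hy' a) => /esym; apply: mulfI.
by rewrite pnatr_eq0 -lt0n fact_gt0.
Qed.

Variable lambda : R[i].
Hypothesis lambda0 : lambda != 0.
Definition eigendegree k := (k`!%:R * lambda == 1).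

(** L x takes the default value 0 when no adjoint vector exists, and L x = lambda x with nonzero
    lambda and x excludes this case. *)
Lemma eigenspace_adjoint x : x != 0 -> eigenspace_of F2 L lambda x ->
  hdom F2 x /\ adjoint_at x (lambda *: x).
Proof.
move=> x0 [Fx Lx]; split=> //; rewrite -Lx.
have [H|H] := pselect (exists y, adjoint_at x y); first exact: xgetPex H.
have : L x = 0 by apply: xgetPN => y Hy; apply: H; exists y.
by move/eqP; rewrite Lx scaler_eq0 (negPf lambda0) (negPf x0).
Qed.

Lemma projQ_component x k : (forall a, Qseries x a = (mpoly.mdeg a)`!%:R * (lambda * x a)) ->
  Q (tpoly k.+1 x - tpoly k x) = (k`!%:R * lambda) *: (tpoly k.+1 x - tpoly k x).
Proof.
move=> H; rewrite linearB /= -!tpoly_Qseries; apply/mpoly.mpolyP => m.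
rewrite mpoly.mcoeffZ !mpoly.mcoeffB !mcoeff_tpoly ltnS.
case: (ltngtP (mpoly.mdeg m) k) => [mk|mk|mk]; rewrite ?subrr ?mulr0//.
by rewrite !subr0 H mk mulrA.
Qed.

(** K bounds the degrees n with n! = 1 / lambda, so the eigenvectors are polynomials: the vectors
    fixed by [Q] and supported in these degrees. *)
Lemma eigenspaceP K x : (forall k, eigendegree k -> (k < K)%N) ->
  eigenspace_of F2 L lambda x <-> exists p, [/\ x = cf p, Q p = p,
    (mpoly.msize p <= K)%N &
    forall m, mpoly.mcoeff m p != 0 -> eigendegree (mpoly.mdeg m)].
Proof.
move=> HK; split=> [Ex|[p [-> Qp _ Hp]]].
  have [->|x0] := eqVneq x 0.
    exists 0; rewrite linear0 mpoly.msize0; split=> //.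
      by apply/funext => m; rewrite /series_of_poly mpoly.mcoeff0.
    by move=> m; rewrite mpoly.mcoeff0 eqxx.
  have [Fx Ax] := eigenspace_adjoint x0 Ex.
  have H a : Qseries x a = (mpoly.mdeg a)`!%:R * (lambda * x a).
    exact: adjoint_at_coef Fx Ax.
  have supp a : x a != 0 -> eigendegree (mpoly.mdeg a).
    move=> xa; set k := mpoly.mdeg a; set c := k`!%:R * lambda.
    (* On the component of degree k, the idempotent [Q] acts as the nonzero scalar c = k! lambda; so
       c = 1 if the component is not zero. *)
    have Qh := projQ_component k H; rewrite -/c in Qh.
    have := projQK idJ grJ (tpoly k.+1 x - tpoly k x).
    rewrite Qh linearZ /= Qh => /(congr1 (mpoly.mcoeff a)).
    rewrite !mpoly.mcoeffZ mpoly.mcoeffB !mcoeff_tpoly ltnSn ltnn subr0.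
    have c0 : c != 0 by rewrite mulf_neq0// pnatr_eq0 -lt0n fact_gt0.
    by move=> /(mulfI c0); rewrite -[RHS]mul1r => /(mulIf xa)/eqP.
  have xE : x = cf (tpoly K x).
    apply/funext => a; rewrite /series_of_poly mcoeff_tpoly.
    have [//|Ka] := ltnP (mpoly.mdeg a) K.
    by apply: contraTeq Ka => /supp /HK; rewrite ltnNge.
  exists (tpoly K x); split=> //; last 1 first.
  - by move=> m; rewrite mcoeff_tpoly; case: ifP => [_ /supp//|]; rewrite eqxx.
  - rewrite -tpoly_Qseries; apply/mpoly.mpolyP => m; rewrite !mcoeff_tpoly.
    case: ifP => // _; rewrite H mulrA.
    have [->|/supp /eqP ->] := eqVneq (x m) 0; first by rewrite mulr0.
    by rewrite mul1r.
  - exact: msize_tpoly.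
have Fp := hdom_fock_poly p.
suff Ap : adjoint_at (cf p) (lambda *: cf p).
  split=> //; apply: xget_unique => // y Ay; exact: adjoint_at_unique Fp Ay Ap.
rewrite -cfZ; split; first exact: hdom_fock_poly.
move=> v Fv; rewrite !(iota_Qseries idJ grJ); [|exact: Fp.1|exact: Fv.1].
rewrite Qseries_poly Qp -[hinner (Q_space I) _ _]/(hinner DA _ _) hinner_poly.
rewrite -[hinner F2 _ _]/(fock_inner _ _) (ip_Qseries _ _ _ (leqnn _)).
rewrite ip_projQ_sym Qp ip_tpoly_id// (ipE _ (leqnn _)).
rewrite (fock_inner_polyE Fv (mpoly.msizeZ_le p lambda)).
apply: eq_bigr => a _; rewrite mpoly.mcoeffZ -da_weight_fact.
move: (mpoly.bmnm a) => m.
have [->|/Hp /eqP Hm] := eqVneq (mpoly.mcoeff m p) 0.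
  by rewrite mulr0 conjc0 mulr0 !mul0r.
have Hc : conjc lambda * (mpoly.mdeg m)`!%:R = 1.
  by have := congr1 (@conjc R) Hm; rewrite rmorphM rmorph_nat rmorph1 mulrC.
rewrite rmorphM -[LHS]mulr1 -[X in _ * X = _]Hc; ring.
Qed.

Local Notation stdT n :=
  {m : mpoly.bmultinom d n | standard J (mpoly.bmnm m)}.
Local Notation mon t := (mpoly.bmnm (val t)).

Lemma series_of_poly_inj : injective cf.
Proof.
move=> p q pq; apply/mpoly.mpolyP => m.
exact: (congr1 (fun f : power_series R d => f m) pq).
Qed.

(** The basis consists of the projections of the standard monomials of the relevant degrees. A
    relation between them puts a combination of standard monomials into J, so it is trivial; they
    span because standard monomials span modulo J. *)
Lemma has_dim_eigenspace K : (forall k, eigendegree k -> (k < K)%N) ->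
  has_dim (eigenspace_of F2 L lambda)
    #|[pred t : stdT K | eigendegree (mpoly.mdeg (mon t))]|.
Proof.
move=> HK; set A := [pred t | _].
exists (fun i => cf (Q 'X_[mon (enum_val i : stdT K)])); split.
- move=> i; apply/(eigenspaceP _ HK); exists (Q 'X_[mon (enum_val i)]).
  split=> //; first exact: projQK.
    by rewrite (leq_trans (msize_projQ _ _ _))// mpoly.msizeX mpoly.bmdeg.
  move=> m; have := enum_valP i; rewrite inE.
  have [-> //|/mcoeff_projQX ->] := eqVneq (mpoly.mdeg m) (mpoly.mdeg (mon (enum_val i))).
  by rewrite eqxx.
- move=> c c0; pose p : P := \sum_(i < #|A|) c i *: 'X_[mon (enum_val i)].
  have coef i : mpoly.mcoeff (mon (enum_val i)) p = c i.
    rewrite raddf_sum /= (bigD1 i)//= mpoly.mcoeffZ mpoly.mcoeffX eqxx mulr1.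
    rewrite big1 ?addr0// => j ji; rewrite mpoly.mcoeffZ mpoly.mcoeffX.
    case: eqP => [/bmnm_inj/val_inj/enum_val_inj E|]; last by rewrite mulr0.
    by rewrite E eqxx in ji.
  suff p0 : p = 0 by move=> i; rewrite -coef p0 mpoly.mcoeff0.
  have Qp : Q p = 0.
    apply: series_of_poly_inj; rewrite /p linear_sum cf_sum.
    transitivity (0 : power_series R d); last first.
      by apply/funext => m; rewrite /series_of_poly mpoly.mcoeff0.
    by rewrite -[RHS]c0; apply: eq_bigr => i _; rewrite linearZ cfZ.
  apply: (@standard_indep _ _ J).
    by have := projQ_sub idJ grJ p; rewrite Qp subr0.
  move=> m; rewrite mpoly.mcoeff_msupp raddf_sum /= => H.
  have [i +] : exists i, mpoly.mcoeff m (c i *: 'X_[mon (enum_val i)]) != 0.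
    apply/existsP; apply: contraNT H => /existsPn H.
    by rewrite big1// => i _; apply/eqP; have := H i; rewrite negbK.
  rewrite mpoly.mcoeffZ mpoly.mcoeffX; case: (_ =P m) => [<- _|_]; last by rewrite mulr0 eqxx.
  exact: (valP (enum_val i)).
- move=> x /(eigenspaceP _ HK)[p [-> Qp pK Hp]].
  have [c Jc] := standard_span idJ pK.
  have pE := projQ_congr idJ grJ Jc; rewrite Qp linear_sum /= in pE.
  exists (fun i => c (enum_val i)).
  have -> : \sum_(i < #|A|) c (enum_val i) *: cf (Q 'X_[mon (enum_val i)]) =
      cf (\sum_(t in A) c t *: Q 'X_[mon t]).
    rewrite cf_sum.
    have := @big_enum_val _ 0 +%R _ A (fun t => cf (c t *: Q 'X_[mon t])).
    by move=> E; apply: etrans (esym E);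
      apply: eq_bigr => i _; rewrite cfZ.
  congr cf; apply/mpoly.mpolyP => m.
  have [mg|mg] := boolP (eigendegree (mpoly.mdeg m)).
    rewrite [in LHS]pE (bigID [in A])/= mpoly.mcoeffD [X in _ + X]raddf_sum /=.
    rewrite [X in _ + X]big1 ?addr0.
      by congr mpoly.mcoeff; apply: eq_bigr => t _; rewrite linearZ.
    move=> t; rewrite inE => nt; rewrite linearZ mpoly.mcoeffZ mcoeff_projQX ?mulr0//.
    by apply: contraNneq nt => <-.
  rewrite raddf_sum /= big1; first by apply/eqP; apply: contraNT mg => /Hp.
  move=> t; rewrite inE => ht; rewrite mpoly.mcoeffZ mcoeff_projQX ?mulr0//.
  by apply: contraNneq mg => ->.
Qed.

End Eigenspaces.

(** * The singular values *)

Section Listings.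
Variables (R : realType) (V : lmodType R[i]) (H : hilbert_space V).
Implicit Types (E : set V) (mu : nat -> R).

Lemma has_dim_le E n m : has_dim E n -> has_dim E m -> (n <= m)%N.
Proof.
move=> [b [Eb indb _]] [c [_ _ spanc]].
have /choice[C HC] i := spanc _ (Eb i).
pose M : 'M[R[i]]_(n, m) := \matrix_(i, j) C i j.
suff : row_free M by rewrite /row_free => /eqP <-; exact: rank_leq_col.
apply: inj_row_free => v vM; apply/rowP => i; rewrite mxE.
apply: (indb (fun i => v 0 i)).
under eq_bigr do rewrite HC scaler_sumr.
rewrite exchange_big /= big1// => j _.
under eq_bigr do rewrite scalerA.
rewrite -scaler_suml.
have := congr1 (fun A : 'rV[R[i]]_m => A 0 j) vM; rewrite !mxE => E0.
rewrite (_ : \sum_(i < n) _ = 0) ?scale0r// -[RHS]E0.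
by apply: eq_bigr => k _; rewrite mxE.
Qed.

Lemma has_dim_unique E n m : has_dim E n -> has_dim E m -> n = m.
Proof. by move=> En Em; apply/eqP; rewrite eqn_leq !(has_dim_le _ _ (E := E)). Qed.

Lemma finite_subset_card_eq (A B : set nat) n : (A #= `I_n)%card ->
  (B #= `I_n)%card -> A `<=` B -> A = B.
Proof.
move=> An Bn AB.
have fA : finite_set A by exists n.
have fB : finite_set B by exists n.
suff E : fset_set A = fset_set B by rewrite -(fset_setK fA) E fset_setK.
apply/eqP; rewrite finmap.eqEfcard (card_fset_set An) (card_fset_set Bn) leqnn andbT.
by rewrite -fset_set_sub.
Qed.

Lemma listing_noninc L mu j k : eigenvalue_listing H L mu -> (j <= k)%N ->
  mu k <= mu j.
Proof.
move=> [_ dmu _]; elim: k => [|k IH]; first by rewrite leqn0 => /eqP ->.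
rewrite leq_eqVlt => /orP[/eqP -> //|/IH]; exact: le_trans.
Qed.

(** At a first index k with mu' k > mu k, every index where mu takes the value mu' k precedes k, so
    mu' takes that value there as well, and also at k; but the two index sets have the same finite
    cardinality. *)
Lemma listing_le L mu mu' k : eigenvalue_listing H L mu ->
  eigenvalue_listing H L mu' -> (forall j, (j < k)%N -> mu j = mu' j) ->
  mu' k <= mu k.
Proof.
move=> lmu lmu' E; rewrite leNgt; apply/negP => kk.
have a0 : (mu' k)%:C != 0.
  apply/eqP => -[a0]; move: kk; rewrite a0 ltNge.
  by case: lmu => -> .
have [_ _ /(_ _ a0)[n En An]] := lmu.
have [_ _ /(_ _ a0)[n' En' An']] := lmu'.
have nn := has_dim_unique En' En; rewrite {}nn in An'.
have := finite_subset_card_eq An An'; apply: contraPP => _.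
move=> /(_ _)/seteqP[]; last first.
  move=> _ /(_ k erefl) /= [E0]; by move: kk; rewrite E0 ltxx.
move=> j /= [Ej]; rewrite -E//.
  by rewrite Ej.
rewrite ltnNge; apply/negP => kj; have := listing_noninc lmu kj.
by rewrite Ej leNgt kk.
Qed.

Lemma listing_unique L mu mu' : eigenvalue_listing H L mu ->
  eigenvalue_listing H L mu' -> mu = mu'.
Proof.
move=> lmu lmu'; apply/funext => k; elim/ltn_ind: k => k IH.
apply/eqP; rewrite eq_le (listing_le lmu' lmu) ?(listing_le lmu lmu')//.
by move=> j /IH.
Qed.

Lemma singular_valuesE L mu : eigenvalue_listing H L mu ->
  singular_values H L = mu.
Proof.
by move=> lmu; apply: xget_unique => // mu' lmu'; exact: listing_unique lmu' lmu.
Qed.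

End Listings.

(** * The eigenvalues 1 / n! with their multiplicities *)

Section Spectrum.
Variables (R : realType) (d : nat) (I : {pred polynomials R d}).
Local Notation J := [set p | p \in I].
Local Notation h := (hilb J).
Hypothesis (idJ : is_ideal J) (grJ : graded J).

Lemma lt_fact n m : (0 < n)%N -> (n < m)%N -> (n`! < m`!)%N.
Proof.
move=> n0; case: m => // m; rewrite ltnS => nm.
rewrite factS mulSn (leq_ltn_trans (leq_fact nm))// -[ltnLHS]addn0 ltn_add2l.
by rewrite muln_gt0 fact_gt0 (leq_trans n0).
Qed.

Lemma fact_inj n m : (0 < n)%N -> (0 < m)%N -> n`! = m`! -> n = m.
Proof.
move=> n0 m0 nm; have [nm'|mn|] := ltngtP n m => //.
  by have := lt_fact n0 nm'; rewrite nm ltnn.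
by have := lt_fact m0 mn; rewrite nm ltnn.
Qed.

(* 0! = 1!, so the degrees with the same factorial as n > 0 are the k such that
   [lowdeg n <= k <= n]. *)
Definition lowdeg n : nat := if (n <= 1)%N then 0 else n.

Lemma lowdegP n k : (0 < n)%N -> (k`! == n`!) = (lowdeg n <= k <= n)%N.
Proof.
move=> n0; apply/eqP/andP => [kn|[]]; rewrite /lowdeg.
  case: k kn => [|k] kn; last first.
    by rewrite (fact_inj (ltn0Sn k) n0 kn); split=> //; case: (n <= 1)%N.
  by rewrite -(@fact_inj 1 n (ltn0Sn 0) n0 kn).
case: (leqP n 1) => n1; last by move=> nk kn; have -> : k = n by lia.
have -> : n = 1%N by lia.
by case: k => [|[|]].
Qed.

Definition reached k := exists n, (0 < n)%N && (k < h n.+1)%N.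

(* The k-th standard monomial, in the order of increasing degrees, contributes
   the eigenvalue 1 / n!, n being its degree; [ex_minn] returns 1 instead of 0. *)
Definition spectrum k : R :=
  if pselect (reached k) is left kn then ((ex_minn kn)`!%:R)^-1 else 0.

Lemma spectrumP k :
  (spectrum k = 0 /\ forall n, (h n <= k)%N) \/
  exists n, [/\ (0 < n)%N, spectrum k = (n`!%:R)^-1, (h (lowdeg n) <= k)%N
              & (k < h n.+1)%N].
Proof.
rewrite /spectrum; case: pselect => [kn|nk].
  case: ex_minnP => n /andP[n0 kn'] nmin; right; exists n; split=> //.
  (* Minimality of n gives [h n <= k], except for n = 1, whose block contains degree 0 and starts at
     index 0. *)
  rewrite /lowdeg; case: (leqP n 1) => [_|n1]; first by rewrite hilb0.
  rewrite leqNgt; apply/negP => kn1.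
  have := nmin n.-1; rewrite (ltn_predK n1) kn1 -subn1 subn_gt0 n1 => /(_ isT).
  lia.
left; split=> // n; rewrite leqNgt; apply/negP => kn; apply: nk; exists n.+1.
by rewrite /= (leq_trans kn)// hilb_mono// -addn2 leq_addr.
Qed.

Lemma invfact_inj n m : (0 < n)%N -> (0 < m)%N ->
  (n`!%:R)^-1 = (m`!%:R)^-1 :> R -> n = m.
Proof.
move=> n0 m0 /invr_inj/eqP; rewrite eqr_nat => /eqP; exact: fact_inj.
Qed.

Lemma spectrum_eq k n : (0 < n)%N ->
  spectrum k = (n`!%:R)^-1 <-> (h (lowdeg n) <= k)%N /\ (k < h n.+1)%N.
Proof.
move=> n0; have [[-> hk]|[m [m0 -> mk km]]] := spectrumP k; split.
- by move/esym/eqP; rewrite invr_eq0 pnatr_eq0 -leqn0 leqNgt fact_gt0.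
- by move=> [_]; rewrite ltnNge hk.
- by move=> /(invfact_inj m0 n0) <-.
move=> [nk kn]; congr (_`!%:R)^-1; apply/eqP; rewrite eqn_leq.
apply/andP; split; rewrite leqNgt; apply/negP => lt.
  have : (h n.+1 <= k)%N; last by rewrite leqNgt kn.
  apply: leq_trans mk; apply: hilb_mono; rewrite /lowdeg; case: ifP; lia.
have : (h m.+1 <= k)%N; last by rewrite leqNgt km.
apply: leq_trans nk; apply: hilb_mono; rewrite /lowdeg; case: ifP; lia.
Qed.

Local Notation stdT n :=
  {m : mpoly.bmultinom d n | standard J (mpoly.bmnm m)}.
Local Notation mon t := (mpoly.bmnm (val t)).

Lemma card_standard_lt n k : (k <= n)%N ->
  #|[pred t : stdT n | (mpoly.mdeg (mon t) < k)%N]| = h k.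
Proof.
move=> kn.
have lt (t : stdT k) : (mpoly.mdeg (mon t) < n)%N.
  by rewrite (leq_trans (mpoly.bmdeg _)).
pose f (t : stdT k) : stdT n := exist _ (mpoly.BMultinom (lt t)) (valP t).
have injf : injective f.
  by move=> t s /(congr1 (fun u : stdT n => mon u)) /= /bmnm_inj /val_inj.
rewrite -[RHS](card_codom injf); apply: eq_card => t; rewrite !inE.
apply/idP/codomP => [tk|[s ->]]; last exact: (mpoly.bmdeg (val s)).
exists (exist _ (mpoly.BMultinom tk) (valP t) : stdT k).
by apply/val_inj/bmnm_inj.
Qed.

(** The indices with the value 1 / n! form the block from [h (lowdeg n)] to [h n.+1]; its length
    counts the standard monomials of the degrees k with k! = n!, as the dimension of the eigenspace
    does. *)
Lemma spectrum_listing : eigenvalue_listing (fock_space R d)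
  (L_op (Q_space I) (S_tuple I) (e_vector I)) spectrum.
Proof.
split.
- move=> k; have [[-> //]|[n [_ -> _ _]]] := spectrumP k.
  by rewrite invr_ge0.
- move=> k; have [[-> hk]|[m [m0 -> mk km]]] := spectrumP k.
    have [[-> //]|[n [_ _ _]]] := spectrumP k.+1.
    by rewrite ltnNge (leq_trans (hk _)).
  have [[-> _]|[n [n0 -> nk kn]]] := spectrumP k.+1; first by rewrite invr_ge0.
  rewrite lef_pV2 ?posrE ?ltr0n ?fact_gt0// ler_nat leq_fact// leqNgt.
  apply/negP => nm; have : (h n.+1 <= k)%N; last by rewrite leqNgt (ltnW kn).
  apply: leq_trans mk; apply: hilb_mono; rewrite /lowdeg; case: ifP; lia.
move=> lambda l0.
have [[n /andP[n0 /eqP nl]]|nl] :=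
    pselect (exists n, (0 < n)%N && (n`!%:R * lambda == 1)).
  have lE : lambda = ((n`!%:R)^-1)%:C.
    rewrite fmorphV rmorph_nat; apply: (mulfI (x := n`!%:R)).
      by rewrite pnatr_eq0 -lt0n fact_gt0.
    by rewrite nl divff// pnatr_eq0 -lt0n fact_gt0.
  have eigE k : eigendegree lambda k = (lowdeg n <= k <= n)%N.
    rewrite -lowdegP// -(eqr_nat R[i]) /eigendegree -[X in _ == X]nl (inj_eq (mulIf l0)). reflexivity.
  exists (h n.+1 - h (lowdeg n))%N.
    have -> : (h n.+1 - h (lowdeg n))%N =
        #|[pred t : stdT n.+1 | eigendegree lambda (mpoly.mdeg (mon t))]|.
      have ln : (lowdeg n <= n.+1)%N by rewrite /lowdeg; case: ifP.
      rewrite -(card_standard_lt ln) /hilb.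
      rewrite -[X in (X - _)%N](cardC [pred t : stdT n.+1 | (mpoly.mdeg (mon t) < lowdeg n)%N]).
      rewrite addKn; apply: eq_card => t; rewrite !inE eigE -leqNgt.
      by have := mpoly.bmdeg (val t); rewrite ltnS => ->; rewrite andbT.
    apply: (has_dim_eigenspace idJ grJ l0) => k; rewrite eigE => /andP[_].
    by rewrite ltnS.
  rewrite (_ : [set k | _] = `I_(h n.+1) `\` `I_(h (lowdeg n))); first exact: card_IID.
  apply/seteqP; split => k /=; rewrite lE.
    by move=> [/(spectrum_eq _ n0)[nk kn]]; split => //; apply/negP; rewrite -leqNgt.
  move=> [kn /negP]; rewrite -leqNgt => nk; congr (_%:C).
  exact/(spectrum_eq _ n0).
have noeig k : ~ eigendegree lambda k.
  (* Degree 0 yields the same eigenvalue as degree 1. *)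
  move=> ek; apply: nl; case: k ek => [|k] ek; last by exists k.+1.
  by exists 1%N.
exists 0%N.
  have -> : 0%N = #|[pred t : stdT 0 | eigendegree lambda (mpoly.mdeg (mon t))]|.
    by apply/esym/eq_card0 => t; rewrite !inE; apply/negP/noeig.
  by apply: (has_dim_eigenspace idJ grJ l0) => k /noeig.
rewrite (_ : [set k | _] = set0); last first.
  apply/seteqP; split => // k /= kl; apply: nl.
  have [[k0 _]|[n [n0 kn _ _]]] := spectrumP k.
    by move: l0; rewrite -kl k0 eqxx.
  exists n; rewrite n0 -kl kn fmorphV rmorph_nat divff ?eqxx//.
by rewrite II0.
Qed.

End Spectrum.

(** * Asymptotics *)

Section Growth.
Variable R : realType.
Implicit Types (n k D : nat).

Lemma fact_le_expn n : (n`! <= n ^ n)%N.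
Proof.
elim: n => // n IH; rewrite factS expnS leq_mul2l /= (leq_trans IH)//.
by case: n {IH} => // n; rewrite leq_exp2r.
Qed.

Lemma expn2_le_fact n : (2 ^ n.-1 <= n`!)%N.
Proof.
case: n => // n; elim: n => // n IH.
by rewrite [_.-1]/= expnS factS; apply: leq_mul IH.
Qed.

Lemma ln_le_sqrt (x : R) : 0 < x -> ln x <= 2 * Num.sqrt x.
Proof.
move=> x0; have s0 : 0 < Num.sqrt x by rewrite sqrtr_gt0.
have -> : ln x = 2 * ln (Num.sqrt x).
  by rewrite -[in LHS](sqr_sqrtr (ltW x0)) lnXn// mulr_natl.
by rewrite ler_pM2l// ltW// ln_sublinear.
Qed.

Lemma ln2_gt0 : 0 < ln (2 : R). Proof. by rewrite ln_gt0// ltr1n. Qed.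

(** From n! >= 2^(n-1) and n - 1 >= n / 2. *)
Lemma ln_fact_ge n : (1 < n)%N -> (ln 2 / 2 : R) * n%:R <= ln (n`!%:R).
Proof.
move=> n1; have l2 := ln2_gt0.
apply: (@le_trans _ _ (ln ((2 ^ n.-1)%:R))); last first.
  by rewrite ler_ln ?posrE ?ltr0n ?fact_gt0 ?expn_gt0// ler_nat expn2_le_fact.
rewrite natrX lnXn ?ltr0n// -[_ *+ n.-1]mulr_natl mulrAC ler_pdivrMr//.
rewrite [leLHS]mulrC [leRHS]mulrAC ler_wpM2r ?(ltW l2)// -natrM ler_nat; lia.
Qed.

Lemma lnln_fact_ge n : (1 < n)%N -> ln n%:R + ln (ln 2 / 2 : R) <= ln (ln (n`!%:R)).
Proof.
move=> n1; have l2 : 0 < ln 2 / 2 :> R by rewrite divr_gt0 ?ln2_gt0.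
have n0 : 0 < n%:R :> R by rewrite ltr0n ltnW.
have l0 : 0 < ln (n`!%:R : R).
  by apply: lt_le_trans (ln_fact_ge n1); rewrite mulr_gt0.
by rewrite addrC -lnM ?posrE// ler_ln ?posrE ?mulr_gt0 ?ln_fact_ge ?ln2_gt0 ?invr_gt0.
Qed.

(** From n! <= n^n. The remaining term ln ln n is replaced by a square root, so that the final
    bounds become rational in (ln n)^(-1/2). *)
Lemma lnln_fact_le n : (2 < n)%N ->
  ln (ln (n`!%:R)) <= ln n%:R + 2 * Num.sqrt (ln n%:R) :> R.
Proof.
move=> n2; have n0 : 0 < n%:R :> R by rewrite ltr0n (leq_trans _ n2).
have x0 : 0 < ln n%:R :> R by rewrite ln_gt0// ltr1n (ltn_trans _ n2).
apply: (@le_trans _ _ (ln (n%:R * ln n%:R))).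
  rewrite ler_ln ?posrE ?mulr_gt0//; last first.
    rewrite ln_gt0// ltr1n (leq_trans _ (expn2_le_fact n))//.
    by rewrite (@leq_exp2l 2 1 n.-1)//; lia.
  rewrite mulr_natl -lnXn// -natrX ler_ln ?posrE ?ltr0n ?fact_gt0 ?expn_gt0 ?(ltn_trans _ n2)//.
  by rewrite ler_nat fact_le_expn.
by rewrite lnM ?posrE// lerD2l ln_le_sqrt.
Qed.

Lemma seqV (f : nat -> R) (a : R) : a != 0 -> f @ \oo --> a ->
  (fun n => (f n)^-1) @ \oo --> a^-1.
Proof. by move=> a0 fa; exact: cvgV. Qed.

(** With y = (ln n)^(-1/2), this is (D ln n - c) / (ln n + 2 sqrt (ln n)) after division by ln n;
    [upper_cvg] treats (D ln n + c) / (ln n + e) in the same way. *)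
Lemma lower_cvg D (c : R) (y : nat -> R) : y @ \oo --> (0 : R) ->
  (fun k => (D%:R - c * (y k * y k)) / (1 + 2 * y k)) @ \oo --> (D%:R : R).
Proof.
move=> y0; have := seqM (seqB (seq_cst D%:R) (seqM (seq_cst c) (seqM y0 y0)))
  (seqV _ (seq_add (seq_cst 1) (seqM (seq_cst 2) y0))).
by rewrite !mulr0 addr0 subr0 invr1 mulr1; apply; exact: oner_neq0.
Qed.

Lemma upper_cvg D (c e : R) (y : nat -> R) : y @ \oo --> (0 : R) ->
  (fun k => (D%:R + c * (y k * y k)) / (1 + e * (y k * y k))) @ \oo --> (D%:R : R).
Proof.
move=> y0; have := seqM (seq_add (seq_cst D%:R) (seqM (seq_cst c) (seqM y0 y0)))
  (seqV _ (seq_add (seq_cst 1) (seqM (seq_cst e) (seqM y0 y0)))).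
by rewrite !mulr0 !addr0 invr1 mulr1; apply; exact: oner_neq0.
Qed.

Lemma ln_ratio_cvg D (c1 c2 : R) (nu : nat -> nat) :
  (forall N, \forall k \near \oo, (N < nu k)%N) ->
  (\forall k \near \oo, D%:R * ln (nu k)%:R - c1 <= ln (k.+1%:R : R)
     <= D%:R * ln (nu k)%:R + c2) ->
  (fun k => ln k.+1%:R / ln (ln ((nu k)`!%:R : R))) @ \oo --> (D%:R : R).
Proof.
move=> nuoo bounds.
pose x k : R := ln (nu k)%:R; pose y k := (Num.sqrt (x k))^-1.
have xA A : \forall k \near \oo, A <= x k.
  apply: filterS (nuoo `|Num.ceil (expR A)|%N) => k Nk.
  have eA : expR A <= (nu k)%:R.
    apply: (le_trans (ceil_ge _)); rewrite pmulrn ler_int.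
    apply: le_trans (ler_norm _) _; rewrite -abszE lez_nat; exact: ltnW.
  by rewrite -[A]expRK ler_ln ?posrE ?expR_gt0// (lt_le_trans _ eA)// expR_gt0.
have y0 : y @ \oo --> (0 : R).
  apply/gtr0_cvgV0.
    by apply: filterS (xA 1) => k x1; rewrite sqrtr_gt0 (lt_le_trans _ x1).
  apply/cvgryPge => A; apply: filterS (xA (A ^+ 2)) => k Ak.
  by apply: le_trans (ler_norm _) _; rewrite -sqrtr_sqr ler_wsqrtr.
set e := ln (ln 2 / 2 : R).
apply: (squeeze_cvgr _ (@lower_cvg D c1 y y0) (@upper_cvg D c2 e y y0)).
near=> k.
have x1 : 1 - e <= x k by near: k; exact: xA.
have x1' : 1 <= x k by near: k; exact: xA.
have x0 : 0 < x k by rewrite (lt_le_trans _ x1').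
have n2 : (2 < nu k)%N by near: k; exact: nuoo.
have /andP[b1 b2] : D%:R * x k - c1 <= ln (k.+1%:R : R) <= D%:R * x k + c2.
  by near: k.
have yy : y k * y k = (x k)^-1 by rewrite -invfM -expr2 sqr_sqrtr// ltW.
have K0 : 0 <= ln (k.+1%:R : R) by rewrite ln_ge0// ler1n.
have L1 := lnln_fact_ge (ltnW n2); rewrite -/(x k) -/e in L1.
have L2 := lnln_fact_le n2; rewrite -/(x k) in L2.
have e0 : 0 < x k + e by lra.
have L0 := lt_le_trans e0 L1.
have sx : x k * y k = Num.sqrt (x k).
  rewrite /y -[X in X * _](sqr_sqrtr (ltW x0)) expr2 mulfK//.
  by rewrite gt_eqF// sqrtr_gt0.
have yk0 : 0 < y k by rewrite invr_gt0 sqrtr_gt0.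
apply/andP; split.
  rewrite ler_pdivrMr ?ltr_wpDr//; last by rewrite mulr_ge0// ltW.
  rewrite mulrAC ler_pdivlMr//.
  (* An upper bound for the denominator can be multiplied only by a non-negative factor; in the
     other case the claim holds because ln (k + 1) is non-negative. *)
  have b3 : 0 <= D%:R - c1 * (y k * y k) \/ D%:R - c1 * (y k * y k) <= 0.
    by case: (lerP 0 (D%:R - c1 * (y k * y k))) => [|/ltW]; [left|right].
  have Kx : (D%:R - c1 * (y k * y k)) * x k <= ln k.+1%:R.
    by rewrite mulrBl -(mulrA c1) yy mulVf ?gt_eqF// mulr1.
  have Ly : ln (ln (nu k)`!%:R) <= x k * (1 + 2 * y k).
    by rewrite mulrDr mulr1 mulrCA sx.
  have y2 : 0 < 1 + 2 * y k by lra.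
  case: b3 => b3.
    apply: (le_trans (ler_wpM2l b3 Ly)); rewrite mulrA ler_wpM2r//.
    exact: ltW.
  apply: (@le_trans _ _ 0); first by rewrite mulr_le0_ge0// ltW.
  by rewrite mulr_ge0// ltW.
have e1 : 0 < 1 + e * (y k * y k).
  by rewrite yy -(divff (lt0r_neq0 x0)) -mulrDl divr_gt0.
rewrite ler_pdivrMr// mulrAC ler_pdivlMr//.
have Ex : (x k) * (1 + e * (y k * y k)) = x k + e.
  by rewrite yy mulrDr mulr1 mulrCA divff ?mulr1// gt_eqF.
have Kx : ln k.+1%:R <= (D%:R + c2 * (y k * y k)) * x k.
  by rewrite mulrDl -(mulrA c2) yy mulVf ?gt_eqF// mulr1.
have C0 : 0 <= D%:R + c2 * (y k * y k).
  by rewrite -(pmulr_lge0 _ x0); exact: le_trans K0 Kx.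
apply: (le_trans (ler_wpM2r (ltW e1) Kx)); rewrite -mulrA Ex.
by rewrite ler_wpM2l.
Unshelve. all: by end_near. Qed.

End Growth.

(** * The limit of the quotient of logarithms *)

Section Asymptotics.
Variables (R : realType) (d : nat) (I : {pred polynomials R d}) (D : nat).
Local Notation J := [set p | p \in I].
Local Notation h := (hilb J).
Local Notation mu := (spectrum I).
Hypothesis upper : exists C, forall n, (h n.+1 <= C * n.+1 ^ D)%N.
Hypothesis lower : forall n, (n.+1 ^ D <= h (D * n).+1)%N.

(** Interpolates the lower bound, available at the arguments D n + 1, to all arguments at the cost
    of the constant D^D. *)
Lemma hilb_ge_exp n : (0 < D)%N -> (n.+1 ^ D <= D ^ D * h n.+1)%N.
Proof.
move=> D0; have nD : (n.+1 <= D * (n %/ D).+1)%N by rewrite mulnC ltn_ceil.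
apply: (@leq_trans ((D * (n %/ D).+1) ^ D)); first by rewrite leq_exp2r.
rewrite expnMn leq_mul2l (leq_trans (lower _)) ?orbT//.
by apply: hilb_mono; rewrite ltnS mulnC leq_trunc_div.
Qed.

Lemma spectrum_cvg : (fun k => lne k.+1%:R%:E / lne (lne ((mu k)%:E)^-1))%E @ \oo
  --> (D%:R%:E : \bar R).
Proof.
have [C HC] := upper.
(* If D = 0, then [h] is bounded and mu_k is eventually 0; in the extended reals ln ln (1 / 0) is
   +oo and the quotient is 0. *)
have [D0|D0] := posnP D.
  have near0 : \forall k \near \oo, 0%:E = (lne k.+1%:R%:E / lne (lne ((mu k)%:E)^-1))%E.
    exists C.+1 => // k /= Ck; have [[-> _]|[n [_ _ _ kn]]] := spectrumP I k.
      by rewrite inve0 /= invey mule0.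
    by have := HC n; rewrite D0 expn0 muln1; lia.
  by rewrite {1}D0; apply: cvg_near_cst; apply: filterS near0.
have hk k : (k < h (D * k).+1)%N.
  by apply: leq_trans (lower k); rewrite -[ltnLHS]expn1 -[X in (X <= _)%N]expn1 leq_pexp2l.
have /choice[nu Hnu] k : exists n, [/\ (0 < n)%N, mu k = (n`!%:R)^-1,
    (h (lowdeg n) <= k)%N & (k < h n.+1)%N].
  have [[_ H]|//] := spectrumP I k.
  by have := hk k; rewrite ltnNge H.
have nuoo N : \forall k \near \oo, (N < nu k)%N.
  exists (h N.+1) => // k /= Nk; rewrite ltnNge; apply/negP => kN.
  have [_ _ _] := Hnu k; rewrite ltnNge (leq_trans _ Nk)//.
  by apply: hilb_mono; rewrite ltnS.
(* For nu k = n > 1 the block bounds are h(n) <= k < h(n + 1). D^D comes from [hilb_ge_exp], and 2^D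
   from (n + 1)^D <= (2n)^D. *)
have ratio := @ln_ratio_cvg R D (ln (D ^ D)%:R) (ln (C * 2 ^ D)%:R) nu nuoo.
have {}ratio : (fun k => ln k.+1%:R / ln (ln ((nu k)`!%:R : R))) @ \oo --> (D%:R : R).
  apply: ratio; apply: filterS (nuoo 1) => k nk.
  have [nu0 _ lo hi] := Hnu k.
  have n0 : 0 < (nu k)%:R :> R by rewrite ltr0n.
  rewrite lerBlDr mulr_natl -lnXn// -natrX.
  have C0 : (0 < C)%N.
    rewrite lt0n; apply/eqP => C0; have := leq_trans hi (HC (nu k)).
    by rewrite C0 mul0n.
  rewrite -!lnM ?posrE ?ltr0n ?muln_gt0 ?expn_gt0 ?C0 ?D0 ?nu0//.
  rewrite !ler_ln ?posrE -?natrM ?ltr0n ?muln_gt0 ?expn_gt0 ?C0 ?D0 ?nu0//.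
  rewrite !ler_nat; apply/andP; split.
    have := @hilb_ge_exp (nu k).-1 D0; rewrite prednK// => H.
    rewrite (leq_trans H)// mulnC leq_mul2r; apply/orP; right.
    by rewrite (leq_trans _ (leqnSn _))// (leq_trans _ lo)// /lowdeg [(nu k <= 1)%N]leqNgt nk.
  apply: leq_trans hi _; apply: leq_trans (HC _) _.
  rewrite [leqRHS]mulnC -mulnA leq_mul2l; apply/orP; right.
  by rewrite -expnMn leq_exp2r//; lia.
have {}ratio : (fun k => (ln k.+1%:R / ln (ln ((nu k)`!%:R : R)))%:E) @ \oo
    --> (D%:R%:E : \bar R).
  by apply: cvg_EFin; [exact: nearW|exact: ratio].
apply: cvg_trans ratio; apply: near_eq_cvg.
(* Beyond 2 / ln 2 one has ln n! > 1, so the iterated logarithm is positive and the extended-real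
   operations agree with the real ones. *)
apply: filterS2 (nuoo 2) (nuoo `|Num.ceil (2 / ln (2 : R))|%N) => k nk Nk.
have [nu0 mk _ _] := Hnu k.
have f1 : 1 < (nu k)`!%:R :> R.
  by rewrite ltr1n; apply: (@lt_fact 1) => //; exact: leq_trans nk.
have f0 : 0 < (nu k)`!%:R :> R by exact: lt_trans f1.
have l1 : 0 < ln ((nu k)`!%:R : R) by rewrite ln_gt0.
have l2 : 0 < ln (ln ((nu k)`!%:R : R)).
  rewrite ln_gt0//; apply: lt_le_trans (ln_fact_ge R (ltnW nk)).
  rewrite mulrAC ltr_pdivlMr// mul1r mulrC -ltr_pdivrMr ?ln2_gt0//.
  apply: (le_lt_trans (ceil_ge _)); rewrite [ltRHS]pmulrn ltr_int.
  by apply: (le_lt_trans (ler_norm _)); rewrite -abszE ltz_nat.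
rewrite mk [((_)^-1)%:E^-1%E]inver invr_eq0 (gt_eqF f0) invrK.
by rewrite !lne_EFin// inver (gt_eqF l2) -EFinM.
Qed.

End Asymptotics.

Lemma complex_dimE (R : realType) d (Z : set ('I_d -> R[i])) D :
  (exists W, irreducible_chain Z W D) ->
  (forall W n, irreducible_chain Z W n -> (n <= D)%N) ->
  complex_dim Z = D%:R%:E.
Proof.
move=> [W HW] HD; apply/eqP; rewrite eq_le; apply/andP; split.
  apply: ge_ereal_sup => _ /= [n [V HV] <-]; rewrite lee_fin ler_nat.
  exact: HD HV.
by apply: ereal_sup_ubound; exists D => //; exists W.
Qed.

Theorem proposition1p2 (R : realType) (d : nat)
    (I : {pred polynomials R d}) (homI : homogeneous_ideal I)
    (mu : nat -> R)
    (muE : mu = singular_values (fock_space R d)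
                  (L_op (Q_space I) (S_tuple I) (e_vector I))) :
  (fun k : nat =>
     (lne k.+1%:R%:E / lne (lne ((mu k)%:E)^-1))%E) @ \oo
    --> complex_dim (zero_locus I).
Proof.
have [idJ grJ [D [upper lower chain maxchain]]] :=
  hilbert_dimension (@uncountable_complex R) homI.
rewrite (complex_dimE chain maxchain) muE.
rewrite (singular_valuesE (spectrum_listing idJ grJ)).
exact: spectrum_cvg upper lower.
Qed.
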